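(* Assume that $f=\mathfrak d+b$ and $\sigma$ satisfy Hypothesis (A), that $\psi$ satisfies Hypothesis (P), and that $G$ satisfies Hypothesis (G) (all stated in the context). Let $x\in\overline G$ and consider the ergodic BSDE $$Y_t=Y_T+\int_t^T[\psi(X_s^x,Z_s)-\lambda]\,ds-\int_t^T Z_s\,dW_s,\qquad \forall\,0\le t\le T<+\infty .$$ 1. $\lambda$ is unique among solutions $(Y,Z,\lambda)$ such that $Y$ is a bounded continuous process and $Z\in\mathscr M^2(\mathbb R_+,\mathbb R^{1\times d})$. 2. More generally, let $(Y,Z,\lambda)$ and $(Y',Z',\lambda')$ be two solutions with $Y,Y'$ continuous progressively measurable and $Z,Z'\in\mathscr M^2(\mathbb R_+,\mathbb R^{1\times d})$, and assume that there are constants $C,C'$ such that, $\mathbb P$-a.s. for all $t\ge0$, $$|Y_t|\le C(1+|X_t^x|^2),\qquad |Y'_t|\le C'(1+|X_t^x|^2).$$ Then $\lambda=\lambda'$.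
   Context: $d\ge 1$ is an integer; $(\cdot,\cdot)$ and $|\cdot|$ are the Euclidean scalar product and norm ($|\cdot|$ also denotes a norm on matrices), and $|||\cdot|||$ is the operator norm on $\mathbb R^{d\times d}$; for the matrix field $\sigma^{-1}$, $|||\sigma^{-1}|||$ means $\sup_x|||\sigma^{-1}(x)|||$. $(\Omega,\mathcal F,\mathbb P)$ is a complete probability space carrying a standard $\mathbb R^d$-valued Brownian motion $W$, and $(\mathcal F_t)_{t\ge0}$ is its natural filtration augmented by the null sets. $\mathscr M^2(\mathbb R_+,\mathbb R^{1\times d})$ is the space of progressively measurable $\mathbb R^{1\times d}$-valued processes $Z$ with $\mathbb E\int_0^T|Z_s|^2ds<\infty$ for all $T>0$. Hypothesis (A), on $f=\mathfrak d+b:\mathbb R^d\to\mathbb R^d$ and $\sigma:\mathbb R^d\to\mathbb R^{d\times d}$: (i) $\mathfrak d:\mathbb R^d\to\mathbb R^d$ is $\eta$-dissipative for some $\eta>0$, i.e. $(\mathfrak d(x)-\mathfrak d(x'),x-x')\le-\eta|x-x'|^2$ for all $x,x'$; it is locally Lipschitz and has polynomial growth: there are $C,\nu>0$ with $|\mathfrak d(x)|\le C(1+|x|^\nu)$ for all $x$; (ii) $b:\mathbb R^d\to\mathbb R^d$ is Lipschitz and $|b|$ is bounded by $B$; (iii) $\sigma$ is Lipschitz, $\sigma(x)$ is invertible for every $x$, and $|\sigma|$ and $|\sigma^{-1}|$ are bounded by $\sigma_\infty$; (iv) there exists $\Lambda\ge0$ such that $|(y,\sigma(x+y)-\sigma(x))|\le\Lambda|y|$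 for all $x,y\in\mathbb R^d$, where $(y,M)$ denotes the row vector ${}^t y\,M$, and there exists $\lambda_0>0$ such that $2(\lambda_0-\lambda_0^2\Lambda^2)>|||\sigma^{-1}|||^2$. Hypothesis (P), on $\psi:\mathbb R^d\times\mathbb R^{1\times d}\to\mathbb R$: $\psi$ is measurable and there exists $M_\psi\in\mathbb R$ such that for all $x\in\mathbb R^d$ and $z,z'\in\mathbb R^{1\times d}$: $\psi(\cdot,z)$ is continuous, $|\psi(x,0)|\le M_\psi$, and $|\psi(x,z)-\psi(x,z')|\le M_\psi|z-z'|$. Hypothesis (G): $G$ is an open convex subset of $\mathbb R^d$ (not necessarily bounded), and there is a $C^2$ function $\phi:\mathbb R^d\to\mathbb R$ with bounded partial derivatives such that $G=\{\phi>0\}$, $\partial G=\{\phi=0\}$ and $|\nabla\phi(x)|=1$ for all $x\in\partial G$. For $x\in\overline G$, $(X^x,K^x)$ is the unique continuous adapted solution, with $X^x$ valued in $\overline G$ and $K^x$ real-valued, non-decreasing and starting from $0$, of the reflected SDE $$X_t^x=x+\int_0^t f(X_s^x)ds+\int_0^t\sigma(X_s^x)dW_s+\int_0^t\nabla\phi(X_s^x)dK_s^x,\qquad K_t^x=\int_0^t\mathbf 1_{\{X_s^x\in\partial G\}}dK_s^x,\quad t\ge0.$$ *)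

(* Defs.v *)
From HB Require Import structures.
From mathcomp Require Import all_boot all_order all_algebra.
From mathcomp Require Import all_classical all_reals all_analysis.

Set Implicit Arguments.
Unset Strict Implicit.
Unset Printing Implicit Defensive.

Import Order.TTheory GRing.Theory Num.Theory.
Import numFieldNormedType.Exports.

Local Open Scope classical_set_scope.
Local Open Scope ring_scope.

(* R^d is 'cV[R]_d and R^{1 x d} is 'rV[R]_d.  The library norm `|.| on matrices
   is the max norm; topology, continuity and the Lipschitz property do not depend
   on the choice of the norm, everything quantitative uses the norms below. *)
Section euclidean.
Context {R : realType}.

Definition dotp d (x y : 'cV[R]_d) : R := \sum_i x i 0 * y i 0.

(* Euclidean norm of vectors, Frobenius norm of matrices *)
Definition enorm m n (A : 'M[R]_(m, n)) : R :=
  Num.sqrt (\sum_i \sum_j A i j ^+ 2).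

Definition opnorm m n (A : 'M[R]_(m, n)) : R :=
  sup [set enorm (A *m v) | v in [set v : 'cV[R]_n | enorm v <= 1]].

Definition partial d (i : 'I_d) (phi : 'cV[R]_d -> R) : 'cV[R]_d -> R :=
  'D_(delta_mx i 0) (phi : 'cV[R]_d -> R^o).

Definition has_partial d (i : 'I_d) (phi : 'cV[R]_d -> R) : Prop :=
  forall x, derivable (phi : 'cV[R]_d -> R^o) x (delta_mx i 0).

Definition grad d (phi : 'cV[R]_d -> R) (x : 'cV[R]_d) : 'cV[R]_d :=
  \col_i partial i phi x.

Definition C2_fun d (phi : 'cV[R]_d -> R) : Prop :=
  [/\ forall i, has_partial i phi,
      forall i, continuous (partial i phi),
      forall i j, has_partial i (partial j phi) &
      forall i j, continuous (partial i (partial j phi))].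

Definition boundary (T : topologicalType) (A : set T) : set T :=
  closure A `\` interior A.

End euclidean.

Section hypotheses.
Context {R : realType} {d : nat}.
Implicit Types (x y : 'cV[R]_d) (z : 'rV[R]_d).

Definition dissipative (eta : R) (dd : 'cV[R]_d -> 'cV[R]_d) : Prop :=
  forall x x', dotp (dd x - dd x') (x - x') <= - eta * enorm (x - x') ^+ 2.

Record hypA (dd b : 'cV[R]_d -> 'cV[R]_d) (sigma : 'cV[R]_d -> 'M[R]_d) : Prop := {
  hypA_dissipative : exists2 eta, 0 < eta & dissipative eta dd;
  hypA_local_lipschitz :
    forall x, exists2 U, nbhs x U & [lipschitz dd y | y in U];
  hypA_growth : exists C nu, [/\ 0 < C, 0 < nu &
    forall x, enorm (dd x) <= C * (1 + enorm x `^ nu)];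
  hypA_b_lipschitz : lipschitz b;
  hypA_b_bounded : exists B, forall x, enorm (b x) <= B;
  hypA_sigma_lipschitz : lipschitz sigma;
  hypA_sigma_invertible : forall x, sigma x \in unitmx;
  hypA_sigma_bounded : exists sigma_infty, forall x,
    enorm (sigma x) <= sigma_infty /\ enorm (invmx (sigma x)) <= sigma_infty;
  hypA_Lambda : exists Lambda lambda0, [/\ 0 <= Lambda,
    forall x y, enorm (y^T *m (sigma (x + y) - sigma x)) <= Lambda * enorm y,
    0 < lambda0 &
    2 * (lambda0 - lambda0 ^+ 2 * Lambda ^+ 2) >
      sup (range (fun x => opnorm (invmx (sigma x)))) ^+ 2]
}.

(* measurability is with respect to the Borel sigma-algebra of R^d x R^{1 x d} *)
Definition hypP (psi : 'cV[R]_d -> 'rV[R]_d -> R) : Prop :=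
  measurable_fun
    [set: g_sigma_algebraType (@open ('cV[R]_d * 'rV[R]_d)%type)]
    (fun p => psi p.1 p.2) /\
  exists M : R, forall x z z',
    [/\ continuous (psi^~ z),
        `|psi x 0| <= M &
        `|psi x z - psi x z'| <= M * enorm (z - z')].

Record hypG (G : set 'cV[R]_d) (phi : 'cV[R]_d -> R) : Prop := {
  hypG_open : open G;
  hypG_convex : convex_set G;
  hypG_C2 : C2_fun phi;
  hypG_bounded : exists M : R, forall x i j,
    `|partial i phi x| <= M /\ `|partial i (partial j phi) x| <= M;
  hypG_domain : G = [set x | 0 < phi x];
  hypG_boundary : boundary G = [set x | phi x = 0];
  hypG_normal : forall x, boundary G x -> enorm (grad phi x) = 1
}.

End hypotheses.

(* Processes are indexed by R, only times t >= 0 being relevant.  A filtration is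
   a family F of sigma-algebras; g_sigma_algebraType (F t) is Omega equipped with
   F t. *)
Section processes.
Context {R : realType} {dO : measure_display} {Omega : measurableType dO}.
Variables (P : probability Omega R) (F : R -> set_system Omega).

Definition adapted (Y : R -> Omega -> R) : Prop :=
  forall t, 0 <= t -> measurable_fun [set: g_sigma_algebraType (F t)] (Y t).

Definition progressive (Y : R -> Omega -> R) : Prop :=
  forall t, 0 <= t ->
    measurable_fun (`[0, t] `*` [set: g_sigma_algebraType (F t)])
      (fun p => Y p.1 p.2).

Definition continuous_process (V : topologicalType) (X : R -> Omega -> V) : Prop :=
  forall w, {within `[0, +oo[, continuous (X ^~ w)}.

Definition M2 m n (Z : R -> Omega -> 'M[R]_(m, n)) : Prop :=
  (forall i j, progressive (fun t w => Z t w i j)) /\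
  forall T, 0 < T ->
    (\int[P]_w \int[lebesgue_measure]_(s in `[0%R, T])
       (enorm (Z s w) ^+ 2)%:E < +oo)%E.

End processes.

Section brownian_motion.
Context {R : realType} {dO : measure_display} {Omega : measurableType dO}.
Variable P : probability Omega R.
Context {d : nat}.
Variable W : R -> Omega -> 'cV[R]_d.

Definition bm_events (t : R) : set_system Omega :=
  [set A | exists s i B, [/\ 0 <= s <= t, measurable B &
                             A = [set w | B (W s w i 0)]]].

(* The last field says that W t - W s is independent of sigma(W u, u <= s) and
   has law N(0, (t - s) I_d). *)
Record brownian_motion : Prop := {
  bm_measurable : forall t i, 0 <= t -> measurable_fun setT (fun w => W t w i 0);
  bm_start : {ae P, forall w, W 0 w = 0};
  bm_continuous : {ae P, forall w, {within `[0, +oo[, continuous (W ^~ w)}};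
  bm_increments : forall s t, 0 <= s < t ->
    forall A, <<s bm_events s >> A ->
    forall B : 'I_d -> set R, (forall i, measurable (B i)) ->
    P (A `&` [set w | forall i, B i (W t w i 0 - W s w i 0)]) =
    (P A * \big[mule/1]_(i < d) normal_prob 0 (Num.sqrt (t - s)) (B i))%E
}.

Definition bm_filtration (t : R) : set_system Omega :=
  <<s bm_events t `|` P.-negligible >>.

End brownian_motion.

Section ito_integral.
Context {R : realType} {dO : measure_display} {Omega : measurableType dO}.
Variables (P : probability Omega R) (F : R -> set_system Omega).
Context {d : nat}.
Variable W : R -> Omega -> 'cV[R]_d.

Record simple_process (m : nat) := SimpleProcess {
  sp_size : nat;
  sp_time : nat -> R;
  sp_coef : nat -> Omega -> 'M[R]_(m, d);
  sp_time_ge0 : 0 <= sp_time 0;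
  sp_time_nondecreasing : forall k, sp_time k <= sp_time k.+1;
  sp_coef_measurable : forall k i j,
    measurable_fun [set: g_sigma_algebraType (F (sp_time k))]
      (fun w => sp_coef k w i j);
  sp_coef_bounded : exists C, forall k w, enorm (sp_coef k w) <= C
}.

Definition simple_val m (S : simple_process m) (s : R) (w : Omega) : 'M[R]_(m, d) :=
  \sum_(k < sp_size S)
    \1_(`]sp_time S k, sp_time S k.+1]) s *: sp_coef S k w.

Definition simple_ito m (S : simple_process m) (t : R) (w : Omega) : 'cV[R]_m :=
  \sum_(k < sp_size S) sp_coef S k w *m
    (W (Num.min (sp_time S k.+1) t) w - W (Num.min (sp_time S k) t) w).

(* I is (a continuous version of) the process t |-> \int_0^t H_s dW_s, for H in
   M2: the L^2 limit of integrals of simple processes approximating H. *)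
Definition ito_integral m (H : R -> Omega -> 'M[R]_(m, d))
    (I : R -> Omega -> 'cV[R]_m) : Prop :=
  [/\ M2 P F H,
      forall i, adapted F (fun t w => I t w i 0),
      continuous_process I &
      forall t, 0 <= t -> exists S : nat -> simple_process m,
        (fun n => \int[P]_w \int[lebesgue_measure]_(s in `[0%R, t])
           (enorm (simple_val (S n) s w - H s w) ^+ 2)%:E)%E @ \oo --> 0%E /\
        (fun n => \int[P]_w
           (enorm (simple_ito (S n) t w - I t w) ^+ 2)%:E)%E @ \oo --> 0%E].

End ito_integral.

Section equations.
Context {R : realType} {dO : measure_display} {Omega : measurableType dO}.
Variables (P : probability Omega R).
Context {d : nat}.
Variable W : R -> Omega -> 'cV[R]_d.
Local Notation F := (bm_filtration P W).

(* The path t |-> K w t is extended by 0 to negative times, so that dK w is a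
   Lebesgue-Stieltjes measure on R. *)
Record reflected_sde (f : 'cV[R]_d -> 'cV[R]_d) (sigma : 'cV[R]_d -> 'M[R]_d)
    (G : set 'cV[R]_d) (phi : 'cV[R]_d -> R) (x : 'cV[R]_d)
    (X : R -> Omega -> 'cV[R]_d) (K : Omega -> cumulative R R) : Prop := {
  rsde_X_adapted : forall i, adapted F (fun t w => X t w i 0);
  rsde_X_continuous : continuous_process X;
  rsde_X_closure : forall t w, 0 <= t -> closure G (X t w);
  rsde_K_adapted : adapted F (fun t w => K w t);
  rsde_K_continuous : forall w, continuous (K w);
  rsde_K_start : forall t w, t <= 0 -> K w t = 0;
  rsde_equation : exists2 I, ito_integral P F W (fun t w => sigma (X t w)) I &
    {ae P, forall w, forall t, 0 <= t ->
      X t w = x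
        + \col_i \int[lebesgue_measure]_(s in `[0, t]) f (X s w) i 0
        + I t w
        + \col_i \int[lebesgue_stieltjes_measure (K w)]_(s in `[0, t])
                   grad phi (X s w) i 0};
  rsde_K_boundary : {ae P, forall w, forall t, 0 <= t ->
    K w t = \int[lebesgue_stieltjes_measure (K w)]_(s in `[0, t])
              \1_(boundary G) (X s w)}
}.

Definition ergodic_bsde (psi : 'cV[R]_d -> 'rV[R]_d -> R)
    (X : R -> Omega -> 'cV[R]_d) (Y : R -> Omega -> R)
    (Z : R -> Omega -> 'rV[R]_d) (lambda : R) : Prop :=
  exists2 I, ito_integral P F W Z I &
    {ae P, forall w, forall t T, 0 <= t <= T ->
      Y t w = Y T w
        + \int[lebesgue_measure]_(s in `[t, T]) (psi (X s w) (Z s w) - lambda)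
        - (I T w 0 0 - I t w 0 0)}.

End equations.

(* Main.v *)
(* Suppose l := lam - lam' > 0 and let Yh, Zh be the differences of the two solutions.  As psi is
   Lipschitz in z, the equation gives, for every T,
     l T <= Yh_T - Yh_0 + M int_0^T |Zh| ds - int_0^T Zh dW.
   Girsanov's theorem would remove the last two terms.  Its discrete analogue is elementary:
   Zh is approximated by a simple process with values s_i on a fine grid, and D is the product of
   the factors 1 + sum_j u_ij (1_{dW_ij > 0} - P(dW_ij > 0)), where u_i, a multiple of
   s_i / |s_i|, is chosen so that E[D sum_i (s_i dW_i - M |s_i| dt_i)] = 0.  Hence l T <= E[D Yh_T] + const.
   The right-hand side is bounded independently of T because |X - x|^2 is a Lyapunov function which
   survives the change of density: dissipativity gives
     d|X - x|^2 <= (C - eta |X - x|^2) dt + 2 (X - x) sigma dW + |sigma|^2 dt,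
   the reflection term being <= 0 since (y - x) . grad phi(y) <= 0 on the boundary of the convex set
   G, and the tilt |u_i| = O(sqrt dt) is absorbed by half of the contraction.  Localisation at the
   first grid time where |X - x|^2 is large costs nothing in the limit, since D has moments of order
   4 which do not depend on the mesh.  Letting T tend to infinity yields a contradiction. *)

Require Import Defs.
From mathcomp Require Import all_boot all_order all_algebra.
From mathcomp Require Import all_classical all_reals all_analysis.
From mathcomp Require Import measurable_realfun ring lra.

Set Implicit Arguments.
Unset Strict Implicit.
Unset Printing Implicit Defensive.

Import Order.TTheory GRing.Theory Num.Theory.
Import numFieldNormedType.Exports.

Local Open Scope classical_set_scope.
Local Open Scope ring_scope.

(** * Expectations of real random variables *)

(** The density is built from signs of the increments, not from the increments, because its factors
    must stay nonnegative, which a factor linear in a Gaussian does not. A sign has covariance of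
    order sqrt dt with its increment, so tilts of order sqrt dt produce a drift of order dt. Their
    squares add up to O(T), hence the fourth moment of D is bounded in terms of T alone. Order 4 is
    what Young's inequality requires for the product of D, a square integrable variable and the
    indicator of a rare event. No moment of X is estimated. The square integrability of Yh_T is read
    off from the equation, and |X - x|^2 enters through a recursion which only contracts once a
    level has been exceeded and which dominates |X - x|^2 outside two rare events. The stochastic
    integrals are given as L^2 limits, for each time separately. Their conditional means and
    variances are therefore recovered from step processes on common grids, with constants that are
    not sharp. *)

Section expectation.
Context {R : realType} {dO : measure_display} {Omega : measurableType dO}.
Variable P : probability Omega R.
Implicit Types (f g h : Omega -> R).

Definition rint f := P.-integrable setT (EFin \o f).
Definition rE f : R := Rintegral P setT f.

Lemma rint_meas f : rint f -> measurable_fun setT f.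
Proof. by move=> /integrableP[/measurable_EFinP]. Qed.

Lemma rint_le f g : measurable_fun setT f -> (forall w, `|f w| <= g w) ->
  rint g -> rint f.
Proof.
move=> mf fg; apply: le_integrable => //; first exact/measurable_EFinP.
by move=> w _; rewrite /= lee_fin (le_trans (fg w))// ler_norm.
Qed.

Lemma rint_cst c : rint (fun=> c).
Proof.
have := finite_measure_integrable_cst P c.
by apply.
Qed.

Lemma rintD f g : rint f -> rint g -> rint (fun w => f w + g w).
Proof. by move=> fi gi; have := integrableD measurableT fi gi. Qed.

Lemma rintZ k f : rint f -> rint (fun w => k * f w).
Proof. by move=> fi; have := integrableZl measurableT k fi. Qed.

Lemma rintN f : rint f -> rint (fun w => - f w).
Proof. by move=> fi; have := integrableN fi. Qed.

Lemma rintB f g : rint f -> rint g -> rint (fun w => f w - g w).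
Proof. by move=> fi /rintN; exact: rintD. Qed.

Lemma rint_norm f : rint f -> rint (fun w => `|f w|).
Proof. by move=> fi; have := integrable_abse fi. Qed.

Lemma rint_sum (I : Type) (s : seq I) (F : I -> Omega -> R) :
  (forall i, rint (F i)) -> rint (fun w => \sum_(i <- s) F i w).
Proof.
move=> Fi; elim: s => [|i s IH].
  by under eq_fun do rewrite big_nil; exact: rint_cst.
by under eq_fun do rewrite big_cons; exact: rintD.
Qed.

Lemma rintM_bdd M h g : measurable_fun setT h -> (forall w, `|h w| <= M) ->
  rint g -> rint (fun w => h w * g w).
Proof.
move=> mh hM gi.
apply: (@rint_le _ (fun w => M * `|g w|)); last exact/rintZ/rint_norm.
- by apply: measurable_funM => //; exact: rint_meas.
- by move=> w; rewrite normrM ler_wpM2r.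
Qed.

Lemma rED f g : rint f -> rint g -> rE (fun w => f w + g w) = rE f + rE g.
Proof. by move=> fi gi; rewrite /rE RintegralD. Qed.

Lemma rEB f g : rint f -> rint g -> rE (fun w => f w - g w) = rE f - rE g.
Proof. by move=> fi gi; rewrite /rE RintegralB. Qed.

Lemma rEZ k f : rint f -> rE (fun w => k * f w) = k * rE f.
Proof. by move=> fi; rewrite /rE RintegralZl. Qed.

Lemma rE_cst c : rE (fun=> c) = c.
Proof.
rewrite /rE Rintegral_cst//; have := probability_setT P.
by rewrite /= => ->; rewrite /= mulr1.
Qed.

Lemma rE_sum (I : Type) (s : seq I) (F : I -> Omega -> R) :
  (forall i, rint (F i)) ->
  rE (fun w => \sum_(i <- s) F i w) = \sum_(i <- s) rE (F i).
Proof.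
move=> Fi; elim: s => [|i s IH].
  by under eq_fun do rewrite big_nil; rewrite big_nil rE_cst.
under eq_fun do rewrite big_cons.
by rewrite big_cons rED// ?IH//; exact: rint_sum.
Qed.

Lemma rE_ge0 f : (forall w, 0 <= f w) -> 0 <= rE f.
Proof. by move=> f0; apply: Rintegral_ge0. Qed.

Lemma rE_le f g : rint f -> rint g -> (forall w, f w <= g w) -> rE f <= rE g.
Proof. by move=> fi gi fg; apply: le_Rintegral. Qed.

Lemma rEfin f : rint f -> (\int[P]_w (f w)%:E)%E = (rE f)%:E.
Proof. by move=> fi; rewrite /rE /Rintegral fineK// integrable_fin_num. Qed.

Lemma rE_le_ae f g : rint f -> rint g -> {ae P, forall w, f w <= g w} ->
  rE f <= rE g.
Proof.
move=> fi gi fg.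
(* The maximum equals [g] almost surely and dominates [f] everywhere, so a pointwise comparison
   suffices. *)
pose h := fun w => Num.max (f w) (g w).
have mh : measurable_fun setT h.
  by apply: measurable_maxr; apply: rint_meas.
have hi : rint h.
  apply: (@rint_le _ (fun w => `|f w| + `|g w|)) => //; last first.
    by apply: rintD; exact: rint_norm.
  move=> w; rewrite /h; case: (leP (f w) (g w)) => _.
    by rewrite lerDr.
  by rewrite lerDl.
have -> : rE g = rE h.
  rewrite /rE /Rintegral; congr fine; apply: ae_eq_integral => //.
  - exact/measurable_EFinP/rint_meas.
  - exact/measurable_EFinP.
  - move: fg; apply: filterS => w fgw _; rewrite /h.
    by move: fgw; case: (leP (f w) (g w)).
by apply: rE_le => // w; rewrite /h le_max lexx.
Qed.

Lemma rint_lty f : measurable_fun setT f -> (forall w, 0 <= f w) ->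
  (\int[P]_w (f w)%:E < +oo)%E -> rint f.
Proof.
move=> mf f0 fi; apply/integrableP; split; first exact/measurable_EFinP.
by under eq_integral do rewrite /= ger0_norm//.
Qed.

Definition sqint f := measurable_fun setT f /\ rint (fun w => f w ^+ 2).

Lemma sqintM f g : sqint f -> sqint g -> rint (fun w => f w * g w).
Proof.
move=> [mf fi] [mg gi].
apply: (@rint_le _ (fun w => f w ^+ 2 + g w ^+ 2)); last exact: rintD.
- exact: measurable_funM.
- move=> w; rewrite normrM -(real_normK (num_real (f w))).
  rewrite -(real_normK (num_real (g w))).
  by have := sqr_ge0 (`|f w| - `|g w|); have := sqr_ge0 (`|f w| + `|g w|); nra.
Qed.

Lemma sqint_bdd M f : measurable_fun setT f -> (forall w, `|f w| <= M) -> sqint f.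
Proof.
move=> mf fM; split=> //; apply: (@rint_le _ (fun=> M ^+ 2)); last exact: rint_cst.
- exact: measurable_funX.
- move=> w; rewrite normrX; apply: lerXn2r => //; rewrite ?nnegrE//.
  exact: le_trans (fM w).
Qed.

Lemma sqint_cst c : sqint (fun=> c).
Proof. by apply: (@sqint_bdd `|c|). Qed.

Lemma sqint_rint f : sqint f -> rint f.
Proof.
move=> fi; have := sqintM (sqint_cst 1) fi.
by under eq_fun do rewrite mul1r.
Qed.

Lemma sqintM_bdd M h g : measurable_fun setT h -> (forall w, `|h w| <= M) ->
  sqint g -> sqint (fun w => h w * g w).
Proof.
move=> mh hM [mg gi]; split; first exact: measurable_funM.
under eq_fun do rewrite exprMn.
apply: (@rintM_bdd (M ^+ 2)) => //; first exact: measurable_funX.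
move=> w; rewrite normrX; apply: lerXn2r => //; rewrite ?nnegrE//.
exact: le_trans (hM w).
Qed.

Lemma sqintZ k f : sqint f -> sqint (fun w => k * f w).
Proof. by apply: (@sqintM_bdd `|k|). Qed.

Lemma sqintD f g : sqint f -> sqint g -> sqint (fun w => f w + g w).
Proof.
move=> fi gi; have [mf f2] := fi; have [mg g2] := gi.
split; first exact: measurable_funD.
under eq_fun do rewrite sqrrD.
apply: rintD => //; apply: rintD => //.
under eq_fun do rewrite -mulr_natl.
by apply: rintZ; exact: sqintM.
Qed.

Lemma sqintB f g : sqint f -> sqint g -> sqint (fun w => f w - g w).
Proof.
move=> fi gi; under eq_fun do rewrite -mulN1r.
by apply: sqintD => //; exact: sqintZ.
Qed.

Lemma sqint_sum (I : Type) (s : seq I) (F : I -> Omega -> R) :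
  (forall i, sqint (F i)) -> sqint (fun w => \sum_(i <- s) F i w).
Proof.
move=> Fi; elim: s => [|i s IH].
  by under eq_fun do rewrite big_nil; exact: sqint_cst.
by under eq_fun do rewrite big_cons; exact: sqintD.
Qed.

Lemma sqint_norm f : sqint f -> sqint (fun w => `|f w|).
Proof.
move=> [mf fi]; split; first exact: measurableT_comp.
by under eq_fun do rewrite real_normK ?num_real//.
Qed.

(** From the square of [del * f - g], giving up a factor 1/2. The free weight lets a small error [g]
    be paired with an [f] of merely finite second moment. *)
Lemma rE_young del f g : 0 < del -> sqint f -> sqint g ->
  rE (fun w => f w * g w) <= del * rE (fun w => f w ^+ 2) +
                              del^-1 * rE (fun w => g w ^+ 2).
Proof.
move=> d0 fi gi; have [mf f2] := fi; have [mg g2] := gi.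
rewrite -!rEZ// -rED; [|exact: rintZ..].
apply: rE_le; [exact: sqintM|by apply: rintD; exact: rintZ|].
move=> w; have d1 : del * del^-1 = 1 by rewrite divff// gt_eqF.
have di : 0 < del^-1 by rewrite invr_gt0.
have : 0 <= del^-1 * (del * f w - g w) ^+ 2 by rewrite mulr_ge0 ?sqr_ge0 ?ltW.
have -> : del^-1 * (del * f w - g w) ^+ 2 =
  (del * del^-1) * del * f w ^+ 2 - 2 * (del * del^-1) * (f w * g w) + del^-1 * g w ^+ 2 by ring.
rewrite d1 !mul1r mulr1.
have : 0 <= del * f w ^+ 2 by rewrite mulr_ge0 ?sqr_ge0 ?ltW.
have : 0 <= del^-1 * g w ^+ 2 by rewrite mulr_ge0 ?sqr_ge0 ?ltW.
by lra.
Qed.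

Lemma indic_le1 (A : set Omega) w : `|\1_A w : R| <= 1.
Proof. by rewrite indicE; case: (_ \in _); rewrite ?normr1 ?normr0. Qed.

Lemma rint_indic (A : set Omega) : measurable A -> rint (\1_A : Omega -> R).
Proof.
move=> mA; apply: (@rint_le _ (fun=> 1)); last exact: rint_cst.
- exact: measurable_indic.
- by move=> w; exact: indic_le1.
Qed.

Lemma rE_indic (A : set Omega) : measurable A -> rE (\1_A : Omega -> R) = fine (P A).
Proof. by move=> mA; rewrite /rE /Rintegral integral_indic// setIT. Qed.

(** Dominated convergence with bound 1. It turns facts known path by path (small defects on fine
    grids, bounded paths) into small probabilities of the exceptional events. *)
Lemma rE_cvg0 (A : nat -> set Omega) : (forall n, measurable (A n)) ->
  {ae P, forall w, \forall n \near \oo, ~ A n w} ->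
  (fun n => fine (P (A n))) @ \oo --> (0 : R).
Proof.
move=> mA hA.
have -> : (fun n => fine (P (A n))) = (fun n => rE (\1_(A n) : Omega -> R)).
  by apply/funext => n; rewrite rE_indic.
pose F n w := (\1_(A n) w : R)%:E.
have mF n : measurable_fun setT (F n) by exact/measurable_EFinP/measurable_indic.
have Fcvg : {ae P, forall w, setT w -> F ^~ w @ \oo --> 0%E}.
  apply: filterS hA => w hw _; apply: cvg_near_cst.
  by apply: filterS hw => n nA; rewrite /F indicE memNset.
have Fle : {ae P, forall w n, setT w -> (`|F n w| <= cst 1%E w)%E}.
  by apply: aeW => w n _; rewrite lee_fin; exact: indic_le1.
have [_ _] := dominated_convergence measurableT mF (measurable_cst _) Fcvg
  (rint_cst 1) Fle.
by rewrite integral0 => /fine_cvg.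
Qed.

End expectation.

(** * Gaussian integrals *)

Section integral_image.
Context {R : realType} {d0 d1 d2 : measure_display}.
Context {T : measurableType d0} {T1 : measurableType d1} {T2 : measurableType d2}.
Import HBNNSimple.

Let image_step (d' : measure_display) (T' : measurableType d') (m : {measure set T' -> \bar R})
    (X : T' -> T) (g : T' -> R) (f : {nnsfun T >-> R}) :
  measurable_fun setT X -> measurable_fun setT g -> (forall w, 0 <= g w) ->
  (\int[m]_w (g w * f (X w))%:E =
   \sum_(y \in range f) (y%:E * \int[m]_w (g w * \1_(f @^-1` [set y]) (X w))%:E))%E.
Proof.
move=> mX mg g0.
have mi y : measurable_fun setT (fun w => \1_(f @^-1` [set y]) (X w) : R).
  by apply: measurableT_comp => //; exact: measurable_indic.
transitivity (\int[m]_w (\sum_(y \in range f)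
    (y * (g w * \1_(f @^-1` [set y]) (X w)))%:E))%E.
  apply: eq_integral => w _; rewrite fsumEFin// fimfunE; congr EFin.
  rewrite mulr_fsumr//.
  by apply: eq_fsbigr => y _; rewrite mulrCA.
rewrite ge0_integral_fsum//; last 2 first.
- move=> y; apply/measurable_EFinP; apply: measurable_funM => //.
  exact: measurable_funM.
- move=> y w _; rewrite mulrCA lee_fin mulr_ge0//.
  by have := nnfun_muleindic_ge0 f y (X w); rewrite lee_fin.
apply: eq_fsbigr => y /set_mem[x _ <-].
under eq_integral do rewrite EFinM.
rewrite ge0_integralZl//.
- by apply/measurable_EFinP; exact: measurable_funM.
- by move=> w _; rewrite lee_fin mulr_ge0.
- by rewrite lee_fin.
Qed.

(** Passage from sets to functions through simple approximations. The weights [g1] and [g2] let the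
    same principle serve both for densities and for independence from a sigma-algebra. *)
Lemma ge0_integral_image_eq (m1 : {measure set T1 -> \bar R})
    (m2 : {measure set T2 -> \bar R}) (X1 : T1 -> T) (X2 : T2 -> T)
    (g1 : T1 -> R) (g2 : T2 -> R) (h : T -> R) :
  measurable_fun setT X1 -> measurable_fun setT X2 ->
  measurable_fun setT g1 -> measurable_fun setT g2 ->
  (forall w, 0 <= g1 w) -> (forall w, 0 <= g2 w) ->
  (forall B, measurable B -> (\int[m1]_w (g1 w * \1_B (X1 w))%:E =
                             \int[m2]_w (g2 w * \1_B (X2 w))%:E)%E) ->
  measurable_fun setT h -> (forall x, 0 <= h x) ->
  (\int[m1]_w (g1 w * h (X1 w))%:E = \int[m2]_w (g2 w * h (X2 w))%:E)%E.
Proof.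
move=> mX1 mX2 mg1 mg2 g10 g20 H mh h0.
have mhE : measurable_fun setT (EFin \o h) by exact/measurable_EFinP.
pose hn := nnsfun_approx measurableT mhE.
have lim_step (d' : measure_display) (T' : measurableType d') (m : {measure set T' -> \bar R})
    (X : T' -> T) (g : T' -> R) : measurable_fun setT X ->
    measurable_fun setT g -> (forall w, 0 <= g w) ->
  (\int[m]_w (g w * h (X w))%:E =
     lim (\int[m]_w (g w * hn n (X w))%:E @[n --> \oo]))%E.
  move=> mX mg g0.
  rewrite -monotone_convergence//=.
  - apply: eq_integral => w _; apply/esym/cvg_lim => //.
    under eq_fun do rewrite EFinM.
    rewrite EFinM; apply: cvgeZl => //.
    by apply: cvg_nnsfun_approx => // x _; rewrite lee_fin.
  - move=> n; apply/measurable_EFinP; apply: measurable_funM => //.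
    exact: measurableT_comp.
  - by move=> n w _; rewrite lee_fin mulr_ge0.
  - move=> w _ a b ab; rewrite lee_fin ler_wpM2l//.
    exact/lefP/nd_nnsfun_approx.
have E n : (\int[m1]_w (g1 w * hn n (X1 w))%:E =
            \int[m2]_w (g2 w * hn n (X2 w))%:E)%E.
  rewrite !image_step//; apply: eq_fsbigr => y _; congr (_ * _)%E.
  by apply: H; exact: measurable_sfunP.
by rewrite !lim_step//; under eq_fun do rewrite E.
Qed.

End integral_image.

Section gaussian.
Context {R : realType}.
Variable s : R.
Hypothesis s0 : 0 < s.
Local Notation N := (normal_prob 0 s).
Local Notation mu := lebesgue_measure.

Lemma ge0_integral_normal_prob (h : R -> R) : measurable_fun setT h ->
  (forall y, 0 <= h y) ->
  (\int[N]_y (h y)%:E = \int[mu]_y (normal_pdf 0 s y * h y)%:E)%E.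
Proof.
move=> mh h0.
have := @ge0_integral_image_eq R _ _ _ (measurableTypeR R) (measurableTypeR R)
  (measurableTypeR R) N mu id id (cst 1) (normal_pdf 0 s) h.
under eq_integral do rewrite /= mul1r.
apply => //.
- exact: measurable_normal_pdf.
- by move=> w; exact: normal_pdf_ge0.
move=> B mB.
under eq_integral do rewrite /= mul1r.
rewrite integral_indic// setIT /normal_prob [LHS]integral_mkcond.
apply: eq_integral => y _; rewrite patchE indicE.
by case: (y \in B); rewrite ?mulr1 ?mulr0.
Qed.

(** With [u = y^2 / (4 s^2)] the exponents are [- 2 u] on the left and [- u / 2] on the right, and
    [u * expR (- u) <= 1] absorbs the square. The second moment is thus bounded by [8 s^2] instead
    of the exact [s^2], at no cost later on. *)
Lemma normal_pdf_sqr_le (y : R) :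
  normal_pdf 0 s y * y ^+ 2 <= 8 * s ^+ 2 * normal_pdf 0 (2 * s) y.
Proof.
have s2 : 0 < 2 * s by rewrite mulr_gt0.
rewrite !normal_pdfE ?gt_eqF// /normal_fun !subr0.
have -> : normal_peak (2 * s) = 2^-1 * normal_peak s.
  rewrite /normal_peak -invfM; congr (_^-1).
  have -> : (2 * s) ^+ 2 * pi *+ 2 = 2 ^+ 2 * (s ^+ 2 * pi *+ 2) by ring.
  by rewrite sqrtrM ?sqr_ge0// sqrtr_sqr ger0_norm.
set pk := normal_peak s.
have pk0 : 0 <= pk by exact: normal_peak_ge0.
set u := y ^+ 2 / (4 * s ^+ 2).
have sn0 : s != 0 by rewrite gt_eqF.
have yu : y ^+ 2 = 4 * s ^+ 2 * u by rewrite /u; field.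
have u0 : 0 <= u by rewrite divr_ge0 ?sqr_ge0// mulr_ge0 ?sqr_ge0.
have -> : - y ^+ 2 / (s ^+ 2 *+ 2) = - u - u by rewrite yu; field.
have -> : - y ^+ 2 / ((2 * s) ^+ 2 *+ 2) = - (u / 2) by rewrite yu; field.
rewrite expRD yu.
have e1 : u * expR (- u) <= 1.
  rewrite expRN ler_pdivrMr ?expR_gt0// mul1r.
  by apply: le_trans (expR_ge1Dx u); lra.
have e2 : expR (- u) <= expR (- (u / 2)) by rewrite ler_expR; lra.
have := expR_ge0 (- u); have := expR_ge0 (- (u / 2)).
move: (expR (- u)) (expR (- (u / 2))) e1 e2 => a b ua ab b0 a0.
have -> : pk * (a * a) * (4 * s ^+ 2 * u) = (4 * s ^+ 2 * pk) * (u * a * a) by ring.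
have -> : 8 * s ^+ 2 * (2^-1 * pk * b) = (4 * s ^+ 2 * pk) * b by field.
apply: ler_wpM2l; first by rewrite mulr_ge0// mulr_ge0 ?sqr_ge0.
by apply: le_trans ab; rewrite ler_piMl.
Qed.

Lemma integral_normal_sqr : (\int[N]_y (y ^+ 2)%:E <= (8 * s ^+ 2)%:E)%E.
Proof.
rewrite ge0_integral_normal_prob//; last by move=> y; exact: sqr_ge0.
apply: (@le_trans _ _ (\int[mu]_y ((8 * s ^+ 2)%:E * (normal_pdf 0 (2 * s) y)%:E))%E).
  apply: ge0_le_integral => //.
  - by move=> y _; rewrite lee_fin mulr_ge0 ?sqr_ge0 ?normal_pdf_ge0.
  - apply/measurable_EFinP; apply: measurable_funM => //; exact: measurable_normal_pdf.
  - apply/measurable_EFinP; apply: measurable_funM => //; exact: measurable_normal_pdf.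
  - by move=> y _; rewrite -EFinM lee_fin normal_pdf_sqr_le.
rewrite ge0_integralZl//.
- by rewrite integral_normal_pdf mule1.
- by apply/measurable_EFinP; exact: measurable_normal_pdf.
- by move=> y _; rewrite lee_fin normal_pdf_ge0.
- by rewrite lee_fin mulr_ge0 ?sqr_ge0.
Qed.

Lemma sqint_normal : sqint N (fun y => y).
Proof.
split=> //; apply: rint_lty => //; first by move=> y; exact: sqr_ge0.
by apply: le_lt_trans integral_normal_sqr _; rewrite ltry.
Qed.

Lemma rE_normal_sqr : rE N (fun y => y ^+ 2) <= 8 * s ^+ 2.
Proof.
have [_ i2] := sqint_normal.
by rewrite -lee_fin -rEfin//; exact: integral_normal_sqr.
Qed.

Let pos (y : R) : R := \1_`]0, +oo[%classic y * y.
Let neg (y : R) : R := \1_`]-oo, 0[%classic y * - y.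

Let posE y : pos y = Num.max y 0.
Proof.
rewrite /pos indicE mem_setE in_itv/= andbT.
by case: (ltP 0 y) => _; rewrite ?mul1r ?mul0r.
Qed.

Let negE y : neg y = Num.max (- y) 0.
Proof.
rewrite /neg indicE mem_setE in_itv/=; rewrite -oppr_gt0.
by case: (ltP 0 (- y)) => _; rewrite ?mul1r ?mul0r.
Qed.

Let pos_ge0 y : 0 <= pos y. Proof. by rewrite posE le_max lexx orbT. Qed.

Let neg_ge0 y : 0 <= neg y. Proof. by rewrite negE le_max lexx orbT. Qed.

Let mpos : measurable_fun setT pos.
Proof. by apply: measurable_funM => //; exact: measurable_indic. Qed.

Let mneg : measurable_fun setT neg.
Proof.
by apply: measurable_funM => //; exact: measurable_indic.
Qed.

Let posneg y : y = pos y - neg y.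
Proof.
rewrite posE negE; case: (leP 0 y) => y0.
  by rewrite max_r ?subr0// oppr_le0.
by rewrite max_l ?oppr_ge0 ?sub0r ?opprK// ltW.
Qed.

(** Symmetry of the density under the substitution of [- y] for [y]; it makes the Gaussian
    centred. *)
Let int_posneg : (\int[N]_y (pos y)%:E = \int[N]_y (neg y)%:E)%E.
Proof.
rewrite !ge0_integral_normal_prob//.
pose G y := normal_pdf 0 s y * - y.
have cG : continuous G.
  move=> y; apply: cvgM; first by apply: continuous_normal_pdf; rewrite gt_eqF.
  exact: cvgN.
have pdfN y : normal_pdf 0 s (- y) = normal_pdf 0 s y.
  by rewrite normal_pdfE ?gt_eqF// /normal_fun !subr0 sqrrN.
have := @ge0_integration_by_substitutionNy R G 0.
rewrite oppr0 => H.
transitivity (\int[mu]_(x in `[0%R, +oo[) ((G \o -%R) x)%:E)%E.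
  rewrite [RHS]integral_mkcond; apply: eq_integral => y _.
  rewrite patchE mem_setE in_itv/= andbT /G/= pdfN opprK posE.
  by case: (leP 0 y) => y0 //; rewrite mulr0.
rewrite -H.
- rewrite integral_mkcond; apply: eq_integral => y _.
  rewrite patchE mem_setE in_itv/= /G negE -oppr_ge0.
  by case: (leP 0 (- y)) => y0 //; rewrite mulr0.
- exact: continuous_subspaceT.
- move=> y; rewrite in_itv/= => y0.
  by rewrite mulr_ge0 ?normal_pdf_ge0// oppr_ge0 ltW.
Qed.

Lemma rint_normal_pos : rint N pos.
Proof.
apply: (@rint_le _ _ _ _ _ (fun y : measurableTypeR R => `|y : R|)) => //; last first.
  exact/rint_norm/sqint_rint/sqint_normal.
move=> y; rewrite /pos normrM ler_piMl//; exact: indic_le1.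
Qed.

Lemma rE_normal_id : rE N (fun y => y) = 0.
Proof.
have ip := rint_normal_pos.
have ineg : rint N neg.
  apply: (@rint_le _ _ _ _ _ (fun y : measurableTypeR R => `|y : R|)) => //; last first.
    exact/rint_norm/sqint_rint/sqint_normal.
  move=> y; rewrite /neg normrM normrN ler_piMl//; exact: indic_le1.
rewrite (_ : (fun y => y) = (fun y => pos y - neg y)); last exact/funext.
rewrite rEB//; apply/eqP; rewrite subr_eq0; apply/eqP.
by rewrite /rE /Rintegral int_posneg.
Qed.

(** Only [[s, 2 s]] is kept: there [y >= s], the exponent is at least [- 2] and the peak is
    [normal_peak 1 / s], so the integrand is at least a constant on an interval of length [s].
    Linearity in [s] is what later makes the tilts of order sqrt dt. *)
Lemma rE_normal_pos : expR (- 2) * normal_peak 1 * s <= rE N pos.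
Proof.
rewrite -lee_fin -rEfin; last exact: rint_normal_pos.
rewrite ge0_integral_normal_prob//.
have sn0 : s != 0 by rewrite gt_eqF.
pose c0 : R := expR (- 2) * normal_peak 1.
have c00 : 0 <= c0 by rewrite mulr_ge0 ?expR_ge0 ?normal_peak_ge0.
apply: (@le_trans _ _ (\int[mu]_(y in `[s, (2 * s)%R]) (c0)%:E)%E).
  rewrite integral_cst//= lebesgue_measure_itv/= lte_fin.
  have -> : s < 2 * s by rewrite ltr_pMl// ltr1n.
  by rewrite -EFinB -EFinM (_ : 2 * s - s = s)//; ring.
rewrite integral_mkcond; apply: ge0_le_integral => //.
- by move=> y _; rewrite patchE; case: ifP.
- by apply/(measurable_restrictT _ _).1.
- by apply/measurable_EFinP; apply: measurable_funM => //; exact: measurable_normal_pdf.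
move=> y _; rewrite patchE mem_setE in_itv/=.
have p0 : (0 <= (normal_pdf 0 s y * pos y)%:E)%E.
  by rewrite lee_fin mulr_ge0// normal_pdf_ge0.
case: ifP => // /andP[sy y2].
rewrite lee_fin /c0 normal_pdfE// /normal_fun subr0 posE max_l; last first.
  exact: le_trans (ltW s0) sy.
have -> : normal_peak s = normal_peak 1 / s.
  rewrite /normal_peak expr1n mul1r -mulrnAr sqrtrM ?sqr_ge0//.
  by rewrite sqrtr_sqr gtr0_norm// invfM mulrC.
have e : expR (- 2) <= expR (- y ^+ 2 / (s ^+ 2 *+ 2)).
  rewrite ler_expR mulNr lerN2 ler_pdivrMr; last by rewrite pmulrn_lgt0// exprn_gt0.
  by rewrite -mulr_natl; nra.
rewrite mulrC -2!mulrA ler_wpM2l ?normal_peak_ge0//.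
rewrite -mulrA mulrCA.
apply: (@le_trans _ _ (expR (- 2) * 1)); first by rewrite mulr1.
apply: ler_pM => //; rewrite ?expR_ge0//.
by rewrite [leRHS]mulrC ler_pdivlMr// mul1r.
Qed.

End gaussian.

(** * Brownian increments *)

Section brownian_filtration.
Context {R : realType} {dO : measure_display} {Omega : measurableType dO}.
Variable P : probability Omega R.
Hypothesis hP : measure_is_complete P.
Context {d : nat}.
Variable W : R -> Omega -> 'cV[R]_d.
Hypothesis hW : brownian_motion P W.
Local Notation F := (bm_filtration P W).

Definition fmeas (t : R) (f : Omega -> R) : Prop :=
  measurable_fun [set: g_sigma_algebraType (F t)] f.

Definition dW (s t : R) (k : 'I_d) (w : Omega) : R := W t w k 0 - W s w k 0.

Lemma sub_bm_filtration s t : s <= t -> F s `<=` F t.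
Proof.
move=> st; apply: sub_sigma_algebra2 => A [[u [i [B [/andP[u0 us] mB ->]]]]|An].
  by left; exists u, i, B; split => //; rewrite u0 (le_trans us).
by right.
Qed.

(** This is where completeness of [P] enters: the augmented filtration contains every negligible
    set. *)
Lemma bm_filtration_measurable t A : F t A -> measurable A.
Proof.
move: A; suff : F t `<=` (@measurable _ Omega) by exact.
apply: smallest_sub; first exact: sigma_algebra_measurable.
move=> B [[u [i [C [/andP[u0 _] mC ->]]]]|].
  rewrite -[X in measurable X]setTI.
  by apply: (bm_measurable hW).
exact: hP.
Qed.

Lemma measurable_bm_filtration t A :
  measurable (A : set (g_sigma_algebraType (F t))) -> F t A.
Proof.
move=> mA; have : <<s F t>> A by [].
by rewrite sigma_algebra_id//; exact: smallest_sigma_algebra.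
Qed.

Lemma bm_filtrationP t A : F t A ->
  measurable (A : set (g_sigma_algebraType (F t))).
Proof. by move=> FA; apply: sub_sigma_algebra. Qed.

Lemma fmeas_measurable t f : fmeas t f -> measurable_fun setT f.
Proof.
move=> mf _ B mB; apply: (@bm_filtration_measurable t).
by apply: measurable_bm_filtration; exact: mf.
Qed.

Lemma fmeas_le s t f : s <= t -> fmeas s f -> fmeas t f.
Proof.
move=> st mf _ B mB; apply: bm_filtrationP; apply: sub_bm_filtration st _ _.
by apply: measurable_bm_filtration; exact: mf.
Qed.

Lemma fmeas_W s t k : 0 <= s <= t -> fmeas t (fun w => W s w k 0).
Proof.
move=> st _ B mB; rewrite setTI; apply: bm_filtrationP.
by apply: sub_sigma_algebra; left; exists s, k, B.
Qed.

Lemma fmeas_dW s t u k : 0 <= s -> s <= t -> t <= u -> fmeas u (dW s t k).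
Proof.
move=> s0 st tu; apply: measurable_funB; apply: fmeas_W.
  by rewrite (le_trans s0 st).
by rewrite s0 (le_trans st).
Qed.

(** The independence in [brownian_motion] concerns events generated by [W] alone. Events that agree
    almost surely with such an event form a sigma-algebra containing the null sets, so independence
    passes to the augmented filtration. *)
Lemma bm_filtration_modification t A : F t A ->
  exists2 A0, <<s bm_events W t >> A0 & {ae P, forall w, A w <-> A0 w}.
Proof.
pose G := [set A : set Omega | exists2 A0, <<s bm_events W t >> A0 &
  {ae P, forall w, A w <-> A0 w}].
suff : F t `<=` G by move=> + FA => /(_ _ FA).
have sa := smallest_sigma_algebra setT (bm_events W t).
apply: smallest_sub.
- split.
  + by exists set0; [exact: sigma_algebra0|exact: aeW].
  + move=> B [B0 sB0 BB0]; exists (setT `\` B0); first exact: sigma_algebraCD.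
    by apply: filterS BB0 => w BB0; rewrite /setD/=; tauto.
  + move=> B sB.
    have /choice[B0 HB0] : forall n, exists B0, <<s bm_events W t >> B0 /\
        {ae P, forall w, B n w <-> B0 w}.
      by move=> n; have [C] := sB n; exists C.
    exists (\bigcup_n B0 n).
      by apply: sigma_algebra_bigcup => n; exact: (HB0 n).1.
    have : {ae P, forall w, forall n, B n w <-> B0 n w}.
      by apply/ae_foralln => n; exact: (HB0 n).2.
    apply: filterS => w H; split => -[n _ Bn]; exists n => //; exact/H.
- move=> B [|Bn]; first by exists B; [exact: sub_sigma_algebra|exact: aeW].
  exists set0; first exact: sigma_algebra0.
  have [N [mN N0 BN]] := Bn; exists N; split => // w.
  by rewrite /= => nB; apply: BN; apply: contrapT => Bw; apply: nB; split.
Qed.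

Lemma ae_eq_measure (A B : set Omega) : measurable A -> measurable B ->
  {ae P, forall w, A w <-> B w} -> P A = P B.
Proof.
move=> mA mB AB.
rewrite -[A]setIT -[B]setIT -!integral_indic//.
apply: ae_eq_integral => //.
- exact/measurable_EFinP/measurable_indic.
- exact/measurable_EFinP/measurable_indic.
apply: filterS AB => w ABw _; rewrite !indicE; congr ((nat_of_bool _)%:R%:E).
by apply/idP/idP; rewrite !inE => /ABw.
Qed.

Lemma measurable_dW s t k : 0 <= s <= t -> measurable_fun setT (dW s t k).
Proof.
move=> /andP[s0 st].
by apply: (@fmeas_measurable t); exact: fmeas_dW.
Qed.

Local Notation N s t := (normal_prob 0 (Num.sqrt (t - s))).

Lemma bm_indep s t A (B : 'I_d -> set R) : 0 <= s < t -> F s A ->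
  (forall i, measurable (B i)) ->
  P (A `&` [set w | forall i, B i (dW s t i w)]) =
  (P A * \big[mule/1%E]_(i < d) N s t (B i))%E.
Proof.
move=> st FA mB.
have [A0 sA0 AA0] := bm_filtration_modification FA.
have FA0 : F s A0 by apply: sub_sigma_algebra2 sA0 => C; left.
have mA := bm_filtration_measurable FA; have mA0 := bm_filtration_measurable FA0.
have mC : measurable [set w | forall i, B i (dW s t i w)].
  rewrite (_ : [set _ | _] = \bigcap_(i in [set: 'I_d]) (dW s t i @^-1` B i)).
    apply: fin_bigcap_measurable => // i _; rewrite -[X in measurable X]setTI.
    by apply: measurable_dW => //; case/andP: st => -> /ltW ->.
  by apply/seteqP; split => w /= H i; [move=> _|]; exact: H.
rewrite (ae_eq_measure mA mA0 AA0) -(bm_increments hW st sA0 mB).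
apply: ae_eq_measure; [exact: measurableI..|].
by apply: filterS AA0 => w H /=; rewrite /dW; split => -[/H].
Qed.

Lemma bm_indep1 s t A k B : 0 <= s < t -> F s A -> measurable B ->
  P (A `&` (dW s t k @^-1` B)) = (P A * N s t B)%E.
Proof.
move=> st FA mB; pose C i := if i == k then B else setT.
have := @bm_indep s t A C st FA; rewrite (bigD1 k)//= big1 => [|i /negbTE ik]; last first.
  by rewrite /C ik; exact: probability_setT.
rewrite /C eqxx mule1 => <-; last by move=> i; case: ifP.
congr (P (_ `&` _)); apply/seteqP; split => w /=.
  by move=> Bw i; case: eqP => [->|].
by move/(_ k); rewrite eqxx.
Qed.

Lemma bm_indep2 s t A j k B B' : 0 <= s < t -> F s A -> measurable B ->
  measurable B' -> j != k ->
  P (A `&` (dW s t j @^-1` B) `&` (dW s t k @^-1` B')) =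
  (P A * N s t B * N s t B')%E.
Proof.
move=> st FA mB mB' jk; pose C i := if i == k then B' else if i == j then B else setT.
have := @bm_indep s t A C st FA.
rewrite (bigD1 k)//= (bigD1 j)//= big1 => [|i /andP[/negbTE ik /negbTE ij]]; last first.
  by rewrite /C ik ij; exact: probability_setT.
rewrite /C !eqxx (negbTE jk) mule1 -muleA (muleC (N s t B)) => <-; last first.
  by move=> i; do 2 case: ifP => // _.
congr (P _); apply/seteqP; split => w /=.
  by move=> [[Aw Bw] B'w]; split => // i; case: eqP => [->//|_]; case: eqP => [->|].
move=> [Aw Cw]; split; last by have := Cw k; rewrite eqxx.
by split => //; have := Cw j; rewrite eqxx (negbTE jk).
Qed.

End brownian_filtration.

Section increments.
Context {R : realType} {dO : measure_display} {Omega : measurableType dO}.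
Variable P : probability Omega R.
Hypothesis hP : measure_is_complete P.
Context {d : nat}.
Variable W : R -> Omega -> 'cV[R]_d.
Hypothesis hW : brownian_motion P W.
Local Notation F := (bm_filtration P W).
Local Notation fmeas := (fmeas P W).
Local Notation dW := (dW W).
Local Notation N s t := (normal_prob 0 (Num.sqrt (t - s))).
Local Notation pospart f := (fun w => Num.max (f w) 0).
Local Notation negpart f := (fun w => Num.max (- f w) 0).

Let posneg (x : R) : x = Num.max x 0 - Num.max (- x) 0.
Proof.
case: (leP 0 x) => x0; first by rewrite max_r ?subr0// oppr_le0.
by rewrite max_l ?oppr_ge0 ?sub0r ?opprK// ltW.
Qed.

Let le_pos (x : R) : `|Num.max x 0| <= `|x|.
Proof.
by rewrite ger0_norm ?le_max ?lexx ?orbT// ge_max normr_ge0 ler_norm.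
Qed.

Let le_neg (x : R) : `|Num.max (- x) 0| <= `|x|.
Proof. by have := le_pos (- x); rewrite normrN. Qed.

Let rint_pospart d' (T : measurableType d') (Q : probability T R) (f : T -> R) :
  rint Q f -> rint Q (pospart f).
Proof.
move=> fi; apply: (rint_le _ _ (rint_norm fi)) => [|w]; last exact: le_pos.
by apply: measurable_maxr => //; exact: rint_meas fi.
Qed.

Let rint_negpart d' (T : measurableType d') (Q : probability T R) (f : T -> R) :
  rint Q f -> rint Q (negpart f).
Proof.
move=> fi; apply: (rint_le _ _ (rint_norm fi)) => [|w]; last exact: le_neg.
apply: measurable_maxr => //; apply: measurableT_comp => //.
exact: rint_meas fi.
Qed.

Section independence.
Variables (s t : R) (k : 'I_d) (E0 : set Omega) (p : R).
Hypotheses (st : 0 <= s < t) (mE0 : measurable E0) (p0 : 0 <= p).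
Hypothesis ind : forall A B, F s A -> measurable B ->
  P (A `&` E0 `&` (dW s t k @^-1` B)) = (P A * p%:E * N s t B)%E.

Let mdW : measurable_fun setT (dW s t k).
Proof. by apply: (measurable_dW hP hW); case/andP: st => -> /ltW ->. Qed.

(** The passage from sets to functions is made twice: in [h], with the indicator of an event of
    [F s] in place of [xi], and afterwards in [xi]. *)
Let ge0_incr_int (xi : Omega -> R) (h : R -> R) :
  fmeas s xi -> rint P xi -> (forall w, 0 <= xi w) ->
  rint (N s t) h -> (forall y, 0 <= h y) ->
  (\int[P]_w (\1_E0 w * h (dW s t k w) * xi w)%:E =
   (p * rE (N s t) h * rE P xi)%:E)%E.
Proof.
move=> mxi ixi xi0 ih h0.
have mh : measurable_fun setT h by exact: rint_meas ih.
have mE : measurable_fun setT (\1_E0 : Omega -> R) by exact: measurable_indic.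
have mhW : measurable_fun setT (fun w => h (dW s t k w)).
  exact: (measurableT_comp mh mdW).
have step A : F s A ->
    (\int[P]_w ((\1_E0 w * h (dW s t k w)) * \1_A w)%:E =
     (p * rE (N s t) h)%:E * P A)%E.
  move=> FA; have mA := bm_filtration_measurable hP hW FA.
  transitivity (\int[P]_w ((\1_A w * \1_E0 w) * h (dW s t k w))%:E)%E.
    by apply: eq_integral => w _; congr EFin; ring.
  rewrite (@ge0_integral_image_eq R _ _ _ _ _ _ P (N s t) (dW s t k) id
    (fun w => \1_A w * \1_E0 w) (fun=> p * fine (P A)) h) => //.
  - under eq_integral do rewrite EFinM.
    rewrite ge0_integralZl//.
    + rewrite -/(rE _ _) rEfin// -EFinM.
      rewrite -[in RHS](@fineK _ (P A)) ?fin_num_measure// -EFinM.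
      by congr EFin; rewrite /=; ring.
    + exact/measurable_EFinP.
    + by move=> y _; rewrite lee_fin.
    + by rewrite lee_fin mulr_ge0// fine_ge0.
  - by apply: measurable_funM => //; exact: measurable_indic.
  - by move=> w; rewrite /= mulr_ge0// fine_ge0.
  - move=> B mB.
    transitivity (\int[P]_w (\1_(A `&` E0 `&` (dW s t k @^-1` B)) w)%:E)%E.
      by apply: eq_integral => w _; rewrite !indicI/= mulrC.
    rewrite integral_indic//; last first.
      apply: measurableI; first exact: measurableI.
      by rewrite -[X in measurable X]setTI; exact: mdW.
    rewrite setIT; transitivity (P A * p%:E * N s t B)%E; first exact: ind.
    under eq_integral do rewrite EFinM.
    rewrite ge0_integralZl//; last 2 first.
    + exact/measurable_EFinP/measurable_indic.
    + by rewrite lee_fin mulr_ge0// fine_ge0.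
    rewrite integral_indic// setIT EFinM fineK ?fin_num_measure//.
    by rewrite (muleC p%:E).
(* The target is [Omega] with the smaller sigma-algebra, so that only events of [F s] have to be
   tested. *)
rewrite (@ge0_integral_image_eq R _ _ _ (g_sigma_algebraType (F s)) _ _ P P id id
    (fun w => \1_E0 w * h (dW s t k w)) (fun=> p * rE (N s t) h) xi) => //.
- under eq_integral do rewrite EFinM.
  rewrite ge0_integralZl//.
  + by rewrite rEfin.
  + by apply/measurable_EFinP; exact: rint_meas ixi.
  + by move=> w _; rewrite lee_fin.
  + by rewrite lee_fin mulr_ge0// rE_ge0.
- move=> _ B mB; rewrite setTI.
  by apply: (bm_filtration_measurable hP hW); exact: measurable_bm_filtration mB.
- move=> _ B mB; rewrite setTI.
  by apply: (bm_filtration_measurable hP hW); exact: measurable_bm_filtration mB.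
- exact: measurable_funM.
- by move=> w; rewrite mulr_ge0.
- by move=> w /=; rewrite mulr_ge0// rE_ge0.
- move=> B /measurable_bm_filtration FB; rewrite step//.
  have mB := bm_filtration_measurable hP hW FB.
  under [RHS]eq_integral do rewrite EFinM.
  rewrite ge0_integralZl//; last 2 first.
  + exact/measurable_EFinP/measurable_indic.
  + by rewrite lee_fin mulr_ge0// rE_ge0.
  by rewrite integral_indic// setIT.
Qed.

Let ge0_incr (xi : Omega -> R) (h : R -> R) :
  fmeas s xi -> rint P xi -> (forall w, 0 <= xi w) ->
  rint (N s t) h -> (forall y, 0 <= h y) ->
  rint P (fun w => \1_E0 w * h (dW s t k w) * xi w) /\
  rE P (fun w => \1_E0 w * h (dW s t k w) * xi w) = p * rE (N s t) h * rE P xi.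
Proof.
move=> mxi ixi xi0 ih h0; have H := ge0_incr_int mxi ixi xi0 ih h0.
have i : rint P (fun w => \1_E0 w * h (dW s t k w) * xi w).
  apply: rint_lty.
  - apply: measurable_funM; last exact: rint_meas ixi.
    apply: measurable_funM; first exact: measurable_indic.
    by apply: (measurableT_comp _ mdW); exact: rint_meas ih.
  - by move=> w; rewrite !mulr_ge0.
  - by rewrite H ltry.
split=> //; apply: EFin_inj.
by rewrite -rEfin.
Qed.

(** Splitting [xi] and [h] into positive and negative parts gives four nonnegative products. The
    event [E0] will be the whole space, or the positivity of another coordinate of the same
    increment. *)
Lemma incr_indep (xi : Omega -> R) (h : R -> R) :
  fmeas s xi -> rint P xi -> rint (N s t) h ->
  rint P (fun w => \1_E0 w * h (dW s t k w) * xi w) /\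
  rE P (fun w => \1_E0 w * h (dW s t k w) * xi w) = p * rE (N s t) h * rE P xi.
Proof.
move=> mxi ixi ih.
have mp : fmeas s (pospart xi) by exact: measurable_maxr.
have mn : fmeas s (negpart xi).
  by apply: measurable_maxr => //; exact: measurableT_comp.
have [ixp ixn] := (rint_pospart ixi, rint_negpart ixi).
have [ihp ihn] := (rint_pospart ih, rint_negpart ih).
have max0 (x : R) : 0 <= Num.max x 0 by rewrite le_max lexx orbT.
have [i1 e1] := ge0_incr mp ixp (fun=> max0 _) ihp (fun=> max0 _).
have [i2 e2] := ge0_incr mp ixp (fun=> max0 _) ihn (fun=> max0 _).
have [i3 e3] := ge0_incr mn ixn (fun=> max0 _) ihp (fun=> max0 _).
have [i4 e4] := ge0_incr mn ixn (fun=> max0 _) ihn (fun=> max0 _).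
have E : (fun w => \1_E0 w * h (dW s t k w) * xi w) = (fun w =>
  (\1_E0 w * Num.max (h (dW s t k w)) 0 * Num.max (xi w) 0 -
   \1_E0 w * Num.max (- h (dW s t k w)) 0 * Num.max (xi w) 0) -
  (\1_E0 w * Num.max (h (dW s t k w)) 0 * Num.max (- xi w) 0 -
   \1_E0 w * Num.max (- h (dW s t k w)) 0 * Num.max (- xi w) 0)).
  apply/funext => w; rewrite {1}(posneg (h _)) {1}(posneg (xi w)); ring.
rewrite E; split; first by apply: rintB; exact: rintB.
rewrite rEB; [|exact: rintB..].
rewrite !rEB// e1 e2 e3 e4.
have -> : rE P xi = rE P (pospart xi) - rE P (negpart xi).
  by rewrite -rEB//; congr rE; apply/funext => w.
have -> : rE (N s t) h = rE (N s t) (pospart h) - rE (N s t) (negpart h).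
  by rewrite -rEB//; congr rE; apply/funext => w.
ring.
Qed.

End independence.

Variables (s t : R) (st : 0 <= s < t).

Let sq0 : 0 < Num.sqrt (t - s).
Proof. by rewrite sqrtr_gt0 subr_gt0; case/andP: st. Qed.

Let sqE : Num.sqrt (t - s) ^+ 2 = t - s.
Proof. by rewrite sqr_sqrtr// subr_ge0 ltW//; case/andP: st. Qed.

Lemma incr_indep1 k (xi : Omega -> R) (h : R -> R) :
  fmeas s xi -> rint P xi -> rint (N s t) h ->
  rint P (fun w => h (dW s t k w) * xi w) /\
  rE P (fun w => h (dW s t k w) * xi w) = rE (N s t) h * rE P xi.
Proof.
move=> mxi ixi ih.
have H A B : F s A -> measurable B ->
    P (A `&` setT `&` (dW s t k @^-1` B)) = (P A * 1%:E * N s t B)%E.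
  by move=> FA mB; rewrite setIT mule1 (bm_indep1 hP hW).
have [] := @incr_indep s t k setT 1 st measurableT ler01 H _ _ mxi ixi ih.
under eq_fun do rewrite indicT mul1r.
by move=> i ->; rewrite mul1r.
Qed.

Lemma incr_mean k xi : fmeas s xi -> rint P xi ->
  rint P (fun w => dW s t k w * xi w) /\ rE P (fun w => dW s t k w * xi w) = 0.
Proof.
move=> mxi ixi.
have [] := @incr_indep1 k xi (fun y => y) mxi ixi (sqint_rint (sqint_normal sq0)).
by rewrite rE_normal_id// mul0r.
Qed.

Lemma incr_var k xi : fmeas s xi -> rint P xi -> (forall w, 0 <= xi w) ->
  rint P (fun w => dW s t k w ^+ 2 * xi w) /\
  rE P (fun w => dW s t k w ^+ 2 * xi w) <= 8 * (t - s) * rE P xi.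
Proof.
move=> mxi ixi xi0; have [_ i2] := sqint_normal sq0.
have [i ->] := @incr_indep1 k xi (fun y => y ^+ 2) mxi ixi i2.
split=> //; apply: ler_wpM2r; first exact: rE_ge0.
by apply: le_trans (rE_normal_sqr sq0) _; rewrite sqE.
Qed.

Let Bpos : set R := `]0, +oo[%classic.
Let p := fine (N s t Bpos).

Let mB : measurable (Bpos : set (measurableTypeR R)).
Proof. exact: measurable_itv. Qed.

(* A bounded, centred substitute for the increment: it keeps a discrete density nonnegative. *)
Definition incr_sign k w : R := \1_Bpos (dW s t k w) - p.

Let kap := rE (N s t) (fun y : R => \1_Bpos y * y).

(** The covariance of [incr_sign k] with [dW s t k], that is, the mean of the positive part of a
    Gaussian of variance [t - s]. *)
Definition incr_kappa : R := kap.

Lemma incr_kappa_ge : expR (- 2) * normal_peak 1 * Num.sqrt (t - s) <= incr_kappa.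
Proof. exact: rE_normal_pos. Qed.

Lemma incr_sign_le k w : `|incr_sign k w| <= 1.
Proof.
have p0 : 0 <= p by rewrite fine_ge0.
have p1 : p <= 1.
  rewrite -lee_fin /p fineK ?fin_num_measure//.
  exact: (@probability_le1 _ _ _ (N s t) _ mB).
rewrite /incr_sign indicE ler_norml.
by case: (_ \in _) => /=; lra.
Qed.

Let ihB : rint (N s t) (\1_Bpos : R -> R).
Proof. exact: (@rint_indic R _ (measurableTypeR R) (N s t) Bpos mB). Qed.

Let rEB1 : rE (N s t) (\1_Bpos : R -> R) = p.
Proof. by rewrite rE_indic. Qed.

Lemma incr_sign_mean k xi : fmeas s xi -> rint P xi ->
  rint P (fun w => incr_sign k w * xi w) /\ rE P (fun w => incr_sign k w * xi w) = 0.
Proof.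
move=> mxi ixi.
have ih : rint (N s t) (fun y : R => \1_Bpos y - p) by apply: rintB => //; exact: (@rint_cst R _ (measurableTypeR R) (N s t)).
have [i ->] := @incr_indep1 k xi (fun y => \1_Bpos y - p) mxi ixi ih.
by split=> //; rewrite rEB ?rE_cst//; [rewrite rEB1 subrr mul0r|exact: (@rint_cst R _ (measurableTypeR R) (N s t))].
Qed.

Lemma incr_sign_diag k xi : fmeas s xi -> rint P xi ->
  rint P (fun w => incr_sign k w * dW s t k w * xi w) /\
  rE P (fun w => incr_sign k w * dW s t k w * xi w) = incr_kappa * rE P xi.
Proof.
move=> mxi ixi.
have i1 : rint (N s t) (fun y : R => y) by exact: sqint_rint (sqint_normal sq0).
have i2 : rint (N s t) (fun y : R => \1_Bpos y * y).
  apply: (rintM_bdd (M := 1)) => //.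
  by move=> w; exact: indic_le1.
have ih : rint (N s t) (fun y : R => (\1_Bpos y - p) * y).
  under eq_fun do rewrite mulrBl.
  by apply: rintB => //; exact: rintZ.
have [i ->] := @incr_indep1 k xi (fun y => (\1_Bpos y - p) * y) mxi ixi ih.
split=> //; congr (_ * _).
under eq_fun do rewrite mulrBl.
by rewrite rEB ?rEZ//; [rewrite rE_normal_id// mulr0 subr0|exact: rintZ].
Qed.

(** The sign and [dW s t k] belong to independent coordinates and the second is centred, so a tilt
    in direction [j] creates no drift in direction [k]. *)
Lemma incr_sign_offdiag j k xi : j != k -> fmeas s xi -> rint P xi ->
  rint P (fun w => incr_sign j w * dW s t k w * xi w) /\
  rE P (fun w => incr_sign j w * dW s t k w * xi w) = 0.
Proof.
move=> jk mxi ixi.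
have i1 : rint (N s t) (fun y : R => y) by exact: sqint_rint (sqint_normal sq0).
have st' : 0 <= s <= t by case/andP: st => -> /ltW ->.
have mE : measurable (dW s t j @^-1` Bpos).
  by rewrite -[X in measurable X]setTI; exact: (measurable_dW hP hW).
have p0 : 0 <= p by rewrite fine_ge0.
have H A B : F s A -> measurable B -> P (A `&` (dW s t j @^-1` Bpos) `&`
    (dW s t k @^-1` B)) = (P A * p%:E * N s t B)%E.
  by move=> FA mB'; rewrite /p fineK ?fin_num_measure// (bm_indep2 hP hW).
have [i2 e2] := @incr_indep s t k _ p st mE p0 H xi (fun y => y) mxi ixi i1.
have [i3 e3] := incr_mean k mxi ixi.
have E : (fun w => incr_sign j w * dW s t k w * xi w) = (fun w =>
    \1_(dW s t j @^-1` Bpos) w * dW s t k w * xi w - p * (dW s t k w * xi w)).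
  by apply/funext => w; rewrite /incr_sign -[\1_(_ @^-1` _) w]/(\1_Bpos (dW s t j w)); ring.
rewrite E; split; first by apply: rintB => //; exact: rintZ.
rewrite rEB//; last exact: rintZ.
by rewrite e2 rEZ// e3 rE_normal_id//; ring.
Qed.

End increments.

(** * Time grids and simple processes *)

Section grids.
Context {R : realType}.

Record is_grid (T : R) (N : nat) (t : nat -> R) : Prop := {
  grid0 : t 0%N = 0;
  gridN : t N = T;
  grid_lt : forall i, (i < N)%N -> t i < t i.+1 }.

Lemma grid_le T N t i j : is_grid T N t -> (i <= j)%N -> (j <= N)%N -> t i <= t j.
Proof.
move=> g; elim: j => [|j IH]; first by rewrite leqn0 => /eqP ->.
rewrite leq_eqVlt => /predU1P[->//|ij jN].
by apply: (le_trans (IH ij (ltnW jN))); apply/ltW/(grid_lt g).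
Qed.

Lemma grid_ge0 T N t i : is_grid T N t -> (i <= N)%N -> 0 <= t i.
Proof. by move=> g iN; rewrite -(grid0 g); exact: (grid_le g). Qed.

Lemma grid_leT T N t i : is_grid T N t -> (i <= N)%N -> t i <= T.
Proof. by move=> g iN; rewrite -(gridN g); exact: (grid_le g). Qed.

Lemma grid_ltP T N t i j : is_grid T N t -> (i <= N)%N -> (j <= N)%N ->
  (t i < t j) = (i < j)%N.
Proof.
move=> g iN jN; apply/idP/idP.
  by apply: contraTT; rewrite -leqNgt -leNgt => ji; exact: (grid_le g).
move=> ij; apply: (lt_le_trans (grid_lt g (leq_trans ij jN))).
exact: (grid_le g).
Qed.

Lemma grid_step T N t i : is_grid T N t -> (i < N)%N -> 0 <= t i < t i.+1.
Proof. by move=> g iN; rewrite (grid_ge0 g (ltnW iN)) (grid_lt g). Qed.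

(** The prescribed points are merged with a uniform subdivision, duplicates removed, and the result
    is sorted. Strict monotonicity of the grid is wanted because steps of length 0 would have
    degenerate Gaussian increments. *)
Lemma grid_ex (T del : R) (L : seq R) : 0 < T -> 0 < del ->
  (forall x, x \in L -> 0 <= x <= T) ->
  exists N t, [/\ is_grid T N t,
    forall x, x \in L -> exists2 j, (j <= N)%N & t j = x &
    forall i, (i < N)%N -> t i.+1 - t i <= del].
Proof.
move=> T0 del0 LT.
pose m := (Num.truncn (T / del)).+1.
have m0 : 0 < m%:R :> R by rewrite ltr0n.
have mdel : T / m%:R <= del.
  rewrite ler_pdivrMr// mulrC -ler_pdivrMr//.
  by apply/ltW; exact: truncnS_gt.
pose u k := k%:R * (T / m%:R).
pose L' := 0 :: T :: L ++ [seq u k | k <- iota 0 m].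
have L'T x : x \in L' -> 0 <= x <= T.
  rewrite !inE mem_cat => /or4P[/eqP ->|/eqP ->|/LT//|].
  - by rewrite lexx ltW.
  - by rewrite lexx ltW.
  - move=> /mapP[k]; rewrite mem_iota add0n => /andP[_ km] ->.
    have -> /= : 0 <= u k by rewrite /u mulr_ge0// divr_ge0// ltW.
    rewrite /u mulrCA ler_piMr//; first exact: ltW.
    by rewrite ltW// ltr_pdivrMr// mul1r ltr_nat.
pose tau := sort <=%O (undup L').
have mtau x : (x \in tau) = (x \in L') by rewrite mem_sort mem_undup.
have stau : sorted <%O tau by rewrite sort_lt_sorted undup_uniq.
have size0 : (0 < size tau)%N.
  by rewrite size_sort lt0n size_eq0; apply/eqP => /undup_nil.
pose N := (size tau).-1; pose t i := nth 0 tau i.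
have NS : N.+1 = size tau by rewrite prednK.
have lt_t i j : (i < size tau)%N -> (j < size tau)%N -> (t i < t j) = (i < j)%N.
  move=> iN jN; exact: (lt_sorted_ltn_nth 0 stau).
have idx x : x \in L' -> exists2 j, (j <= N)%N & t j = x.
  rewrite -mtau => xt; exists (index x tau); last by rewrite /t nth_index.
  by rewrite -ltnS NS index_mem.
have tL' i : (i <= N)%N -> t i \in L' by move=> iN; rewrite -mtau mem_nth// -NS.
have le_t i j : (i <= j)%N -> (j <= N)%N -> t i <= t j.
  move=> ij jN; rewrite leNgt lt_t -?NS// ?ltnS ?(leq_trans ij)//.
  by rewrite -leqNgt.
exists N, t; split.
- split.
  + have [j jN j0] := idx 0 (mem_head _ _).
    apply/eqP; rewrite eq_le; apply/andP; split; last by case/andP: (L'T _ (tL' _ (leq0n N))).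
    by rewrite -[X in _ <= X]j0; exact: le_t.
  + have TL' : T \in L' by rewrite !inE eqxx orbT.
    have [j jN jT] := idx T TL'.
    apply/eqP; rewrite eq_le; apply/andP; split; first by case/andP: (L'T _ (tL' _ (leqnn N))).
    by rewrite -[X in X <= _]jT; exact: le_t.
  + by move=> i iN; rewrite lt_t -?NS// ltnS ltnW.
- by move=> x xL; apply: idx; rewrite !inE mem_cat xL !orbT.
- move=> i iN; apply: le_trans mdel.
  have /andP[ti0 tiT] := L'T _ (tL' _ (ltnW iN)).
  have tiT' : t i < T.
    have /andP[_] := L'T _ (tL' _ iN); apply: lt_le_trans.
    by rewrite lt_t -?NS// ltnS ltnW.
  (* [u k <= t i < u k.+1] locates [t i] in the uniform subdivision. As [u k.+1] is itself a node,
     the node following [t i] does not exceed it. *)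
  pose k := Num.truncn (t i / (T / m%:R)).
  have Tm0 : 0 < T / m%:R by rewrite divr_gt0.
  have q0 : 0 <= t i / (T / m%:R) by rewrite divr_ge0// ltW.
  have /andP[k1 k2] := truncn_itv q0.
  have uk : u k <= t i by rewrite /u -ler_pdivlMr.
  have uk1 : t i < u k.+1 by rewrite /u -ltr_pdivrMr.
  have km : (k < m)%N.
    rewrite -(ltr_nat R) (le_lt_trans k1)// ltr_pdivrMr// mulrCA divff ?gt_eqF// mulr1.
    exact: tiT'.
  have ukL : u k.+1 \in L'.
    (* The list of the [u k] stops at [m - 1]; the remaining point [u m] is [T], which was added
       separately. *)
    have [km1|km1] := ltnP k.+1 m.
      rewrite !inE mem_cat; apply/or4P; apply: Or44; apply/mapP.
      by exists k.+1 => //; rewrite mem_iota add0n.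
    have -> : k.+1 = m by apply/eqP; rewrite eqn_leq km km1.
    by rewrite /u mulrCA divff ?gt_eqF// mulr1 !inE eqxx orbT.
  have [j jN jE] := idx _ ukL.
  have ij : (i < j)%N by rewrite -lt_t -?NS ?ltnS ?(ltnW iN)// jE.
  have : t i.+1 <= u k.+1 by rewrite -jE; exact: le_t.
  move: uk; rewrite /u -[k.+1]addn1 natrD mulrDl mul1r.
  by move=> *; lra.
Qed.

(** Values are prescribed on left-open cells because simple processes are constant there. The value
    at time 0 is left free, a point being negligible. *)
Lemma step_integral T N t (G : R -> R) (v : nat -> R) p : is_grid T N t ->
  (p <= N)%N -> (forall s, 0 <= G s) ->
  (forall i s, (i < p)%N -> t i < s <= t i.+1 -> G s = v i) ->
  measurable_fun `[0, t p] G /\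
  (\int[lebesgue_measure]_(s in `[0%R, t p]) (G s)%:E =
   (\sum_(i < p) v i * (t i.+1 - t i))%:E)%E.
Proof.
move=> g; elim: p => [|p IH] pN G0 GE.
  rewrite (grid0 g) set_itv1 integral_set1 big_ord0; split=> //.
  exact: measurable_fun_set1.
have [mG iG] := IH (ltnW pN) G0 (fun i s ip => GE i s (ltnW ip)).
have tp : t p < t p.+1 by exact: (grid_lt g).
have U : `[0, t p.+1]%classic = `[0, t p]%classic `|` `]t p, t p.+1]%classic.
  by rewrite -itv_bndbnd_setU// bnd_simp ?(grid_ge0 g (ltnW pN))// ltW.
have mG' : measurable_fun `]t p, t p.+1] G.
  apply: (eq_measurable_fun (cst (v p))) => // s.
  by rewrite inE/= in_itv/= => /(GE p s (ltnSn p)) ->.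
have mU : measurable_fun `[0, t p.+1] G by rewrite U; apply/measurable_funU.
split=> //; rewrite U ge0_integral_setU//=.
- rewrite iG big_ord_recr/= EFinD; congr (_ + _)%E.
  rewrite (eq_integral (cst (v p)%:E)); last first.
    by move=> s; rewrite inE/= in_itv/= => /(GE p s (ltnSn p)) ->.
  by rewrite integral_cst//= lebesgue_measure_itv/= lte_fin tp -EFinB EFinM.
- by rewrite -U; exact/measurable_EFinP.
- by move=> s _; rewrite lee_fin.
- apply/disj_setPS => s [/=]; rewrite !in_itv/= => /andP[_ sp] /andP[].
  by rewrite ltNge sp.
Qed.

Lemma sqr_sum_le n (x : 'I_n -> R) : (\sum_i x i) ^+ 2 <= n%:R * \sum_i x i ^+ 2.
Proof.
have : 0 <= \sum_i \sum_j (x i - x j) ^+ 2.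
  by apply: sumr_ge0 => i _; apply: sumr_ge0 => j _; exact: sqr_ge0.
have -> : \sum_i \sum_j (x i - x j) ^+ 2 =
   2 * (n%:R * \sum_i x i ^+ 2) - 2 * (\sum_i x i) ^+ 2.
  transitivity (\sum_i (n%:R * x i ^+ 2 - 2 * x i * (\sum_j x j) + \sum_j x j ^+ 2)).
    apply: eq_bigr => i _.
    under eq_bigr do rewrite sqrrB.
    rewrite !big_split/= sumr_const card_ord mulr_natl; congr (_ + _ + _).
    rewrite mulr_sumr -sumrN; apply: eq_bigr => j _.
    by rewrite -mulr_natl mulrA.
  rewrite !big_split/= sumrN -mulr_sumr -mulr_suml -mulr_sumr sumr_const card_ord.
  rewrite -mulr_natl; ring.
by lra.
Qed.

End grids.

Section simple_processes.
Context {R : realType} {dO : measure_display} {Omega : measurableType dO}.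
Variable P : probability Omega R.
Hypothesis hP : measure_is_complete P.
Context {d : nat}.
Variable W : R -> Omega -> 'cV[R]_d.
Hypothesis hW : brownian_motion P W.
Local Notation F := (bm_filtration P W).
Local Notation fmeas := (fmeas P W).
Local Notation dW := (dW W).

Definition incr_sum (t : nat -> R) (a : nat -> 'I_d -> Omega -> R) (p q : nat) (w : Omega) : R :=
  \sum_(p <= i < q) \sum_j a i j w * dW (t i) (t i.+1) j w.

Section incr_sum.
Variables (T : R) (N : nat) (t : nat -> R) (g : is_grid T N t).
Variables (a : nat -> 'I_d -> Omega -> R) (M : R).
Hypothesis ma : forall i j, (i < N)%N -> fmeas (t i) (a i j).
Hypothesis aM : forall i j w, `|a i j w| <= M.

Let tt i (iN : (i < N)%N) := grid_step g iN.

Let sqW i j : (i < N)%N -> sqint P (dW (t i) (t i.+1) j).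
Proof.
move=> iN; have [] := @incr_var R dO Omega P hP d W hW _ _ (tt iN) j (cst 1).
- exact: measurable_cst.
- exact: rint_cst.
- by [].
under eq_fun do rewrite mulr1.
move=> H _; split => //; apply: (measurable_dW hP hW).
by have /andP[-> /ltW ->] := tt iN.
Qed.

Let mona i j xi : (i < N)%N -> fmeas (t i) xi -> rint P xi ->
  rint P (fun w => xi w * (a i j w * dW (t i) (t i.+1) j w)) /\
  rE P (fun w => xi w * (a i j w * dW (t i) (t i.+1) j w)) = 0.
Proof.
move=> iN mxi ixi.
have ia : rint P (fun w => a i j w * xi w).
  by apply: (rintM_bdd (M := M)) => //; exact: fmeas_measurable (ma j iN).
have := incr_mean hP hW (tt iN) j (measurable_funM (ma j iN) mxi) ia.
rewrite (_ : (fun w => dW _ _ _ w * _) = (fun w => xi w * (a i j w * dW (t i) (t i.+1) j w)))//.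
by apply/funext => w; rewrite mulrC mulrAC mulrC.
Qed.

Lemma sqint_incr_sum p q : (p <= q <= N)%N -> sqint P (incr_sum t a p q).
Proof.
move=> /andP[pq qN]; rewrite /incr_sum.
elim: q pq qN => [|q IH] pq qN.
  by under eq_fun do rewrite big_geq//; exact: sqint_cst.
move: pq; rewrite leq_eqVlt ltnS => /predU1P[<-|pq].
  by under eq_fun do rewrite big_geq//; exact: sqint_cst.
under eq_fun do rewrite big_nat_recr//=.
apply: sqintD; first exact: IH (ltnW qN).
apply: sqint_sum => j; apply: (sqintM_bdd (M := M)) => //; last exact: sqW.
exact: fmeas_measurable (ma j qN).
Qed.

Lemma fmeas_incr_sum p q : (p <= q <= N)%N -> fmeas (t q) (incr_sum t a p q).
Proof.
move=> /andP[pq qN]; rewrite /incr_sum.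
elim: q pq qN => [|q IH] pq qN.
  by under eq_fun do rewrite big_geq//; exact: measurable_cst.
move: pq; rewrite leq_eqVlt ltnS => /predU1P[<-|pq].
  by under eq_fun do rewrite big_geq//; exact: measurable_cst.
under eq_fun do rewrite big_nat_recr//=.
have tq := ltW (grid_lt g qN).
apply: measurable_funD; first exact: fmeas_le tq (IH pq (ltnW qN)).
apply: measurable_sum => j; apply: measurable_funM.
  exact: fmeas_le tq (ma j qN).
by apply: fmeas_dW => //; exact: grid_ge0 g (ltnW qN).
Qed.

Lemma incr_sum_mean p q xi : (p <= q <= N)%N -> fmeas (t p) xi -> sqint P xi ->
  rE P (fun w => xi w * incr_sum t a p q w) = 0.
Proof.
move=> /andP[pq qN] mxi ixi.
elim: q pq qN => [|q IH] pq qN.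
  by under eq_fun do rewrite /incr_sum big_geq// mulr0; exact: rE_cst.
move: pq; rewrite leq_eqVlt ltnS => /predU1P[<-|pq].
  by under eq_fun do rewrite /incr_sum big_geq// mulr0; exact: rE_cst.
have mxq : fmeas (t q) xi by apply: fmeas_le mxi; exact: (grid_le g) (ltnW qN).
pose D w := \sum_j a q j w * dW (t q) (t q.+1) j w.
have E w : incr_sum t a p q.+1 w = incr_sum t a p q w + D w.
  by rewrite /incr_sum big_nat_recr.
under eq_fun do rewrite E mulrDr [xi _ * D _]mulr_sumr.
have H j := @mona q j xi qN mxq (sqint_rint ixi).
rewrite rED; last 2 first.
- by apply: sqintM => //; apply: sqint_incr_sum; rewrite pq ltnW.
- by apply: rint_sum => j; exact: (H j).1.
rewrite [X in X + _]IH// ?(ltnW qN)// add0r rE_sum; last by move=> j; exact: (H j).1.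
by rewrite big1// => j _; exact: (H j).2.
Qed.

(** A conditional form of Ito's isometry, as an inequality. Cross terms between cells vanish since
    the earlier sum is known when the next increment starts. The 8 is the rough Gaussian second
    moment, and [d] is lost by Cauchy-Schwarz over the coordinates of one increment. *)
Lemma incr_sum_var p q xi B : (p <= q <= N)%N -> fmeas (t p) xi ->
  (forall w, 0 <= xi w <= B) ->
  rE P (fun w => xi w * incr_sum t a p q w ^+ 2) <=
  8 * d%:R * rE P (fun w => xi w *
     \sum_(p <= i < q) (t i.+1 - t i) * \sum_j a i j w ^+ 2).
Proof.
move=> /andP[pq qN] mxi xiB.
have xi0 w : 0 <= xi w by case/andP: (xiB w).
have xiB' w : `|xi w| <= B by rewrite ger0_norm//; case/andP: (xiB w).
have mxi' := fmeas_measurable hP hW mxi.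
have bdd_rint f : sqint P f -> rint P (fun w => xi w * f w ^+ 2).
  by move=> [mf f2]; apply: (rintM_bdd (M := B)).
have sqa i j : (i < N)%N -> sqint P (a i j).
  move=> iN; apply: (@sqint_bdd _ _ _ P M) => //.
  exact: fmeas_measurable (ma j iN).
have rxa i j : (i < N)%N -> rint P (fun w => xi w * a i j w ^+ 2).
  by move=> iN; apply: bdd_rint; exact: sqa.
have rsum q' : (q' <= N)%N -> rint P (fun w => xi w *
     \sum_(p <= i < q') (t i.+1 - t i) * \sum_j a i j w ^+ 2).
  move=> q'N; apply: (rintM_bdd (M := B)) => //.
  elim: q' q'N => [|q' IH] q'N.
    by under eq_fun do rewrite big_geq//; exact: rint_cst.
  have [pq'|pq'] := leqP p q'; last by under eq_fun do rewrite big_geq//; exact: rint_cst.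
  under eq_fun do rewrite big_nat_recr//=.
  apply: rintD; first exact: IH (ltnW q'N).
  by apply: rintZ; apply: rint_sum => j; exact: (sqa _ _ q'N).2.
elim: q pq qN => [|q IH] pq qN.
  under eq_fun do rewrite /incr_sum big_geq// expr0n mulr0.
  under [in leRHS]eq_fun do rewrite big_geq// mulr0.
  by rewrite !rE_cst mulr0.
move: pq; rewrite leq_eqVlt ltnS => /predU1P[<-|pq].
  under eq_fun do rewrite /incr_sum big_geq// expr0n mulr0.
  under [in leRHS]eq_fun do rewrite big_geq// mulr0.
  by rewrite !rE_cst mulr0.
have mxq : fmeas (t q) xi by apply: fmeas_le mxi; exact: (grid_le g) (ltnW qN).
pose D w := \sum_j a q j w * dW (t q) (t q.+1) j w.
have iV : sqint P (incr_sum t a p q) by apply: sqint_incr_sum; rewrite pq ltnW.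
have mV : fmeas (t q) (incr_sum t a p q) by apply: fmeas_incr_sum; rewrite pq ltnW.
have saW j : sqint P (fun w => a q j w * dW (t q) (t q.+1) j w).
  apply: (sqintM_bdd (M := M)) => //; last exact: sqW.
  exact: fmeas_measurable (ma j qN).
have iD : sqint P D by apply: sqint_sum => j; exact: saW.
have E w : incr_sum t a p q.+1 w = incr_sum t a p q w + D w.
  by rewrite /incr_sum big_nat_recr.
have -> : (fun w => xi w * incr_sum t a p q.+1 w ^+ 2) = (fun w =>
    xi w * incr_sum t a p q w ^+ 2 + 2 * (xi w * (incr_sum t a p q w * D w)) +
    xi w * D w ^+ 2) by apply/funext => w; rewrite E; ring.
have ixV : rint P (fun w => xi w * incr_sum t a p q w).
  by apply: (rintM_bdd (M := B)) => //; exact: sqint_rint.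
have HD j := @mona q j _ qN (measurable_funM mxq mV) ixV.
have cross : rint P (fun w => xi w * (incr_sum t a p q w * D w)) /\
    rE P (fun w => xi w * (incr_sum t a p q w * D w)) = 0.
  under eq_fun do rewrite mulrA /D mulr_sumr.
  split; first by apply: rint_sum => j; exact: (HD j).1.
  rewrite rE_sum; last by move=> j; exact: (HD j).1.
  by rewrite big1// => j _; exact: (HD j).2.
rewrite rED; last 2 first.
- by apply: rintD; [exact: bdd_rint|apply: rintZ; exact: cross.1].
- exact: bdd_rint.
rewrite rED; last 2 first.
- exact: bdd_rint.
- by apply: rintZ; exact: cross.1.
rewrite rEZ; last exact: cross.1.
rewrite cross.2 mulr0 addr0.
under [in leRHS]eq_fun do rewrite big_nat_recr//= mulrDr.
have rq : rint P (fun w => xi w * ((t q.+1 - t q) * \sum_j a q j w ^+ 2)).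
  by apply: (rintM_bdd (M := B)) => //; apply: rintZ; apply: rint_sum => j; exact: (sqa _ _ qN).2.
rewrite rED//; last exact: rsum (ltnW qN).
rewrite [leRHS]mulrDr; apply: lerD; first exact: IH (ltnW qN).
have VW j := incr_var hP hW (tt qN) j (measurable_funM mxq (measurable_funX 2 (ma j qN)))
  (rxa q j qN) (fun w => mulr_ge0 (xi0 w) (sqr_ge0 _)).
have rXD j : rint P (fun w => xi w * (a q j w * dW (t q) (t q.+1) j w) ^+ 2).
  exact: bdd_rint.
apply: (@le_trans _ _ (rE P (fun w => d%:R *
    \sum_j xi w * (a q j w * dW (t q) (t q.+1) j w) ^+ 2))).
  apply: rE_le; first exact: bdd_rint.
  - by apply: rintZ; exact: rint_sum.
  - move=> w; rewrite -mulr_sumr [leRHS]mulrCA ler_wpM2l//.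
    exact: sqr_sum_le.
rewrite rEZ; last exact: rint_sum.
rewrite rE_sum// (mulrC 8) -mulrA ler_wpM2l//.
apply: (@le_trans _ _ (\sum_j 8 * (t q.+1 - t q) * rE P (fun w => xi w * a q j w ^+ 2))).
  apply: ler_sum => j _; apply: le_trans (VW j).2.
  by apply: rE_le; [exact: rXD|exact: (VW j).1|move=> w /=; rewrite exprMn; lra].
rewrite -mulr_sumr -rE_sum; last by move=> j; exact: rxa.
rewrite -mulrA ler_wpM2l// -rEZ; last by apply: rint_sum => j; exact: rxa.
rewrite le_eqVlt; apply/orP; left; apply/eqP; congr rE; apply/funext => w.
by rewrite [RHS]mulrCA [in RHS]mulr_sumr.
Qed.

End incr_sum.

Section on_grid.
Variables (m : nat) (S : @simple_process R dO Omega F d m).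
Variables (T : R) (N : nat) (t : nat -> R) (g : is_grid T N t).
Hypothesis gS : forall k, (k <= sp_size S)%N ->
  exists2 j, (j <= N)%N & t j = Num.min (sp_time S k) T.

(** The cell is []t i, t i.+1]], closed on the right, so its constant value is read at [t i.+1]; it
    is nevertheless known at time [t i]. *)
Definition grid_coef (r : 'I_m) (i : nat) (j : 'I_d) (w : Omega) : R :=
  simple_val S (t i.+1) w r j.

(** No jump time lies strictly inside a cell. This gives both the constancy of the simple process on
    cells and the measurability of [grid_coef] at the left end. *)
Let time_lt k i : (k <= sp_size S)%N -> (i < N)%N -> sp_time S k < t i.+1 ->
  sp_time S k <= t i.
Proof.
move=> kS iN lt; have [j jN] := gS kS.
have ltT : sp_time S k < T by exact: lt_le_trans lt (grid_leT g iN).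
rewrite min_l; last exact: ltW.
move=> tj.
by move: lt; rewrite -tj (grid_ltP g)// ltnS => ji; exact: (grid_le g) (ltnW iN).
Qed.

Let time_ltE k i s : (k <= sp_size S)%N -> (i < N)%N -> t i < s <= t i.+1 ->
  (sp_time S k < s) = (sp_time S k < t i.+1).
Proof.
move=> kS iN /andP[ts st]; apply/idP/idP => [/lt_le_trans|lt]; first exact.
exact: le_lt_trans (time_lt kS iN lt) ts.
Qed.

Lemma simple_val_grid i s w : (i < N)%N -> t i < s <= t i.+1 ->
  simple_val S s w = simple_val S (t i.+1) w.
Proof.
move=> iN ts; apply: eq_bigr => k _; congr (_ *: _).
rewrite !indicE !mem_setE !in_itv/= !leNgt.
have k1 : (k.+1 <= sp_size S)%N by [].
by rewrite (time_ltE (ltnW k1) iN ts) (time_ltE k1 iN ts).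
Qed.

Lemma fmeas_grid_coef r i j : (i < N)%N -> fmeas (t i) (grid_coef r i j).
Proof.
move=> iN; rewrite /grid_coef /simple_val.
have -> : (fun w => (\sum_(k < sp_size S) \1_(`]sp_time S k, sp_time S k.+1]) (t i.+1) *:
    sp_coef S k w) r j) = (fun w => \sum_(k < sp_size S)
    \1_(`]sp_time S k, sp_time S k.+1]) (t i.+1) * sp_coef S k w r j).
  by apply/funext => w; rewrite summxE; apply: eq_bigr => k _; rewrite mxE.
apply: measurable_sum => k; rewrite indicE mem_setE in_itv/=.
case: (boolP (_ < _ <= _)) => [/andP[lt _]|_]; last first.
  by under eq_fun do rewrite mul0r; exact: measurable_cst.
under eq_fun do rewrite mul1r.
have mc : fmeas (sp_time S k) (fun w => sp_coef S k w r j) by exact: sp_coef_measurable.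
have := fmeas_le (time_lt (ltnW (ltn_ord k)) iN lt) mc.
rewrite /fmeas.
by [].
Qed.

Lemma grid_coef_bounded : exists M, forall r i j w, `|grid_coef r i j w| <= M.
Proof.
have [C HC] := sp_coef_bounded S.
have entry k w r j : `|sp_coef S k w r j| <= C.
  apply: le_trans (HC k w); rewrite /enorm -sqrtr_sqr ler_sqrt.
    rewrite (bigD1 r)//= (bigD1 j)//= -addrA lerDl addr_ge0//.
      by apply: sumr_ge0 => *; exact: sqr_ge0.
    by apply: sumr_ge0 => *; apply: sumr_ge0 => *; exact: sqr_ge0.
  by apply: sumr_ge0 => *; apply: sumr_ge0 => *; exact: sqr_ge0.
exists (\sum_(k < sp_size S) C) => r i j w.
rewrite /grid_coef /simple_val summxE (le_trans (ler_norm_sum _ _ _))//.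
apply: ler_sum => k _; rewrite mxE normrM.
by apply: le_trans (entry k w r j); rewrite ler_piMl//; exact: indic_le1.
Qed.

Let time_idx k p : (k <= sp_size S)%N -> (p <= N)%N -> exists2 j, (j <= p)%N &
  t j = Num.min (sp_time S k) (t p) /\
  forall i, (i < p)%N -> (sp_time S k < t i.+1) = (j <= i)%N.
Proof.
move=> kS pN; have [ltp|lep] := ltP (sp_time S k) (t p); last first.
  exists p => //; split=> // i ip.
  rewrite leqNgt ip/=; apply/negbTE; rewrite -leNgt.
  by apply: le_trans lep; exact: (grid_le g).
have [j jN] := gS kS; rewrite min_l => [tj|]; last first.
  exact: (le_trans (ltW ltp) (grid_leT g pN)).
have jp : (j < p)%N by rewrite -(grid_ltP g)// tj.
exists j; [exact: ltnW|split=> // i ip].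
by rewrite -tj (grid_ltP g)// (leq_trans ip).
Qed.

(** After capping at [t p], consecutive jump times are nodes, and the increment of [W] between them
    telescopes over the cells in between. *)
Lemma simple_ito_grid p w r : (p <= N)%N ->
  simple_ito W S (t p) w r 0 = incr_sum t (grid_coef r) 0 p w.
Proof.
move=> pN; rewrite /simple_ito /incr_sum summxE.
under [RHS]eq_bigr do under eq_bigr do
  rewrite /grid_coef /simple_val summxE mulr_suml.
under [RHS]eq_bigr do rewrite exchange_big/=.
rewrite exchange_big/=; apply: eq_bigr => k _.
have kS : (k <= sp_size S)%N by exact: ltnW.
have k1S : (k.+1 <= sp_size S)%N by [].
have [ja jap [tja Hja]] := time_idx kS pN.
have [jb jbp [tjb Hjb]] := time_idx k1S pN.
have jab : (ja <= jb)%N.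
  rewrite leqNgt; apply/negP => jba.
  have := Hja jb (leq_trans jba jap); rewrite leqNgt jba/=.
  have := Hjb jb (leq_trans jba jap); rewrite leqnn => lt.
  by rewrite (le_lt_trans (sp_time_nondecreasing S k) lt).
rewrite mxE exchange_big/=; apply: eq_bigr => j _.
rewrite -tja -tjb !mxE.
transitivity (\sum_(0 <= i < p) (if (ja <= i < jb)%N then
    sp_coef S k w r j * (W (t i.+1) w j 0 - W (t i) w j 0) else 0)).
  transitivity (\sum_(ja <= i < jb)
      sp_coef S k w r j * (W (t i.+1) w j 0 - W (t i) w j 0)).
    by rewrite -mulr_sumr (telescope_sumr (fun i => W (t i) w j 0)).
  rewrite (big_nat_widen _ _ p)// (big_nat_widenl _ 0%N)// big_mkcond.
  by apply: eq_bigr => i _; rewrite /= andbC.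
apply: eq_big_nat => i /andP[_ ip].
rewrite mxE indicE mem_setE in_itv/= Hja// leNgt Hjb// -ltnNge.
by case: ifP => _; rewrite ?mul1r// !mul0r.
Qed.

Lemma simple_val_grid_coef i s w r j : (i < N)%N -> t i < s <= t i.+1 ->
  simple_val S s w r j = grid_coef r i j w.
Proof. by move=> iN ts; rewrite (simple_val_grid w iN ts). Qed.

End on_grid.

End simple_processes.

(** * Increments of the Ito integral *)

Section joint_measurability.
Context {R : realType} {dO : measure_display} {Omega : measurableType dO}.
Variable P : probability Omega R.

Definition jmeas (T : R) (g : R -> Omega -> R) : Prop :=
  measurable_fun (`[0, T] `*` [set: Omega]) (fun p : measurableTypeR R * Omega => g p.1 p.2).

Let mdom (T : R) : measurable (`[0, T] `*` [set: Omega] : set (measurableTypeR R * Omega)).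
Proof. exact: measurableX. Qed.

Lemma jmeas_path T g w : jmeas T g -> measurable_fun `[0, T] (g^~ w).
Proof.
move=> mg _ B mB.
have -> : `[0, T] `&` (g^~ w) @^-1` B =
  ysection ((`[0, T] `*` [set: Omega]) `&` (fun p => g p.1 p.2) @^-1` B) w.
  apply/seteqP; split => s /=; rewrite /ysection/= ?inE//=.
  - by move=> [].
  - by move=> [[]].
exact: (measurable_ysection w (mg (mdom T) B mB)).
Qed.

Lemma jmeas_integral T g : jmeas T g -> (forall s w, 0 <= g s w) ->
  measurable_fun setT (fun w => \int[lebesgue_measure]_(s in `[0%R, T]) (g s w)%:E)%E.
Proof.
move=> mg g0.
pose f (p : Omega * measurableTypeR R) : \bar R :=
  ((fun q : measurableTypeR R * Omega => (g q.1 q.2)%:E) \_ (`[0, T] `*` setT)) (p.2, p.1).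
have mf : measurable_fun setT f.
  apply: (@measurableT_comp _ _ _ _ _ _ ((fun q : measurableTypeR R * Omega =>
    (g q.1 q.2)%:E) \_ (`[0, T] `*` setT)) _ (fun p : Omega * measurableTypeR R => (p.2, p.1))).
    by apply/(measurable_restrictT _ (mdom T)); exact/measurable_EFinP.
  exact: measurable_swap.
have f0 p : (0 <= f p)%E by rewrite /f patchE; case: ifP => // _; rewrite lee_fin.
have := @measurable_fun_fubini_tonelli_F _ _ _ _ _ lebesgue_measure f mf f0.
apply: eq_measurable_fun => w _.
rewrite /fubini_F [RHS]integral_mkcond; apply: eq_integral => s _.
rewrite /f !patchE /=; congr (if _ then _ else _).
by apply/idP/idP; rewrite !inE/= => // -[].
Qed.

(** A nonnegative variable of finite mean is almost surely finite, hence may be exchanged for its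
    real part; this is how integrals over time become real random variables. *)
Lemma fine_rint (E : Omega -> \bar R) : measurable_fun setT E ->
  (forall w, (0 <= E w)%E) -> (\int[P]_w E w < +oo)%E ->
  [/\ rint P (fun w => fine (E w)), (rE P (fun w => fine (E w)))%:E = (\int[P]_w E w)%E
    & {ae P, forall w, E w = (fine (E w))%:E}].
Proof.
move=> mE E0 iE.
have iE' : P.-integrable setT E.
  apply/integrableP; split=> //.
  by under eq_integral do rewrite gee0_abs//.
have ae : {ae P, forall w, E w = (fine (E w))%:E}.
  have := integrable_ae measurableT iE'; apply: filterS => w /(_ I) H.
  by rewrite fineK.
have mf : measurable_fun setT (fun w => fine (E w)) by exact: measurableT_comp.
have e : (\int[P]_w (fine (E w))%:E = \int[P]_w E w)%E.
  apply: ae_eq_integral => //; first exact/measurable_EFinP.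
  by apply: filterS ae => w + _ => ->.
have i : rint P (fun w => fine (E w)).
  apply: rint_lty => //; first by move=> w; exact: fine_ge0.
  by rewrite e.
by split=> //; rewrite -rEfin// e.
Qed.

Lemma enorm_sqr m n (A : 'M[R]_(m, n)) : enorm A ^+ 2 = \sum_i \sum_j A i j ^+ 2.
Proof.
rewrite /enorm sqr_sqrtr//.
by apply: sumr_ge0 => i _; apply: sumr_ge0 => j _; exact: sqr_ge0.
Qed.

Lemma enorm_ge0 m n (A : 'M[R]_(m, n)) : 0 <= enorm A.
Proof. exact: sqrtr_ge0. Qed.

Lemma enorm_sqr_col m (A : 'cV[R]_m) : enorm A ^+ 2 = \sum_i A i 0 ^+ 2.
Proof. by rewrite enorm_sqr; apply: eq_bigr => i _; rewrite big_ord1. Qed.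

Lemma sqrD_le2 (x y : R) : (x + y) ^+ 2 <= 2 * x ^+ 2 + 2 * y ^+ 2.
Proof. by have := sqr_ge0 (x - y); nra. Qed.

Lemma enorm_sqrD m n (A B : 'M[R]_(m, n)) :
  enorm (A + B) ^+ 2 <= 2 * enorm A ^+ 2 + 2 * enorm B ^+ 2.
Proof.
rewrite !enorm_sqr !mulr_sumr -big_split/=; apply: ler_sum => i _.
rewrite !mulr_sumr -big_split/=; apply: ler_sum => j _.
by rewrite mxE; exact: sqrD_le2.
Qed.

Lemma enorm_sqrN m n (A : 'M[R]_(m, n)) : enorm (- A) ^+ 2 = enorm A ^+ 2.
Proof.
by rewrite !enorm_sqr; apply: eq_bigr => i _; apply: eq_bigr => j _; rewrite mxE sqrrN.
Qed.

Lemma jmeas_enorm_sqr T m n (A : R -> Omega -> 'M[R]_(m, n)) :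
  (forall i j, jmeas T (fun s w => A s w i j)) ->
  jmeas T (fun s w => enorm (A s w) ^+ 2).
Proof.
move=> mA; rewrite /jmeas.
have -> : (fun p : measurableTypeR R * Omega => enorm (A p.1 p.2) ^+ 2) =
          (fun p => \sum_i \sum_j A p.1 p.2 i j ^+ 2).
  by apply/funext => p; rewrite enorm_sqr.
apply: measurable_sum => i; apply: measurable_sum => j.
by apply: measurable_funX; exact: mA.
Qed.

End joint_measurability.

Section ito_increments.
Context {R : realType} {dO : measure_display} {Omega : measurableType dO}.
Variable P : probability Omega R.
Hypothesis hP : measure_is_complete P.
Context {d : nat}.
Variable W : R -> Omega -> 'cV[R]_d.
Hypothesis hW : brownian_motion P W.
Local Notation F := (bm_filtration P W).
Local Notation fmeas := (fmeas P W).
Local Notation dW := (dW W).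

Lemma progressive_jmeas T g : 0 <= T -> progressive F g -> jmeas T g.
Proof.
move=> T0 pg.
have mid : measurable_fun setT (fun p : measurableTypeR R * Omega =>
    (p.1, p.2) : measurableTypeR R * g_sigma_algebraType (F T)).
  apply: measurable_fun_pair; first exact: measurable_fst.
  move=> _ B mB; rewrite setTI.
  rewrite -[X in measurable X]setTI; apply: measurable_snd => //.
  by apply: (bm_filtration_measurable hP hW); exact: measurable_bm_filtration mB.
move=> mD B mB.
have := mid measurableT _ (pg T T0 (measurableX _ measurableT) B mB).
rewrite setTI; apply.
exact: measurable_itv.
Qed.

Lemma jmeas_simple_val T m (S : @simple_process R dO Omega F d m) i j :
  jmeas T (fun s w => simple_val S s w i j).
Proof.
rewrite /jmeas /simple_val.
have -> : (fun p : measurableTypeR R * Omega => (\sum_(k < sp_size S)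
    \1_(`]sp_time S k, sp_time S k.+1]) p.1 *: sp_coef S k p.2) i j) =
  (fun p => \sum_(k < sp_size S)
    \1_(`]sp_time S k, sp_time S k.+1]) p.1 * sp_coef S k p.2 i j).
  by apply/funext => p; rewrite summxE; apply: eq_bigr => k _; rewrite mxE.
apply: measurable_funTS; apply: measurable_sum => k; apply: measurable_funM.
  apply: (@measurableT_comp _ _ _ _ _ _ (\1_(`]sp_time S k, sp_time S k.+1]%classic) : measurableTypeR R -> R) _ fst).
    exact: measurable_indic.
  exact: measurable_fst.
apply: (@measurableT_comp _ _ _ _ _ _ (fun w => sp_coef S k w i j) _ snd).
  by apply: (fmeas_measurable hP hW (t := sp_time S k)); exact: sp_coef_measurable.
exact: measurable_snd.
Qed.

Definition grid_fits m (S : @simple_process R dO Omega F d m) (T : R) (N : nat) (t : nat -> R) :=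
  forall k, (k <= sp_size S)%N -> exists2 j, (j <= N)%N & t j = Num.min (sp_time S k) T.

Lemma sp_time_nneg m (S : @simple_process R dO Omega F d m) k : 0 <= sp_time S k.
Proof.
elim: k => [|k IH]; first exact: sp_time_ge0.
exact: le_trans IH (sp_time_nondecreasing S k).
Qed.

Lemma grid_fits_ex m1 m2 (S1 : @simple_process R dO Omega F d m1)
    (S2 : @simple_process R dO Omega F d m2) (T del : R) (L : seq R) :
  0 < T -> 0 < del -> (forall x, x \in L -> 0 <= x <= T) ->
  exists N t, [/\ is_grid T N t, grid_fits S1 T N t, grid_fits S2 T N t,
    forall x, x \in L -> exists2 j, (j <= N)%N & t j = x &
    forall i, (i < N)%N -> t i.+1 - t i <= del].
Proof.
move=> T0 del0 LT.
pose tm m (S : @simple_process R dO Omega F d m) :=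
  [seq Num.min (sp_time S k) T | k <- iota 0 (sp_size S).+1].
have tmT m (S : @simple_process R dO Omega F d m) x : x \in tm m S -> 0 <= x <= T.
  move=> /mapP[k _ ->]; rewrite le_min sp_time_nneg ltW//=.
  by rewrite ge_min lexx orbT.
have [|N [t [g H1 H2]]] := @grid_ex R T del (tm _ S1 ++ tm _ S2 ++ L) T0 del0.
  by move=> x; rewrite !mem_cat => /or3P[/tmT|/tmT|/LT].
exists N, t; split=> //.
- move=> k kS; apply: H1; rewrite mem_cat; apply/orP; left; apply/mapP.
  by exists k => //; rewrite mem_iota.
- move=> k kS; apply: H1; rewrite !mem_cat; apply/or3P; apply: Or32; apply/mapP.
  by exists k => //; rewrite mem_iota.
- by move=> x xL; apply: H1; rewrite !mem_cat xL !orbT.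
Qed.

Section ito.
Variables (m : nat) (H : R -> Omega -> 'M[R]_(m, d)) (I : R -> Omega -> 'cV[R]_m).
Hypothesis hI : ito_integral P F W H I.

Implicit Types S : @simple_process R dO Omega F d m.

Definition sim_err S (t : R) (w : Omega) : \bar R :=
  (\int[lebesgue_measure]_(s in `[0%R, t]) (enorm (simple_val S s w - H s w) ^+ 2)%:E)%E.

Lemma ito_jmeas t i j : 0 <= t -> jmeas t (fun s w => H s w i j).
Proof. by move=> t0; case: hI => -[pH _] _ _ _; exact: progressive_jmeas. Qed.

Lemma sim_err_jmeas S t : 0 <= t ->
  jmeas t (fun s w => enorm (simple_val S s w - H s w) ^+ 2).
Proof.
move=> t0; apply: jmeas_enorm_sqr => i j; rewrite /jmeas.
have -> : (fun p : measurableTypeR R * Omega => (simple_val S p.1 p.2 - H p.1 p.2) i j) =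
    (fun p => simple_val S p.1 p.2 i j - H p.1 p.2 i j).
  by apply/funext => p; rewrite !mxE.
by apply: measurable_funB; [exact: jmeas_simple_val|exact: ito_jmeas].
Qed.

Lemma measurable_sim_err S t : 0 <= t -> measurable_fun setT (sim_err S t).
Proof.
move=> t0; apply: (jmeas_integral (sim_err_jmeas S t0)) => s w.
exact: sqr_ge0.
Qed.

Lemma sim_err_ge0 S t w : (0 <= sim_err S t w)%E.
Proof. by apply: integral_ge0 => s _; rewrite lee_fin sqr_ge0. Qed.

Lemma sqint_simple_ito S t r : 0 <= t -> sqint P (fun w => simple_ito W S t w r 0).
Proof.
(* The horizon [t + 1] is positive even if [t = 0], and [t] is made a node of the grid. *)
move=> t0; have T0 : 0 < t + 1 by rewrite ltr_wpDl.
have [|N [tt [g fS _ /(_ t (mem_head _ _))[p pN tp] _]]] :=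
    @grid_fits_ex _ _ S S (t + 1) 1 [:: t] T0 ltr01.
  by move=> x; rewrite inE => /eqP ->; rewrite t0/= lerDl.
have [M HM] := grid_coef_bounded S tt.
rewrite -tp; under eq_fun do rewrite (simple_ito_grid g fS _ _ pN).
apply: (sqint_incr_sum hP hW g (M := M)) => //.
by move=> i j iN; exact: (fmeas_grid_coef g fS).
Qed.

Lemma ito_measurable t r : 0 <= t -> measurable_fun setT (fun w => I t w r 0).
Proof. by move=> t0; case: hI => _ aI _ _; apply: (fmeas_measurable hP hW (t := t)); exact: aI. Qed.

Lemma ito_approx t eps : 0 <= t -> 0 < eps -> exists S,
  [/\ (\int[P]_w sim_err S t w < eps%:E)%E,
      forall r, sqint P (fun w => simple_ito W S t w r 0 - I t w r 0) &
      rE P (fun w => \sum_r (simple_ito W S t w r 0 - I t w r 0) ^+ 2) < eps].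
Proof.
move=> t0 e0; case: hI => _ _ _ /(_ t t0)[S [c1 c2]].
have e0' : (0 < eps%:E :> \bar R)%E by rewrite lte_fin.
have n1 : \forall n \near \oo, (\int[P]_w sim_err (S n) t w < eps%:E)%E.
  exact: (c1 _ (open_ereal_lt' e0')).
have n2 : \forall n \near \oo, (\int[P]_w
    (enorm (simple_ito W (S n) t w - I t w) ^+ 2)%:E < eps%:E)%E.
  exact: (c2 _ (open_ereal_lt' e0')).
have [n [h1 h2]] : exists n, (\int[P]_w sim_err (S n) t w < eps%:E)%E /\
  (\int[P]_w (enorm (simple_ito W (S n) t w - I t w) ^+ 2)%:E < eps%:E)%E.
  have [n _ Hn] := filterI n1 n2.
  by exists n; apply: Hn => /=.
have E w : enorm (simple_ito W (S n) t w - I t w) ^+ 2 =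
    \sum_r (simple_ito W (S n) t w r 0 - I t w r 0) ^+ 2.
  by rewrite enorm_sqr_col; apply: eq_bigr => r _; rewrite !mxE.
move: h2; under eq_integral do rewrite E; move=> h2.
have md r : measurable_fun setT (fun w => simple_ito W (S n) t w r 0 - I t w r 0).
  apply: measurable_funB; last exact: ito_measurable.
  by have [] := sqint_simple_ito (S n) r t0.
have msum : measurable_fun setT (fun w => \sum_r (simple_ito W (S n) t w r 0 - I t w r 0) ^+ 2).
  by apply: measurable_sum => r; apply: measurable_funX.
have isum : rint P (fun w => \sum_r (simple_ito W (S n) t w r 0 - I t w r 0) ^+ 2).
  apply: rint_lty => //; last exact: lt_trans h2 (ltry _).
  by move=> w; apply: sumr_ge0 => r _; exact: sqr_ge0.
exists (S n); split => //.
- move=> r; split=> //; apply: rint_le isum; first exact: measurable_funX.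
  move=> w; rewrite ger0_norm ?sqr_ge0// (bigD1 r)//= lerDl.
  by apply: sumr_ge0 => *; exact: sqr_ge0.
- by move: h2; rewrite rEfin.
Qed.

Lemma sqint_ito t r : 0 <= t -> sqint P (fun w => I t w r 0).
Proof.
move=> t0; have [S [_ iS _]] := ito_approx t0 ltr01.
have := sqintB (sqint_simple_ito S r t0) (iS r).
by under eq_fun do rewrite subKr.
Qed.

Lemma sim_err_le S s t w : 0 <= s <= t -> (sim_err S s w <= sim_err S t w)%E.
Proof.
move=> /andP[s0 st]; apply: ge0_subset_integral => //.
- apply/measurable_EFinP; apply: (jmeas_path w (sim_err_jmeas S _)).
  exact: le_trans st.
- by move=> u _; rewrite lee_fin sqr_ge0.
- by apply: subset_itvl; rewrite bnd_simp.
Qed.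

(** Both step processes approximate the same [H], so their distance on a common grid is controlled
    by their two errors. *)
Lemma grid_diff_err S S' T N (t : nat -> R) p w : is_grid T N t ->
  grid_fits S T N t -> grid_fits S' T N t -> (p <= N)%N ->
  ((\sum_(i < p) (\sum_r \sum_j (grid_coef S t r i j w - grid_coef S' t r i j w) ^+ 2)
     * (t i.+1 - t i))%:E <= 2%:E * (sim_err S (t p) w + sim_err S' (t p) w))%E.
Proof.
move=> g fS fS' pN; have tp0 := grid_ge0 g pN.
pose G s := enorm (simple_val S s w - simple_val S' s w) ^+ 2.
have [||mG <-] := @step_integral R T N t G (fun i => \sum_r \sum_j
    (grid_coef S t r i j w - grid_coef S' t r i j w) ^+ 2) p g pN.
- by move=> s; exact: sqr_ge0.
- move=> i s ip ts; rewrite /G enorm_sqr; apply: eq_bigr => r _; apply: eq_bigr => j _.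
  have iN := leq_trans ip pN.
  rewrite -(simple_val_grid_coef g fS w r j iN ts) -(simple_val_grid_coef g fS' w r j iN ts).
  by rewrite !mxE.
have mS S0 : measurable_fun `[0, t p] (fun s => (enorm (simple_val S0 s w - H s w) ^+ 2)%:E).
  by apply/measurable_EFinP; exact: (jmeas_path w (sim_err_jmeas S0 tp0)).
have S0ge0 S0 s : (0 <= (enorm (simple_val S0 s w - H s w) ^+ 2)%:E)%E.
  by rewrite lee_fin sqr_ge0.
rewrite /sim_err -ge0_integralD//; [|exact: mS|exact: mS].
rewrite -ge0_integralZl//; last 2 first.
- by apply: emeasurable_funD; exact: mS.
- by move=> s _; rewrite adde_ge0.
apply: ge0_le_integral => //.
- by move=> s _; rewrite lee_fin sqr_ge0.
- exact/measurable_EFinP.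
- by apply: measurable_funeM; apply: emeasurable_funD; exact: mS.
- move=> s _; rewrite -EFinD -EFinM lee_fin /G mulrDr.
  have := enorm_sqrD (simple_val S s w - H s w) (- (simple_val S' s w - H s w)).
  by rewrite enorm_sqrN opprB addrA subrK.
Qed.

(** A bound on [H] passes to its approximation up to the error, since
    [|S|^2 <= 2 |S - H|^2 + 2 |H|^2]. The indicator of []t p, t q]] restricts the first-order term
    to the cells between the two nodes, while the error is taken over all of [[0, t q]]. *)
Lemma grid_coef_err C2 S T N (t : nat -> R) p q w : is_grid T N t ->
  grid_fits S T N t -> (p <= q <= N)%N ->
  (forall s, 0 <= s -> enorm (H s w) ^+ 2 <= C2) ->
  ((\sum_(p <= i < q) (t i.+1 - t i) * \sum_r \sum_j grid_coef S t r i j w ^+ 2)%:E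
   <= (2 * C2 * (t q - t p))%:E + 2%:E * sim_err S (t q) w)%E.
Proof.
move=> g fS /andP[pq qN] HC; have tq0 := grid_ge0 g qN.
have tp0 := grid_ge0 g (leq_trans pq qN); have tpq := grid_le g pq qN.
have C20 : 0 <= C2 by apply: le_trans (HC 0 (lexx _)); exact: sqr_ge0.
pose G s := \1_(`]t p, t q]%classic) s * enorm (simple_val S s w) ^+ 2.
have [||mG IG] := @step_integral R T N t G (fun i => (p <= i)%N%:R *
  \sum_r \sum_j grid_coef S t r i j w ^+ 2) q g qN.
- by move=> s; rewrite mulr_ge0// sqr_ge0.
- move=> i s iq ts; have iN := leq_trans iq qN.
  rewrite /G enorm_sqr indicE mem_setE in_itv/=.
  have -> : s <= t q.
    by case/andP: ts => _ /le_trans; apply; exact: (grid_le g).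
  have -> : (t p < s) = (p <= i)%N.
    apply/idP/idP => [ps|pi]; last first.
      by apply: le_lt_trans (grid_le g pi (ltnW iN)) _; case/andP: ts.
    rewrite leqNgt; apply/negP => ip; move: ps; rewrite ltNge => /negP; apply.
    by case/andP: ts => _ /le_trans; apply; apply: (grid_le g) => //; exact: leq_trans qN.
  rewrite andbT; congr (_ * _).
  by apply: eq_bigr => r _; apply: eq_bigr => j _; rewrite (simple_val_grid_coef g fS w r j iN ts).
have -> : \sum_(p <= i < q) (t i.+1 - t i) * \sum_r \sum_j grid_coef S t r i j w ^+ 2 =
    \sum_(i < q) (p <= i)%N%:R * (\sum_r \sum_j grid_coef S t r i j w ^+ 2) * (t i.+1 - t i).
  rewrite (big_nat_widenl _ 0%N)//= big_mkord big_mkcond.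
  by apply: eq_bigr => i _; case: (p <= i)%N; rewrite ?mul1r ?mul0r// mulrC.
rewrite -IG.
have mS : measurable_fun `[0, t q] (fun s => (enorm (simple_val S s w - H s w) ^+ 2)%:E).
  by apply/measurable_EFinP; exact: (jmeas_path w (sim_err_jmeas S tq0)).
have Sge0 s : (0 <= (enorm (simple_val S s w - H s w) ^+ 2)%:E)%E.
  by rewrite lee_fin sqr_ge0.
have -> : (2 * C2 * (t q - t p))%:E =
    (\int[lebesgue_measure]_(s in `[0%R, t q]) ((2 * C2) * \1_(`]t p, t q]%classic) s)%:E)%E.
  under eq_integral do rewrite EFinM.
  rewrite ge0_integralZl//; last 2 first.
  - exact/measurable_EFinP/measurable_indic.
  - by rewrite lee_fin mulr_ge0.
  rewrite integral_indic//= setIC (_ : `[0, t q] `&` `]t p, t q] = `]t p, t q]%classic); last first.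
    apply/seteqP; split => s /=; rewrite !in_itv/=; first by move=> [].
    by move=> /andP[ps ->]; rewrite ps (le_trans tp0 (ltW ps)).
  rewrite lebesgue_measure_itv/= lte_fin; case: ltP => tt; first by rewrite -EFinB -EFinM.
  by rewrite (_ : t q = t p) ?subrr ?mulr0 ?mule0//; apply/eqP; rewrite eq_le tt tpq.
rewrite -ge0_integralZl//; last first.
rewrite -ge0_integralD//; last 4 first.
- by move=> s _; rewrite lee_fin mulr_ge0// mulr_ge0.
- by apply/measurable_EFinP; apply: measurable_funM => //; exact: measurable_indic.
- by move=> s _; rewrite mule_ge0.
- exact: measurable_funeM.
apply: ge0_le_integral => //.
- by move=> s _; rewrite lee_fin mulr_ge0// sqr_ge0.
- exact/measurable_EFinP.
- apply: emeasurable_funD; last exact: measurable_funeM.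
  by apply/measurable_EFinP; apply: measurable_funM => //; exact: measurable_indic.
- move=> s; rewrite /= in_itv/= => /andP[s0 _].
  rewrite -EFinM -EFinD lee_fin /G indicE.
  case: (_ \in _); rewrite ?mul1r ?mulr1 ?mul0r ?mulr0; last first.
    by rewrite add0r mulr_ge0 ?sqr_ge0.
  have := enorm_sqrD (simple_val S s w - H s w) (H s w); rewrite subrK.
  by have := HC s s0; lra.
Qed.

(** In [ito_integral] the approximating processes may depend on the time, so those for [s] and for
    [t] are unrelated. On a common grid, the increment of [I] is compared with the sum of the
    coefficients of [S] over []s, t]]; the price is the integral of [S - S'] up to [s], which is
    small because both approximate [H] there. *)
Lemma ito_incr_approx s t eps : 0 <= s <= t -> 0 < eps ->
  exists T N (tt : nat -> R) p q (a : 'I_m -> nat -> 'I_d -> Omega -> R) M err,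
  [/\ is_grid T N tt, (p <= q <= N)%N, tt p = s & tt q = t] /\
  [/\ forall r i j, (i < N)%N -> fmeas (tt i) (a r i j),
      forall r i j w, `|a r i j w| <= M,
      rE P (fun w => \sum_r ((I t w r 0 - I s w r 0) - incr_sum W tt (a r) p q w) ^+ 2) <= eps,
      rint P err /\ rE P err <= eps &
      (forall w, 0 <= err w) /\
      forall C2, (forall s w, 0 <= s -> enorm (H s w) ^+ 2 <= C2) ->
      {ae P, forall w, \sum_(p <= i < q) (tt i.+1 - tt i) * \sum_r \sum_j a r i j w ^+ 2
        <= 2 * C2 * (t - s) + 2 * err w}].
Proof.
move=> /andP[s0 st] e0; have t0 := le_trans s0 st.
(* The square of a sum of three errors is at most 3 times the sum of the squares, whose means are at
   most [eps0], [eps0] and [8 d * 4 eps0]. *)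
pose eps0 := eps / (6 + 96 * d%:R).
have dn0 : 0 < 6 + 96 * d%:R :> R by rewrite ltr_wpDr// mulr_ge0.
have e00 : 0 < eps0 by rewrite divr_gt0.
have eps0E : eps0 * (6 + 96 * d%:R) = eps by rewrite /eps0 divfK// gt_eqF.
have eps0le : eps0 <= eps.
  have : 0 <= eps0 * d%:R by rewrite mulr_ge0// ltW.
  rewrite -eps0E; lra.
have [S [eS iS aS]] := ito_approx t0 e00.
have [S' [eS' iS' aS']] := ito_approx s0 e00.
have T0 : 0 < t + 1 by rewrite ltr_wpDl.
have [|N [tt [g fS fS' gL _]]] := @grid_fits_ex _ _ S S' (t + 1) 1 [:: s; t] T0 ltr01.
  move=> x; rewrite !inE => /orP[] /eqP ->; rewrite ?s0 ?t0/=.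
    by rewrite (le_trans st)// lerDl.
  by rewrite lerDl.
have [p pN tp] := gL s (mem_head _ _).
have [|q qN tq] := gL t; first by rewrite !inE eqxx orbT.
have pq : (p <= q)%N.
  by rewrite leqNgt -(grid_ltP g)// tp tq -leNgt.
have [M HM] := grid_coef_bounded S tt; have [M' HM'] := grid_coef_bounded S' tt.
pose a := grid_coef S tt.
pose u r i j w := a r i j w - grid_coef S' tt r i j w.
have ma r i j : (i < N)%N -> fmeas (tt i) (a r i j).
  by move=> iN; exact: (fmeas_grid_coef g fS).
have mu r i j : (i < N)%N -> fmeas (tt i) (u r i j).
  by move=> iN; apply: measurable_funB; [exact: ma|exact: (fmeas_grid_coef g fS')].
have HMu r i j w : `|u r i j w| <= M + M'.
  by apply: le_trans (ler_normB _ _) _; exact: lerD.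
have [fe fee fea] := fine_rint (measurable_sim_err S t0) (sim_err_ge0 S t) (lt_trans eS (ltry _)).
have [fe' fee' fea'] := fine_rint (measurable_sim_err S' s0) (sim_err_ge0 S' s) (lt_trans eS' (ltry _)).
exists (t + 1), N, tt, p, q, a, M, (fun w => fine (sim_err S t w)).
split; first by split=> //; rewrite pq qN.
split=> //.
- have pN' : (0 <= p <= N)%N by [].
  have pqN : (p <= q <= N)%N by rewrite pq qN.
  have iU r : sqint P (incr_sum W tt (u r) 0 p).
    by apply: (sqint_incr_sum hP hW g (mu r) (HMu r)).
  have iV r : sqint P (incr_sum W tt (a r) p q).
    by apply: (sqint_incr_sum hP hW g (ma r) (HM r)).
  have iI r : sqint P (fun w => I t w r 0 - I s w r 0).
    by apply: sqintB; exact: sqint_ito.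
  have isum (f : 'I_m -> Omega -> R) : (forall r, sqint P (f r)) ->
      rint P (fun w => \sum_r f r w ^+ 2).
    by move=> fi; apply: rint_sum => r; exact: (fi r).2.
  have decomp r w : (I t w r 0 - I s w r 0) - incr_sum W tt (a r) p q w =
      - (simple_ito W S t w r 0 - I t w r 0) + (simple_ito W S' s w r 0 - I s w r 0)
      + incr_sum W tt (u r) 0 p w.
    rewrite -tp -tq (simple_ito_grid g fS w r qN) (simple_ito_grid g fS' w r pN).
    have -> : incr_sum W tt (u r) 0 p w =
        incr_sum W tt (a r) 0 p w - incr_sum W tt (grid_coef S' tt r) 0 p w.
      rewrite /incr_sum -sumrB; apply: eq_bigr => i _; rewrite -sumrB.
      by apply: eq_bigr => j _; rewrite mulrBl.
    have -> : incr_sum W tt (a r) 0 q w = incr_sum W tt (a r) 0 p w + incr_sum W tt (a r) p q w.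
      by rewrite /incr_sum (big_cat_nat (n := p)).
    rewrite -/a; ring.
  have sq3 (x y z : R) : (- x + y + z) ^+ 2 <= 3 * (x ^+ 2 + y ^+ 2 + z ^+ 2).
    by have := sqr_ge0 (x + y); have := sqr_ge0 (x + z); have := sqr_ge0 (y - z); nra.
  apply: (@le_trans _ _ (rE P (fun w => 3 * (\sum_r (simple_ito W S t w r 0 - I t w r 0) ^+ 2
      + \sum_r (simple_ito W S' s w r 0 - I s w r 0) ^+ 2
      + \sum_r incr_sum W tt (u r) 0 p w ^+ 2)))).
    apply: rE_le.
    - by apply: isum => r; exact: sqintB.
    - by apply: rintZ; apply: rintD; [apply: rintD|]; exact: isum.
    - move=> w; rewrite -!big_split/= mulr_sumr; apply: ler_sum => r _.
      by rewrite decomp; exact: sq3.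
  rewrite rEZ; last by apply: rintD; [apply: rintD|]; exact: isum.
  rewrite rED; [|by apply: rintD; exact: isum|exact: isum].
  rewrite rED; [|exact: isum..].
  have HU : rE P (fun w => \sum_r incr_sum W tt (u r) 0 p w ^+ 2) <= 8 * d%:R * (4 * eps0).
    rewrite rE_sum; last by move=> r; exact: (iU r).2.
    apply: (@le_trans _ _ (\sum_r 8 * d%:R * rE P (fun w =>
        \sum_(0 <= i < p) (tt i.+1 - tt i) * \sum_j u r i j w ^+ 2))).
      apply: ler_sum => r _.
      have := incr_sum_var hP hW g (mu r) (HMu r) pN' (measurable_cst (1 : R))
        (B := 1) (fun _ => ltac:(by rewrite /= ler01 lexx)).
      under eq_fun do rewrite mul1r.
      by under [in X in _ <= X -> _]eq_fun do rewrite mul1r.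
    rewrite -mulr_sumr ler_wpM2l ?mulr_ge0//.
    have isu r : rint P (fun w => \sum_(0 <= i < p) (tt i.+1 - tt i) * \sum_j u r i j w ^+ 2).
      under eq_fun do rewrite big_mkord.
      apply: rint_sum => i; apply: rintZ; apply: rint_sum => j.
      have [] := @sqint_bdd _ _ _ P (M + M') (u r i j) _ (HMu r i j) => //.
      by apply: (fmeas_measurable hP hW (t := tt i)); apply: mu; apply: leq_trans pN.
    rewrite -rE_sum//.
    have isu' : rint P (fun w => \sum_r \sum_(0 <= i < p) (tt i.+1 - tt i) * \sum_j u r i j w ^+ 2).
      exact: rint_sum.
    rewrite -lee_fin -rEfin//.
    apply: (@le_trans _ _ (\int[P]_w (2%:E * (sim_err S s w + sim_err S' s w)))%E).
      apply: ge0_le_integral => //.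
      - move=> w _; rewrite lee_fin; apply: sumr_ge0 => r _; rewrite big_mkord.
        apply: sumr_ge0 => i _; rewrite mulr_ge0//; last by apply: sumr_ge0 => j _; exact: sqr_ge0.
        by rewrite subr_ge0 ltW// (grid_lt g)// (leq_trans _ pN).
      - by apply/measurable_EFinP; exact: rint_meas isu'.
      - by apply: measurable_funeM; apply: emeasurable_funD; exact: measurable_sim_err.
      - move=> w _; have := grid_diff_err w g fS fS' pN; rewrite tp.
        congr (_ <= _)%E; congr EFin.
        under [RHS]eq_bigr do rewrite big_mkord.
        rewrite exchange_big/=; apply: eq_bigr => i _.
        rewrite mulrC mulr_sumr; apply: eq_bigr => r _.
        by [].
    rewrite ge0_integralZl//; last 2 first.
    - by apply: emeasurable_funD; exact: measurable_sim_err.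
    - by move=> w _; rewrite adde_ge0// sim_err_ge0.
    rewrite ge0_integralD//; last 4 first.
    - by move=> w _; exact: sim_err_ge0.
    - exact: measurable_sim_err.
    - by move=> w _; exact: sim_err_ge0.
    - exact: measurable_sim_err.
    have -> : 4 * eps0 = 2 * (eps0 + eps0) by ring.
    rewrite EFinM [(eps0 + eps0)%:E]EFinD; apply: lee_wpmul2l => //.
    apply: leeD; last exact: ltW.
    apply: le_trans (ltW eS); apply: ge0_le_integral => //.
    - by move=> w _; exact: sim_err_ge0.
    - exact: measurable_sim_err.
    - exact: measurable_sim_err.
    - by move=> w _; apply: sim_err_le; rewrite s0.
  by rewrite -eps0E; lra.
- by split=> //; rewrite -lee_fin fee (le_trans (ltW eS)).
- split; first by move=> w; rewrite fine_ge0// sim_err_ge0.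
  move=> C2 HC; apply: filterS fea => w Ew.
  have := @grid_coef_err C2 S _ _ _ p q w g fS _ (fun s => HC s w).
  rewrite pq qN => /(_ isT); rewrite tp tq Ew -EFinM -EFinD lee_fin.
  by [].
Qed.

Lemma ito_incr_mean s t r xi : 0 <= s <= t -> fmeas s xi -> sqint P xi ->
  rE P (fun w => xi w * (I t w r 0 - I s w r 0)) = 0.
Proof.
move=> st mxi ixi; have /andP[s0 st'] := st; have t0 := le_trans s0 st'.
have iI : sqint P (fun w => I t w r 0 - I s w r 0) by apply: sqintB; exact: sqint_ito.
apply/eqP; rewrite -normr_le0; apply/ler_addgt0Pr => e e0; rewrite add0r.
pose A := rE P (fun w => xi w ^+ 2).
have A0 : 0 <= A by apply: rE_ge0 => w; exact: sqr_ge0.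
(* Young's inequality costs [del * A] and [del^-1] times the approximation error; each is made at
   most [e / 2]. *)
pose del := e / (2 * (A + 1)).
have A1 : 0 < 2 * (A + 1) by rewrite mulr_gt0// ltr_wpDl.
have d0 : 0 < del by rewrite divr_gt0.
have dA : del * A <= e / 2.
  have : del * (2 * (A + 1)) = e by rewrite /del divfK// gt_eqF.
  by move: (ltW d0); nra.
have e1 : 0 < del * (e / 2) by rewrite mulr_gt0// divr_gt0.
have [T [N [tt [p [q [a [M [err [[g pqN tp tq] [ma HM aV _ _]]]]]]]]]] := ito_incr_approx st e1.
pose V := incr_sum W tt (a r) p q.
have iV : sqint P V by apply: (sqint_incr_sum hP hW g (ma r) (HM r)).
pose D w := (I t w r 0 - I s w r 0) - V w.
have iD : sqint P D by exact: sqintB.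
have HD : rE P (fun w => D w ^+ 2) <= del * (e / 2).
  apply: le_trans aV; apply: rE_le; first exact: iD.2.
  - apply: rint_sum => r'; have [] // := @sqintB _ _ _ P (fun w => I t w r' 0 - I s w r' 0)
      (incr_sum W tt (a r') p q).
      by apply: sqintB; exact: sqint_ito.
    exact: (sqint_incr_sum hP hW g (ma r') (HM r')).
  - move=> w; rewrite (bigD1 r)//= lerDl; apply: sumr_ge0 => *; exact: sqr_ge0.
have -> : rE P (fun w => xi w * (I t w r 0 - I s w r 0)) = rE P (fun w => xi w * D w).
  have -> : (fun w => xi w * (I t w r 0 - I s w r 0)) = (fun w => xi w * D w + xi w * V w).
    by apply/funext => w; rewrite /D; ring.
  rewrite rED; [|exact: sqintM..].
  rewrite [X in _ + X](incr_sum_mean hP hW g (ma r) (HM r) pqN) ?addr0//.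
  by rewrite tp.
(* To be applied to [xi] and to [- xi], which have the same second moment. *)
have key (f : Omega -> R) : sqint P f -> rE P (fun w => f w ^+ 2) = A ->
    rE P (fun w => f w * D w) <= e.
  move=> fi fA; apply: le_trans (rE_young d0 fi iD) _; rewrite fA.
  have : del^-1 * rE P (fun w => D w ^+ 2) <= e / 2.
    by rewrite mulrC ler_pdivrMr// mulrC.
  by move: dA; lra.
rewrite ler_norml; apply/andP; split; last exact: key.
have ixN : sqint P (fun w => -1 * xi w) by exact: sqintZ.
have H1 := key _ ixN; rewrite lerNl.
have -> : - rE P (fun w => xi w * D w) = rE P (fun w => -1 * xi w * D w).
  transitivity (-1 * rE P (fun w => xi w * D w)); first by rewrite mulN1r.
  rewrite -rEZ; last exact: sqintM.
  by congr rE; apply/funext => w; rewrite mulrA.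
by apply: H1; congr rE; apply/funext => w; rewrite mulN1r sqrrN.
Qed.

(** The constant is the product of [8 d] from [incr_sum_var], a 2 for separating the increment from
    its approximation, and a 2 for separating the step process from [H]. *)
Lemma ito_incr_var C2 s t xi B : (forall s w, 0 <= s -> enorm (H s w) ^+ 2 <= C2) ->
  0 <= s <= t -> fmeas s xi -> (forall w, 0 <= xi w <= B) ->
  rE P (fun w => xi w * \sum_r (I t w r 0 - I s w r 0) ^+ 2) <=
  32 * d%:R * C2 * (t - s) * rE P xi.
Proof.
move=> HC st mxi xiB; have /andP[s0 st'] := st; have t0 := le_trans s0 st'.
apply/ler_addgt0Pr => e e0.
have xi0 w : 0 <= xi w by case/andP: (xiB w).
have xiB' w : `|xi w| <= B by rewrite ger0_norm//; case/andP: (xiB w).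
have B0 : 0 <= B by apply: le_trans (xi0 point) _; case/andP: (xiB point).
(* The approximation errors add up to at most [(32 d + 2) * B * e']; the extra 1 keeps [K] positive
   when [B = 0]. *)
pose K := (32 * d%:R + 2) * (B + 1).
have K0 : 0 < K by rewrite mulr_gt0// ?ltr_wpDl// mulr_ge0.
have e1 : 0 < e / K by rewrite divr_gt0.
have eK : e / K * K = e by rewrite divfK// gt_eqF.
have [T [N [tt [p [q [a [M [err [[g pqN tp tq] [ma HM aV [ierr errE] [err0 HE]]]]]]]]]]] :=
  ito_incr_approx st e1.
have /andP[pq qN] := pqN.
move: e1 eK aV errE; set e' := e / K => e1 eK aV errE.
have mxi' := fmeas_measurable hP hW mxi.
have iV r : sqint P (incr_sum W tt (a r) p q).
  by apply: (sqint_incr_sum hP hW g (ma r) (HM r)).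
have iI r : sqint P (fun w => I t w r 0 - I s w r 0).
  by apply: sqintB; exact: sqint_ito.
have isum (f : 'I_m -> Omega -> R) : (forall r, sqint P (f r)) ->
    rint P (fun w => \sum_r f r w ^+ 2).
  by move=> fi; apply: rint_sum => r; exact: (fi r).2.
have xsum f : rint P f -> rint P (fun w => xi w * f w).
  by apply: rintM_bdd.
pose SV w := \sum_r incr_sum W tt (a r) p q w ^+ 2.
pose SD w := \sum_r ((I t w r 0 - I s w r 0) - incr_sum W tt (a r) p q w) ^+ 2.
have iSV : rint P SV by exact: isum.
have iSD : rint P SD by apply: isum => r; exact: sqintB.
have SD0 w : 0 <= SD w by apply: sumr_ge0 => r _; exact: sqr_ge0.
apply: (@le_trans _ _ (rE P (fun w => 2 * (xi w * SV w) + 2 * B * SD w))).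
  apply: rE_le.
  - by apply: xsum; exact: isum.
  - by apply: rintD; apply: rintZ => //; exact: xsum.
  - move=> w; have H1 : \sum_r (I t w r 0 - I s w r 0) ^+ 2 <= 2 * SV w + 2 * SD w.
      rewrite !mulr_sumr -big_split/=; apply: ler_sum => r _.
      have := sqrD_le2 (incr_sum W tt (a r) p q w) ((I t w r 0 - I s w r 0) - incr_sum W tt (a r) p q w).
      by rewrite subrKC.
    apply: le_trans (ler_wpM2l (xi0 w) H1) _.
    have : xi w * SD w <= B * SD w by apply: ler_wpM2r => //; case/andP: (xiB w).
    by lra.
rewrite rED; [|by apply: rintZ; exact: xsum|exact: rintZ].
rewrite !rEZ//; last exact: xsum.
pose SA w := \sum_(p <= i < q) (tt i.+1 - tt i) * \sum_r \sum_j a r i j w ^+ 2.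
have iA r i j : (i < N)%N -> rint P (fun w => a r i j w ^+ 2).
  move=> iN; have [] := @sqint_bdd _ _ _ P M (a r i j) _ (HM r i j) => //.
  exact: (fmeas_measurable hP hW (ma r i j iN)).
have iSA (f : nat -> Omega -> R) : (forall i, (i < N)%N -> rint P (f i)) ->
    rint P (fun w => \sum_(p <= i < q) f i w).
  move=> fi; under eq_fun do rewrite big_nat_cond.
  have -> : (fun w => \sum_(p <= i < q | ((p <= i < q)%N && true)) f i w) =
      (fun w => \sum_(p <= i < q) (if (i < q)%N then f i w else 0)).
    apply/funext => w; rewrite [RHS]big_nat_cond; apply: eq_bigr => i.
    by move=> /andP[/andP[_ ->]].
  apply: rint_sum => i; case: (ltnP i q) => iq; last exact: rint_cst.
  by apply: fi; exact: leq_trans qN.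
have HV : rE P (fun w => xi w * SV w) <= 8 * d%:R * rE P (fun w => xi w * SA w).
  have xiV r : rint P (fun w => xi w * incr_sum W tt (a r) p q w ^+ 2).
    by apply: xsum; exact: (iV r).2.
  have iSr r : rint P (fun w => xi w *
     \sum_(p <= i < q) (tt i.+1 - tt i) * \sum_j a r i j w ^+ 2).
    apply: xsum; apply: (iSA (fun i w => (tt i.+1 - tt i) * \sum_j a r i j w ^+ 2)).
    by move=> i iN; apply: rintZ; apply: rint_sum => j; exact: iA.
  have -> : (fun w => xi w * SV w) = (fun w => \sum_r xi w * incr_sum W tt (a r) p q w ^+ 2).
    by apply/funext => w; rewrite mulr_sumr.
  rewrite rE_sum//.
  apply: (@le_trans _ _ (\sum_r 8 * d%:R * rE P (fun w => xi w *
     \sum_(p <= i < q) (tt i.+1 - tt i) * \sum_j a r i j w ^+ 2))).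
    apply: ler_sum => r _; apply: (incr_sum_var hP hW g (ma r) (HM r) pqN (B := B)) => //.
    by rewrite tp.
  rewrite -mulr_sumr -rE_sum// ler_wpM2l ?mulr_ge0// le_eqVlt; apply/orP; left; apply/eqP.
  congr rE; apply/funext => w; rewrite -mulr_sumr; congr (_ * _).
  rewrite exchange_big/=; apply: eq_bigr => i _.
  by rewrite -mulr_sumr.
have iSA' : rint P SA.
  apply: (iSA (fun i w => (tt i.+1 - tt i) * \sum_r \sum_j a r i j w ^+ 2)).
  by move=> i iN; apply: rintZ; apply: rint_sum => r; apply: rint_sum => j; exact: iA.
have ixi : rint P xi.
  by have [] := @sqint_bdd _ _ _ P B xi mxi' xiB' => _ _; apply: sqint_rint; exact: sqint_bdd xiB'.
have HSA : rE P (fun w => xi w * SA w) <= 2 * C2 * (t - s) * rE P xi + 2 * B * e'.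
  apply: (@le_trans _ _ (rE P (fun w => 2 * C2 * (t - s) * xi w + 2 * B * err w))).
    apply: rE_le_ae; first exact: xsum.
    - by apply: rintD; exact: rintZ.
    - apply: filterS (HE C2 HC) => w H1.
      apply: le_trans (ler_wpM2l (xi0 w) H1) _.
      have : xi w * err w <= B * err w by apply: ler_wpM2r => //; case/andP: (xiB w).
      by lra.
  rewrite rED; [|exact: rintZ..]; rewrite !rEZ// lerD2l ler_wpM2l// mulr_ge0//.
have dR : 0 <= d%:R :> R by [].
have H2 : rE P (fun w => xi w * SV w) <=
    8 * d%:R * (2 * C2 * (t - s) * rE P xi + 2 * B * e').
  by apply: le_trans HV _; rewrite ler_wpM2l// mulr_ge0.
have H3 : 2 * B * rE P SD <= 2 * B * e' by rewrite ler_wpM2l// mulr_ge0.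
have H4 : 32 * d%:R * B * e' + 2 * B * e' <= e.
  have E : (32 * d%:R + 2) * e' + (32 * d%:R * B * e' + 2 * B * e') = e.
    by rewrite -eK /K; ring.
  rewrite -[leRHS]E lerDr mulr_ge0 ?(ltW e1)// addr_ge0// mulr_ge0//.
move: H2 H3 H4; move: (rE P (fun w => xi w * SV w)) (rE P SD) => x1 x2.
have -> : 8 * d%:R * (2 * C2 * (t - s) * rE P xi + 2 * B * e') =
  16 * (d%:R * C2 * (t - s) * rE P xi) + 16 * (d%:R * B * e') by ring.
have -> : 32 * d%:R * C2 * (t - s) * rE P xi = 32 * (d%:R * C2 * (t - s) * rE P xi) by ring.
have -> : 32 * d%:R * B * e' = 32 * (d%:R * B * e') by ring.
lra.
Qed.

End ito.

End ito_increments.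

(** * Discrete Girsanov density *)

Section discrete_density.
Context {R : realType} {dO : measure_display} {Omega : measurableType dO}.
Variable P : probability Omega R.
Hypothesis hP : measure_is_complete P.
Context {d : nat}.
Variable W : R -> Omega -> 'cV[R]_d.
Hypothesis hW : brownian_motion P W.
Local Notation F := (bm_filtration P W).
Local Notation fmeas := (fmeas P W).

Variables (T : R) (N : nat) (t : nat -> R) (g : is_grid T N t).
Variables (x : nat -> Omega -> R) (M' : R).

(** What the moment estimates need from the factors [1 + x i]: conditional mean 1, a tilt of order
    sqrt dt, and a step small enough for the tilt to be at most 1, which keeps the factors in
    [[0, 2]]. *)
Record density_incr : Prop := {
  di_meas : forall i, (i < N)%N -> fmeas (t i.+1) (x i);
  di_bound : forall i w, (i < N)%N -> x i w ^+ 2 <= M' ^+ 2 * (t i.+1 - t i);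
  di_small : forall i, (i < N)%N -> M' ^+ 2 * (t i.+1 - t i) <= 1;
  di_mean : forall i xi, (i < N)%N -> fmeas (t i) xi -> rint P xi ->
    rE P (fun w => xi w * x i w) = 0 }.

Hypothesis hx : density_incr.

Definition density (i : nat) (w : Omega) : R := \prod_(j < i) (1 + x j w).

Lemma densityS i w : density i.+1 w = density i w * (1 + x i w).
Proof. by rewrite /density big_ord_recr. Qed.

Lemma density0 w : density 0 w = 1.
Proof. by rewrite /density big_ord0. Qed.

Lemma di_le1 i w : (i < N)%N -> `|x i w| <= 1.
Proof.
move=> iN; have h1 := le_trans (di_bound hx w iN) (di_small hx iN).
rewrite -(ler_pXn2r (n := 2)) ?nnegrE//.
by rewrite real_normK ?num_real// expr1n.
Qed.

Let incr_ge0 i w : (i < N)%N -> 0 <= 1 + x i w <= 2.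
Proof. by move=> iN; have := di_le1 w iN; rewrite ler_norml; lra. Qed.

Lemma density_ge0 i w : (i <= N)%N -> 0 <= density i w.
Proof.
elim: i => [|i IH] iN; first by rewrite density0.
rewrite densityS mulr_ge0 ?IH ?(ltnW iN)//.
by case/andP: (incr_ge0 w iN).
Qed.

(** A crude bound, growing with the number of cells, which serves only for integrability. Estimates
    independent of the mesh come from [rE_density4]. *)
Lemma density_le i w : (i <= N)%N -> density i w <= 2 ^+ i.
Proof.
elim: i => [|i IH] iN; first by rewrite density0 expr0.
rewrite densityS exprSr; case/andP: (incr_ge0 w iN) => h1 h2.
by rewrite ler_pM ?density_ge0 ?IH// ltnW.
Qed.

Lemma density_norm i w : (i <= N)%N -> `|density i w| <= 2 ^+ i.
Proof. by move=> iN; rewrite ger0_norm ?density_ge0// density_le. Qed.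

Lemma fmeas_density i : (i <= N)%N -> fmeas (t i) (density i).
Proof.
elim: i => [|i IH] iN.
  have -> : density 0 = cst 1 by apply/funext => w; rewrite density0.
  exact: measurable_cst.
have -> : density i.+1 = (fun w => density i w * (1 + x i w)).
  by apply/funext => w; rewrite densityS.
apply: measurable_funM.
  by apply: fmeas_le (IH (ltnW iN)); exact/ltW/(grid_lt g).
by apply: measurable_funD; [exact: measurable_cst|exact: di_meas].
Qed.

Lemma measurable_density i : (i <= N)%N -> measurable_fun setT (density i).
Proof. by move=> iN; exact: (fmeas_measurable hP hW (fmeas_density iN)). Qed.

Lemma rint_density i f : (i <= N)%N -> rint P f -> rint P (fun w => density i w * f w).
Proof.
move=> iN; apply: (rintM_bdd (M := 2 ^+ i)); first exact: measurable_density.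
by move=> w; exact: density_norm.
Qed.

Lemma sqint_density i : (i <= N)%N -> sqint P (density i).
Proof.
move=> iN; apply: (@sqint_bdd _ _ _ P (2 ^+ i)); first exact: measurable_density.
by move=> w; exact: density_norm.
Qed.

Let rint_x i f : (i < N)%N -> rint P f -> rint P (fun w => f w * x i w).
Proof.
move=> iN fi; under eq_fun do rewrite mulrC; apply: (rintM_bdd (M := 1)) => //.
  exact: (fmeas_measurable hP hW (di_meas hx iN)).
by move=> w; exact: di_le1.
Qed.

Lemma density_martingale1 i xi : (i < N)%N -> fmeas (t i) xi -> rint P xi ->
  rE P (fun w => density i.+1 w * xi w) = rE P (fun w => density i w * xi w).
Proof.
move=> iN mxi ixi; have iN' := ltnW iN.
have E : (fun w => density i.+1 w * xi w) =
    (fun w => density i w * xi w + (density i w * xi w) * x i w).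
  by apply/funext => w; rewrite densityS; ring.
have iD := rint_density iN' ixi.
rewrite E rED//; last exact: rint_x.
rewrite (di_mean hx iN _ iD) ?addr0//.
by apply: measurable_funM => //; exact: fmeas_density.
Qed.

Lemma density_martingale i j xi : (i <= j <= N)%N -> fmeas (t i) xi -> rint P xi ->
  rE P (fun w => density j w * xi w) = rE P (fun w => density i w * xi w).
Proof.
move=> /andP[ij jN] mxi ixi; elim: j ij jN => [|j IH].
  by rewrite leqn0 => /eqP ->.
rewrite leq_eqVlt => /predU1P[->//|ij] jN.
rewrite density_martingale1//; first exact: IH ij (ltnW jN).
by apply: fmeas_le mxi; apply: (grid_le g) => //; exact: ltnW.
Qed.

Lemma rE_density i : (i <= N)%N -> rE P (density i) = 1.
Proof.
move=> iN; have := @density_martingale 0 i (cst 1) _ (measurable_cst _) (rint_cst P 1).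
rewrite leq0n iN => /(_ isT).
under eq_fun do rewrite mulr1.
by under [in RHS]eq_fun do rewrite mulr1 density0; rewrite rE_cst.
Qed.

Lemma rint_density4 i : (i <= N)%N -> rint P (fun w => density i w ^+ 4).
Proof.
move=> iN; have [_] := @sqint_bdd _ _ _ P ((2 ^+ i) ^+ 2) (fun w => density i w ^+ 2)
  (measurable_funX 2 (measurable_density iN)) (fun w => ltac:(by
  rewrite normrX; apply: lerXn2r; rewrite ?nnegrE ?exprn_ge0// density_norm)).
by under eq_fun do rewrite -exprM.
Qed.

(** For [|x| <= 1] one has [(1 + x)^4 <= 1 + 4 x + 11 x^2], where [11 = 6 + 4 + 1]. The linear term
    averages out and [1 + 11 dl <= expR (11 dl)], so the product over the cells depends on elapsed
    time only. *)
Lemma rE_density4 i : (i <= N)%N ->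
  rE P (fun w => density i w ^+ 4) <= expR (11 * M' ^+ 2 * t i).
Proof.
elim: i => [|i IH] iN.
  under eq_fun do rewrite density0 expr1n.
  by rewrite rE_cst (grid0 g) mulr0 expR0.
have iN' := ltnW iN; have i4 := rint_density4 iN'.
set dl := M' ^+ 2 * (t i.+1 - t i).
have dl0 : 0 <= dl by rewrite mulr_ge0 ?sqr_ge0// subr_ge0 ltW// (grid_lt g).
apply: (@le_trans _ _ (rE P (fun w => (1 + 11 * dl) * density i w ^+ 4 +
    4 * (density i w ^+ 4 * x i w)))).
  apply: rE_le; first exact: rint_density4.
  - by apply: rintD; apply: rintZ => //; exact: rint_x.
  - move=> w; rewrite densityS exprMn.
    have D0 : 0 <= density i w ^+ 4 by rewrite exprn_ge0// density_ge0.
    have h2 := di_bound hx w iN; rewrite -/dl in h2.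
    have : (1 + x i w) ^+ 4 <= 1 + 11 * dl + 4 * x i w.
      have := di_le1 w iN; rewrite ler_norml => /andP[h3 h4].
      have x2 := sqr_ge0 (x i w).
      have -> : (1 + x i w) ^+ 4 = 1 + 4 * x i w + 6 * x i w ^+ 2 +
        x i w ^+ 2 * (4 * x i w) + x i w ^+ 2 * x i w ^+ 2 by ring.
      have : x i w ^+ 2 * (4 * x i w) <= x i w ^+ 2 * 4 by apply: ler_wpM2l => //; lra.
      have : x i w ^+ 2 * x i w ^+ 2 <= x i w ^+ 2 * 1.
        by apply: ler_wpM2l => //; nra.
      lra.
    move=> h5; apply: le_trans (ler_wpM2l D0 h5) _.
    by lra.
rewrite rED; [|exact: rintZ|by apply: rintZ; exact: rint_x].
rewrite !rEZ//; last exact: rint_x.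
rewrite (di_mean hx iN) ?mulr0 ?addr0//; last first.
  by apply: measurable_funX; exact: fmeas_density.
have -> : 11 * M' ^+ 2 * t i.+1 = 11 * dl + 11 * M' ^+ 2 * t i by rewrite /dl; ring.
rewrite expRD ler_pM//.
- by rewrite addr_ge0// mulr_ge0.
- by apply: rE_ge0 => w; rewrite exprn_ge0// density_ge0.
- exact: expR_ge1Dx.
- exact: IH.
Qed.

(** Young's inequality for three factors with exponents 4, 2 and 4. Choosing [del] before the
    probability of [A] makes the contribution of a rare event small, uniformly over the grids. *)
Lemma density_triple y (A : set Omega) del : 0 < del -> sqint P y -> measurable A ->
  rE P (fun w => density N w * y w * \1_A w) <=
  del * (expR (11 * M' ^+ 2 * T) + rE P (fun w => y w ^+ 2)) + del^-1 ^+ 3 * fine (P A).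
Proof.
move=> d0 iy mA.
have i4 := rint_density4 (leqnn N).
have di : 0 < del^-1 by rewrite invr_gt0.
apply: (@le_trans _ _ (rE P (fun w => del * density N w ^+ 4 + del * y w ^+ 2 +
    del^-1 ^+ 3 * \1_A w))); last first.
  rewrite rED; last 2 first.
  - by apply: rintD; apply: rintZ => //; exact: iy.2.
  - exact/rintZ/rint_indic.
  rewrite rED; [|exact: rintZ|by apply: rintZ; exact: iy.2].
  rewrite !rEZ ?rE_indic//; [|exact: rint_indic|exact: iy.2].
  rewrite mulrDr lerD2r lerD2r; apply: ler_wpM2l; first exact: ltW.
  by have := rE_density4 (leqnn N); rewrite (gridN g).
apply: rE_le.
- have /sqintD := sqint_cst P 1.
  have : sqint P (fun w => \1_A w * y w).
    by apply: (sqintM_bdd (M := 1)) => //; exact: indic_le1.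
  move=> /(sqintM (sqint_density (leqnn N))) + _.
  by under eq_fun do rewrite [_ * y _]mulrC mulrA.
- apply: rintD; last exact/rintZ/rint_indic.
  by apply: rintD; apply: rintZ => //; exact: iy.2.
move=> w; rewrite indicE; set D := density N w; set Y := y w.
have dd : del * del^-1 = 1 by rewrite divff// gt_eqF.
have D4 : 0 <= del * D ^+ 4.
  by rewrite mulr_ge0 ?(ltW d0)// (_ : D ^+ 4 = (D ^+ 2) ^+ 2) ?sqr_ge0// -exprM.
have Y2 : 0 <= del * Y ^+ 2 by rewrite mulr_ge0 ?(ltW d0)// sqr_ge0.
case: (w \in A) => /=; rewrite ?mulr1 ?mulr0; last by rewrite addr0 addr_ge0.
have h1 : D * Y <= del * Y ^+ 2 + del^-1 * D ^+ 2 / 2.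
  have : 0 <= del^-1 * (del * Y - D / 2) ^+ 2 by rewrite mulr_ge0 ?sqr_ge0 ?ltW.
  have -> : del^-1 * (del * Y - D / 2) ^+ 2 =
    (del * del^-1) * del * Y ^+ 2 - (del * del^-1) * (D * Y) + del^-1 * D ^+ 2 / 4 by field; rewrite gt_eqF.
  rewrite dd !mul1r; have : 0 <= del^-1 * D ^+ 2 by rewrite mulr_ge0 ?sqr_ge0 ?ltW.
  lra.
have h2 : del^-1 * D ^+ 2 <= del * D ^+ 4 + del^-1 ^+ 3.
  have : 0 <= del * (D ^+ 2 - del^-1 ^+ 2) ^+ 2 by rewrite mulr_ge0 ?sqr_ge0 ?ltW.
  have -> : del * (D ^+ 2 - del^-1 ^+ 2) ^+ 2 = del * D ^+ 4 -
    2 * (del * del^-1) * (del^-1 * D ^+ 2) + (del * del^-1) * del^-1 ^+ 3 by ring.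
  rewrite dd mulr1 mul1r; have : 0 <= del^-1 * D ^+ 2 by rewrite mulr_ge0 ?sqr_ge0 ?ltW.
  lra.
have : 0 <= del^-1 * D ^+ 2 by rewrite mulr_ge0 ?sqr_ge0 ?ltW.
lra.
Qed.

End discrete_density.

(** * A Lyapunov function under the discrete density *)

Section lyapunov.
Context {R : realType} {dO : measure_display} {Omega : measurableType dO}.
Variable P : probability Omega R.
Hypothesis hP : measure_is_complete P.
Context {d : nat}.
Variable W : R -> Omega -> 'cV[R]_d.
Hypothesis hW : brownian_motion P W.
Local Notation F := (bm_filtration P W).
Local Notation fmeas := (fmeas P W).

Variables (T : R) (N : nat) (t : nat -> R) (g : is_grid T N t).
Variables (m : nat) (zeta dI : nat -> Omega -> 'I_m -> R).
Variables (C eta R2 KI : R).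
Hypotheses (C0 : 0 <= C) (eta0 : 0 < eta) (R20 : 0 <= R2) (KI0 : 0 <= KI).

(** In the application [zeta] is [X - x] at the nodes and [dI] the increment of the integral of
    [sigma]. No moment of [zeta] is available, only of [dI]. The condition on the step keeps the
    contraction factors [1 - th i] nonnegative. *)
Record mart_incr : Prop := {
  mi_zeta : forall i r, (i <= N)%N -> fmeas (t i) (fun w => zeta i w r);
  mi_meas : forall i r, (i < N)%N -> fmeas (t i.+1) (fun w => dI i w r);
  mi_sqint : forall i r, (i < N)%N -> sqint P (fun w => dI i w r);
  mi_mean : forall i r xi, (i < N)%N -> fmeas (t i) xi -> sqint P xi ->
    rE P (fun w => xi w * dI i w r) = 0;
  mi_var : forall i xi B, (i < N)%N -> fmeas (t i) xi -> (forall w, 0 <= xi w <= B) ->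
    rE P (fun w => xi w * \sum_r dI i w r ^+ 2) <= KI * (t i.+1 - t i) * rE P xi;
  mi_step : forall i, (i < N)%N -> eta / 2 * (t i.+1 - t i) <= 1 }.

Hypothesis hI : mart_incr.

Local Notation dt i := (t i.+1 - t i).
Local Notation th i := (eta / 2 * dt i).

Definition lyap i w := \sum_r zeta i w r ^+ 2.

(** The indicator that the level [R2] has not been exceeded at any node up to [i]. It is known at
    time [t i], and multiplying by it makes [zeta] bounded, hence its products with [dI] integrable
    and centred. *)
Fixpoint below (i : nat) (w : Omega) : R :=
  let b := \1_(`]-oo, R2]%classic) (lyap i w) in
  if i is j.+1 then below j w * b else b.

Definition mart_step i w := \sum_r 2 * zeta i w r * dI i w r.
Definition quad_step i w := \sum_r dI i w r ^+ 2.

(* The recursion dominates [lyap] until [lyap] first exceeds [R2], and keeps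
   contracting afterwards. *)
Fixpoint lyap_bound (i : nat) (w : Omega) : R :=
  if i is j.+1 then (1 - th j) * lyap_bound j w +
    below j w * (C * dt j - th j * lyap j w + mart_step j w + quad_step j w)
  else 0.

(** The martingale contribution to [lyap_bound], damped by the same factors. It bounds [lyap_bound]
    from below on paths whose defects are not controlled. *)
Fixpoint lyap_mart (i : nat) (w : Omega) : R :=
  if i is j.+1 then (1 - th j) * lyap_mart j w + below j w * mart_step j w
  else 0.

(* What a discrete Ito expansion of [lyap] leaves; along the paths of the reflected equation
   its positive parts add up to o(1) as the mesh tends to 0. *)
Definition lyap_defect i w :=
  lyap i.+1 w - lyap i w - (C - eta * lyap i w) * dt i - mart_step i w - quad_step i w.

Let dt_gt0 i : (i < N)%N -> 0 < dt i.
Proof. by move=> iN; rewrite subr_gt0 (grid_lt g). Qed.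

Let th01 i : (i < N)%N -> 0 <= th i <= 1.
Proof.
move=> iN; rewrite (mi_step hI iN) andbT mulr_ge0//.
  by rewrite divr_ge0// ltW.
by rewrite ltW// dt_gt0.
Qed.

Lemma lyap_ge0 i w : 0 <= lyap i w.
Proof. by apply: sumr_ge0 => r _; exact: sqr_ge0. Qed.

Let quad_ge0 i w : 0 <= quad_step i w.
Proof. by apply: sumr_ge0 => r _; exact: sqr_ge0. Qed.

Lemma below01 i w : (below i w == 0) || (below i w == 1).
Proof.
elim: i => [|i IH] /=; rewrite indicE; case: (_ \in _) => /=; rewrite ?mulr1 ?mulr0 ?eqxx ?orbT//.
Qed.

Let below_itv i w : 0 <= below i w <= 1.
Proof. by case/orP: (below01 i w) => /eqP ->; rewrite lexx ler01. Qed.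

Let below_norm i w : `|below i w| <= 1.
Proof. by rewrite ger0_norm; case/andP: (below_itv i w). Qed.

Lemma below_lyap i w : below i w * lyap i w <= R2.
Proof.
have H : below i w <= \1_(`]-oo, R2]%classic) (lyap i w).
  case: i => [|i] /=; first by [].
  by rewrite ler_piMl//; case/andP: (below_itv i w).
apply: le_trans (ler_wpM2r (lyap_ge0 i w) H) _.
rewrite indicE mem_setE in_itv/=.
by case: (leP (lyap i w) R2) => h; rewrite ?mul1r ?mul0r.
Qed.

Lemma below1P i w : below i w = 1 <-> forall j, (j <= i)%N -> lyap j w <= R2.
Proof.
have b1 j : \1_(`]-oo, R2]%classic) (lyap j w) = (lyap j w <= R2)%R%:R :> R.
  by rewrite indicE mem_setE in_itv.
elim: i => [|i IH] /=.
  rewrite b1; split=> [h j|/(_ 0%N (leqnn _)) -> //].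
  rewrite leqn0 => /eqP ->; move: h; case: (lyap 0 w <= R2) => // /esym/eqP.
  by rewrite oner_eq0.
rewrite b1; split=> [h j|h]; last first.
  by rewrite (IH.2 _) ?mul1r ?h// => j ji; apply: h; exact: ltnW.
have [hi hl] : below i w = 1 /\ lyap i.+1 w <= R2.
  move: h; case/orP: (below01 i w) => /eqP ->.
    by rewrite mul0r => /esym/eqP; rewrite oner_eq0.
  by rewrite mul1r; case: (_ <= _) => // /esym/eqP; rewrite oner_eq0.
by rewrite leq_eqVlt ltnS => /predU1P[->//|]; exact: IH.1 hi j.
Qed.

Let fm_lyap i : (i <= N)%N -> fmeas (t i) (lyap i).
Proof.
by move=> iN; apply: measurable_sum => r; apply: measurable_funX; exact: (mi_zeta hI).
Qed.

Lemma fmeas_below i : (i <= N)%N -> fmeas (t i) (below i).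
Proof.
have mb j : (j <= N)%N -> fmeas (t j) (fun w => \1_(`]-oo, R2]%classic) (lyap j w)).
  by move=> jN; apply: (measurableT_comp (measurable_indic _)) => //; exact: fm_lyap.
elim: i => [|i IH] iN; first exact: mb.
apply: measurable_funM; last exact: mb.
by apply: fmeas_le (IH (ltnW iN)); exact/ltW/(grid_lt g).
Qed.

Let bz_bdd i r w : `|below i w * (2 * zeta i w r)| <= 2 * (R2 + 1).
Proof.
case/orP: (below01 i w) => /eqP b.
  by rewrite b mul0r normr0 mulr_ge0// addr_ge0.
have := below_lyap i w; rewrite b !mul1r normrM ger0_norm// ler_pM2l// => h.
have : zeta i w r ^+ 2 <= R2.
  by apply: le_trans h; rewrite /lyap (bigD1 r)//= lerDl; apply: sumr_ge0 => *; exact: sqr_ge0.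
rewrite ler_norml; move: (zeta i w r) => z hz.
by apply/andP; split; nra.
Qed.

Let fm_bz i r : (i <= N)%N -> fmeas (t i) (fun w => below i w * (2 * zeta i w r)).
Proof.
move=> iN; apply: measurable_funM; first exact: fmeas_below.
by apply: measurable_funM; [exact: measurable_cst|exact: (mi_zeta hI)].
Qed.

Let bmE i w : below i w * mart_step i w = \sum_r (below i w * (2 * zeta i w r)) * dI i w r.
Proof. by rewrite mulr_sumr; apply: eq_bigr => r _; rewrite mulrA. Qed.

Let sq_bm i : (i < N)%N -> sqint P (fun w => below i w * mart_step i w).
Proof.
move=> iN; under eq_fun do rewrite bmE.
apply: sqint_sum => r; apply: (sqintM_bdd (M := 2 * (R2 + 1))); last exact: (mi_sqint hI).
  exact: (fmeas_measurable hP hW (fm_bz r (ltnW iN))).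
by move=> w; exact: bz_bdd.
Qed.

Let rint_quad i : (i < N)%N -> rint P (quad_step i).
Proof. by move=> iN; apply: rint_sum => r; exact: (mi_sqint hI r iN).2. Qed.

Let fm_quad i : (i < N)%N -> fmeas (t i.+1) (quad_step i).
Proof. by move=> iN; apply: measurable_sum => r; apply: measurable_funX; exact: (mi_meas hI). Qed.

Let step_le i f : (i < N)%N -> fmeas (t i) f -> fmeas (t i.+1) f.
Proof. by move=> iN; apply: fmeas_le; exact/ltW/(grid_lt g). Qed.

Let fm_bm i : (i < N)%N -> fmeas (t i.+1) (fun w => below i w * mart_step i w).
Proof.
move=> iN; under eq_fun do rewrite bmE.
apply: measurable_sum => r; apply: measurable_funM; last exact: (mi_meas hI).
by apply: step_le => //; apply: fm_bz; exact: ltnW.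
Qed.

Let bm_mean i xi : (i < N)%N -> fmeas (t i) xi -> sqint P xi ->
  rE P (fun w => xi w * (below i w * mart_step i w)) = 0.
Proof.
move=> iN mxi ixi.
have sq r : sqint P (fun w => xi w * (below i w * (2 * zeta i w r))).
  under eq_fun do rewrite mulrC.
  apply: (sqintM_bdd (M := 2 * (R2 + 1))) => //.
  exact: (fmeas_measurable hP hW (fm_bz r (ltnW iN))).
have E w : xi w * (below i w * mart_step i w) =
    \sum_r (xi w * (below i w * (2 * zeta i w r))) * dI i w r.
  by rewrite bmE mulr_sumr; apply: eq_bigr => r _; rewrite mulrA.
under eq_fun do rewrite E.
rewrite rE_sum => [|r]; last by apply: sqintM; [exact: sq|exact: (mi_sqint hI)].
rewrite big1// => r _; apply: (mi_mean hI) => //.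
by apply: measurable_funM => //; apply: fm_bz; exact: ltnW.
Qed.

Let bl_bdd i w : `|below i w * lyap i w| <= R2.
Proof.
rewrite ger0_norm; first exact: below_lyap.
by rewrite mulr_ge0 ?lyap_ge0//; case/andP: (below_itv i w).
Qed.

Let fm_bl i : (i <= N)%N -> fmeas (t i) (fun w => below i w * lyap i w).
Proof. by move=> iN; apply: measurable_funM; [exact: fmeas_below|exact: fm_lyap]. Qed.

Let lyap_boundE i w : lyap_bound i.+1 w = (1 - th i) * lyap_bound i w +
  (C * dt i * below i w - th i * (below i w * lyap i w) + below i w * mart_step i w +
   below i w * quad_step i w).
Proof. rewrite /=; ring. Qed.

Let lyap_boundF i : lyap_bound i.+1 = fun w => (1 - th i) * lyap_bound i w +
  (C * dt i * below i w - th i * (below i w * lyap i w) + below i w * mart_step i w +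
   below i w * quad_step i w).
Proof. by apply/funext => w; exact: lyap_boundE. Qed.

Let bq_rint i : (i < N)%N -> rint P (fun w => below i w * quad_step i w).
Proof.
move=> iN; apply: (rintM_bdd (M := 1)) => //; last exact: rint_quad.
exact: (fmeas_measurable hP hW (fmeas_below (ltnW iN))).
Qed.

Let b_rint i : (i <= N)%N -> rint P (below i).
Proof.
move=> iN; apply: sqint_rint; apply: (@sqint_bdd _ _ _ P 1) => //.
exact: (fmeas_measurable hP hW (fmeas_below iN)).
Qed.

Let bl_rint i : (i <= N)%N -> rint P (fun w => below i w * lyap i w).
Proof.
move=> iN; apply: sqint_rint; apply: (@sqint_bdd _ _ _ P R2) => //.
exact: (fmeas_measurable hP hW (fm_bl iN)).
Qed.

Lemma rint_lyap_bound i : (i <= N)%N -> rint P (lyap_bound i).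
Proof.
elim: i => [|i IH] iN; first exact: rint_cst.
rewrite lyap_boundF.
apply: rintD; first exact/rintZ/IH/ltnW.
apply: rintD; last exact: bq_rint.
apply: rintD; last exact/sqint_rint/sq_bm.
by apply: rintB; apply: rintZ; [apply: b_rint|apply: bl_rint]; exact: ltnW.
Qed.

Lemma fmeas_lyap_bound i : (i <= N)%N -> fmeas (t i) (lyap_bound i).
Proof.
elim: i => [|i IH] iN; first exact: measurable_cst.
have mc (c : R) : fmeas (t i.+1) (fun=> c) by exact: measurable_cst.
have iN' := ltnW iN; have mb := step_le iN (fmeas_below iN').
rewrite lyap_boundF.
apply: measurable_funD.
  by apply: measurable_funM => //; apply: step_le => //; exact: IH.
apply: measurable_funD; last by apply: measurable_funM => //; exact: fm_quad.
apply: measurable_funD; last exact: fm_bm.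
apply: measurable_funB; apply: measurable_funM => //.
by apply: step_le => //; exact: fm_bl.
Qed.

(** The drift [- eta * lyap i w * dt] is split into two equal parts: one turns into the factor
    [1 - th i], the other stays as a reserve in [lyap_bound]. Errors are contracted too, so the
    accumulated defects bound the total loss. The last node [i] may already be above the level; the
    lower bound holds even after an exit. *)
Lemma lyap_bound_ge i w E : (i <= N)%N ->
  \sum_(j < i) Num.max (lyap_defect j w) 0 <= E -> lyap 0 w = 0 ->
  - E <= lyap_bound i w /\
  ((forall j, (j < i)%N -> lyap j w <= R2) -> lyap i w <= lyap_bound i w + E).
Proof.
move=> + + l0; elim: i E => [|i IH] E iN.
  by rewrite big_ord0 => E0; rewrite /= l0 add0r lerNl oppr0.
rewrite big_ord_recr/=; set rp := Num.max _ _ => hE.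
have rp0 : 0 <= rp by rewrite /rp le_max lexx orbT.
have rp1 : lyap_defect i w <= rp by rewrite /rp le_max lexx.
set E1 := \sum_(j < i) _ in hE.
have E10 : 0 <= E1 by apply: sumr_ge0 => j _; rewrite le_max lexx orbT.
have [IH1 IH2] := IH E1 (ltnW iN) (lexx _).
have /andP[t0 t1] := th01 iN.
move: rp1; rewrite /lyap_defect.
(* After an exit only the contraction acts, and the hypothesis of the second claim fails at the next
   node. *)
have [b|b] : below i w = 0 \/ below i w = 1 by case/orP: (below01 i w) => /eqP; [left|right].
  move=> _; rewrite b mul0r addr0; split.
    have : (1 - th i) * - E1 <= (1 - th i) * lyap_bound i w.
      by apply: ler_wpM2l => //; lra.
    by have : 0 <= th i * E1 by [exact: mulr_ge0]; lra.
  move=> h; suff : below i w = 1 by rewrite b => /esym/eqP; rewrite oner_eq0.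
  by apply/below1P => j ji; apply: h; rewrite ltnS.
rewrite b mul1r => hrp.
have hl := IH2 (fun j ji => (below1P i w).1 b j (ltnW ji)).
have key : lyap i.+1 w <= (1 - th i) * lyap_bound i w +
    (C * dt i - th i * lyap i w + mart_step i w + quad_step i w) + E.
  have : (1 - th i) * lyap i w <= (1 - th i) * (lyap_bound i w + E1).
    by apply: ler_wpM2l => //; lra.
  have : 0 <= th i * E1 by exact: mulr_ge0.
  move: hrp.
  have -> : (C - eta * lyap i w) * dt i = C * dt i - 2 * (th i * lyap i w) by field.
  by lra.
split=> //.
by have := lyap_ge0 i.+1 w; lra.
Qed.

Let lyap_martE i w : lyap_mart i.+1 w = (1 - th i) * lyap_mart i w + below i w * mart_step i w.
Proof. by []. Qed.

Let fm_sq_mart i : (i <= N)%N -> fmeas (t i) (lyap_mart i) /\ sqint P (lyap_mart i).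
Proof.
elim: i => [|i IH] iN; first by split; [exact: measurable_cst|exact: sqint_cst].
have [mi si] := IH (ltnW iN); split.
  apply: measurable_funD; last exact: fm_bm.
  by apply: measurable_funM; [exact: measurable_cst|exact: step_le].
by apply: sqintD; [exact: sqintZ|exact: sq_bm].
Qed.

(** The terms in [C] and [quad_step] are nonnegative, the reserve costs at most [th i * R2], and
    [(1 - th) * R2 + th * R2 = R2], so the loss does not accumulate. *)
Lemma lyap_bound_mart i w : (i <= N)%N -> lyap_mart i w - R2 <= lyap_bound i w.
Proof.
elim: i => [|i IH] iN; first by rewrite /= sub0r lerNl oppr0.
have /andP[t0 t1] := th01 iN; have iN' := IH (ltnW iN).
rewrite lyap_boundE lyap_martE.
have h1 : (1 - th i) * (lyap_mart i w - R2) <= (1 - th i) * lyap_bound i w.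
  by apply: ler_wpM2l => //; lra.
have h2 : 0 <= C * dt i * below i w.
  apply: mulr_ge0; last by case/andP: (below_itv i w).
  by rewrite mulr_ge0// ltW// dt_gt0.
have h3 : 0 <= below i w * quad_step i w.
  by apply: mulr_ge0 => //; case/andP: (below_itv i w).
have h4 : th i * (below i w * lyap i w) <= th i * R2.
  by apply: ler_wpM2l => //; exact: below_lyap.
lra.
Qed.

(** Increments are orthogonal and the damping factors are at most 1. Each step contributes a 4 from
    the coefficient 2, [m] from Cauchy-Schwarz, [R2] from the localisation and [KI * dt] from the
    variance, hence a bound independent of the mesh. *)
Lemma rE_lyap_mart_sqr i : (i <= N)%N ->
  rE P (fun w => lyap_mart i w ^+ 2) <= 4 * m%:R * R2 * KI * t i.
Proof.
elim: i => [|i IH] iN.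
  by under eq_fun do rewrite /= expr0n; rewrite rE_cst (grid0 g) mulr0.
have iN' := ltnW iN; have [mm sm] := fm_sq_mart iN'.
have /andP[t0 t1] := th01 iN.
have E : (fun w => lyap_mart i.+1 w ^+ 2) = (fun w => (1 - th i) ^+ 2 * lyap_mart i w ^+ 2 +
    (2 * (1 - th i)) * (lyap_mart i w * (below i w * mart_step i w)) +
    (below i w * mart_step i w) ^+ 2).
  by apply/funext => w; rewrite lyap_martE; ring.
have icross : rint P (fun w => lyap_mart i w * (below i w * mart_step i w)).
  by apply: sqintM => //; exact: sq_bm.
rewrite E rED; last 2 first.
- by apply: rintD; apply: rintZ => //; exact: sm.2.
- exact: (sq_bm iN).2.
rewrite rED; [|by apply: rintZ; exact: sm.2|exact: rintZ].
rewrite !rEZ//; last exact: sm.2.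
rewrite bm_mean// mulr0 addr0.
have h1 : (1 - th i) ^+ 2 * rE P (fun w => lyap_mart i w ^+ 2) <= rE P (fun w => lyap_mart i w ^+ 2).
  rewrite ler_piMl//; first by apply: rE_ge0 => w; exact: sqr_ge0.
  by rewrite exprn_ile1//; lra.
have h2 : rE P (fun w => (below i w * mart_step i w) ^+ 2) <= 4 * m%:R * R2 * KI * dt i.
  apply: (@le_trans _ _ (rE P (fun w => 4 * m%:R * (below i w * lyap i w * quad_step i w)))).
    apply: rE_le; first exact: (sq_bm iN).2.
      apply: rintZ; apply: (rintM_bdd (M := R2)) => //; last exact: rint_quad.
      exact: (fmeas_measurable hP hW (fm_bl iN')).
    move=> w; rewrite exprMn.
    have -> : below i w ^+ 2 = below i w.
      by case/orP: (below01 i w) => /eqP ->; rewrite ?expr0n ?expr1n.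
    rewrite (mulrCA (4 * m%:R)) -!mulrA ler_wpM2l//; first by case/andP: (below_itv i w).
    apply: le_trans (sqr_sum_le _) _.
    have -> : lyap i w * (4 * (m%:R * quad_step i w)) = m%:R * (4 * lyap i w * quad_step i w) by ring.
    rewrite ler_wpM2l// /quad_step !mulr_sumr; apply: ler_sum => r _.
    rewrite !exprMn (_ : 2 ^+ 2 = 4)//; last by ring.
    rewrite ler_wpM2r ?sqr_ge0// (bigD1 r)//= lerDl; apply: sumr_ge0 => *.
    by rewrite mulr_ge0 ?sqr_ge0.
  rewrite rEZ; last first.
    apply: (rintM_bdd (M := R2)) => //; last exact: rint_quad.
    exact: (fmeas_measurable hP hW (fm_bl iN')).
  rewrite -!mulrA !ler_wpM2l//.
  have /= := mi_var hI iN (fm_bl iN') (B := R2) (fun w => ltac:(by rewrite below_lyap andbT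
    mulr_ge0 ?lyap_ge0//; case/andP: (below_itv i w))).
  move/le_trans; apply; rewrite mulrC; apply: ler_wpM2r.
    by rewrite mulr_ge0// ltW// dt_gt0.
  rewrite -[leRHS](rE_cst P); apply: rE_le; [exact: bl_rint|exact: rint_cst|].
  by move=> w; exact: below_lyap.
have := IH iN'; move: h1 h2.
have -> : 4 * m%:R * R2 * KI * t i.+1 = 4 * m%:R * R2 * KI * dt i + 4 * m%:R * R2 * KI * t i by ring.
lra.
Qed.

Lemma sqint_lyap_mart i : (i <= N)%N -> sqint P (lyap_mart i).
Proof. by move=> iN; case: (fm_sq_mart iN). Qed.

Variables (x : nat -> Omega -> R) (M' : R).
Hypothesis hx : density_incr P W N t x M'.
Local Notation D := (density x).

(** The growth rate of the recursion under the density. The tilt times the martingale step is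
    estimated with weight [th i], and [x^2 / th <= 2 M'^2 / eta]; the summand 2 bounds the factor
    [1 + x i w] in front of the quadratic step. *)
Definition lyap_const : R := C + (2 * M' ^+ 2 / eta + 2) * KI.

(** With [L = lyap_const], the mean obeys [v' <= (1 - th) v + L dt], whose fixed point is
    [2 L / eta] because [th = eta dt / 2]. Starting from 0 it never exceeds it, whatever the time
    and the grid. *)
Lemma rE_density_lyap_bound i : (i <= N)%N ->
  rE P (fun w => D i w * lyap_bound i w) <= 2 * lyap_const / eta.
Proof.
have Cc0 : 0 <= lyap_const.
  by rewrite addr_ge0// mulr_ge0// addr_ge0// divr_ge0 ?(ltW eta0)// mulr_ge0 ?sqr_ge0.
elim: i => [|i IH] iN.
  under eq_fun do rewrite /= mulr0.
  by rewrite rE_cst divr_ge0 ?(ltW eta0)// mulr_ge0.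
have iN' := ltnW iN; have /andP[t0 t1] := th01 iN.
have mD := fmeas_density g hx iN'.
have D0 w : 0 <= D i w by exact: (density_ge0 hx).
have D2 w : D i w <= 2 ^+ i by exact: (density_le hx).
have rD f : rint P f -> rint P (fun w => D i w * f w) by exact: (rint_density hP hW g hx iN').
have rDS f : rint P f -> rint P (fun w => D i.+1 w * f w) by exact: (rint_density hP hW g hx iN).
have iQ := rint_lyap_bound iN'; have mQ := fmeas_lyap_bound iN'.
have fb := fmeas_below iN'.
(* [A] collects what is known at time [t i], for which the new density factor averages to 1; [Bm] is
   the centred martingale step; [Bq] dominates the effect of the tilt and the quadratic step. *)
pose A w := D i.+1 w * ((1 - th i) * lyap_bound i w +
  (C * dt i * below i w - th i * (below i w * lyap i w))).
pose Bm w := D i w * (below i w * mart_step i w).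
pose Bq w := D i w * (th i * (below i w * lyap i w) +
  (2 * M' ^+ 2 / eta + 2) * (below i w * quad_step i w)).
have bl := bl_rint iN'; have b1 := b_rint iN'; have bq := bq_rint iN.
have sbm := sqint_rint (sq_bm iN).
have iA0 : rint P (fun w => (1 - th i) * lyap_bound i w +
    (C * dt i * below i w - th i * (below i w * lyap i w))).
  by apply: rintD; [exact: rintZ|apply: rintB; exact: rintZ].
have iA : rint P A by exact: rDS.
have iBm : rint P Bm by exact: rD.
have iBq : rint P Bq by apply: rD; apply: rintD; exact: rintZ.
apply: (@le_trans _ _ (rE P (fun w => A w + Bm w + Bq w))).
  apply: rE_le.
  - exact: rDS (rint_lyap_bound iN).
  - by apply: rintD => //; exact: rintD.
  - move=> w; rewrite lyap_boundE densityS.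
    have xi2 := di_bound hx w iN; have := di_le1 hx w iN; rewrite ler_norml => /andP[_ x1].
    (* The first term on the right is exactly the reserve [th i * lyap i w] subtracted in
       [lyap_bound]. *)
    have xm : x i w * mart_step i w <= th i * lyap i w + 2 * M' ^+ 2 / eta * quad_step i w.
      rewrite /mart_step /lyap /quad_step !mulr_sumr -big_split/=; apply: ler_sum => r _.
      have tp : 0 < th i by rewrite mulr_gt0 ?divr_gt0 ?dt_gt0.
      set z := zeta i w r; set y := dI i w r; set X := x i w in xi2 x1 *.
      have h1 (k : R) : 0 < k -> X * (2 * z * y) <= k * z ^+ 2 + (X * y) ^+ 2 / k.
        move=> k0; rewrite -subr_ge0.
        have -> : k * z ^+ 2 + (X * y) ^+ 2 / k - X * (2 * z * y) = (k * z - X * y) ^+ 2 / k.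
          by field; rewrite gt_eqF.
        by rewrite divr_ge0 ?sqr_ge0// ltW.
      apply: le_trans (h1 _ tp) _; rewrite lerD2l exprMn mulrAC ler_wpM2r ?sqr_ge0//.
      rewrite ler_pdivrMr// (_ : 2 * M' ^+ 2 / eta * th i = M' ^+ 2 * dt i)//.
      by field; rewrite gt_eqF.
    have xq : (1 + x i w) * quad_step i w <= 2 * quad_step i w.
      by apply: ler_wpM2r => //; lra.
    have Db : 0 <= D i w * below i w by rewrite mulr_ge0//; case/andP: (below_itv i w).
    have := ler_wpM2l Db (lerD xm xq).
    rewrite /A /Bm /Bq densityS.
    by move: (D i w) (below i w) (lyap i w) (mart_step i w) (quad_step i w) (lyap_bound i w) (x i w)
      => *; lra.
rewrite rED//; last exact: rintD.
rewrite rED//.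
have -> : rE P Bm = 0 by apply: bm_mean => //; exact: (sqint_density hP hW g hx iN').
have mA : fmeas (t i) (fun w => (1 - th i) * lyap_bound i w +
    (C * dt i * below i w - th i * (below i w * lyap i w))).
  have mc (c : R) : fmeas (t i) (fun=> c) by exact: measurable_cst.
  apply: measurable_funD; first by apply: measurable_funM.
  apply: measurable_funB; first by apply: measurable_funM.
  by apply: measurable_funM => //; exact: fm_bl.
have -> : rE P A = (1 - th i) * rE P (fun w => D i w * lyap_bound i w) +
    (C * dt i * rE P (fun w => D i w * below i w) -
     th i * rE P (fun w => D i w * (below i w * lyap i w))).
  rewrite /A (density_martingale1 hP hW g hx iN mA iA0).
  rewrite -!rEZ; [|exact: rD..].
  rewrite -rEB; [|by apply: rintZ; exact: rD..].
  rewrite -rED; last 2 first.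
  - by apply: rintZ; exact: rD.
  - by apply: rintB; apply: rintZ; exact: rD.
  by congr rE; apply/funext => w; ring.
have -> : rE P Bq = th i * rE P (fun w => D i w * (below i w * lyap i w)) +
    (2 * M' ^+ 2 / eta + 2) * rE P (fun w => D i w * below i w * quad_step i w).
  rewrite -!rEZ; last 2 first.
  - by under eq_fun do rewrite -mulrA; exact: rD.
  - exact: rD.
  rewrite -rED; last 2 first.
  - by apply: rintZ; exact: rD.
  - by apply: rintZ; under eq_fun do rewrite -mulrA; exact: rD.
  by congr rE; apply/funext => w; rewrite /Bq; ring.
have Db1 : rE P (fun w => D i w * below i w) <= 1.
  rewrite -[leRHS](rE_density hP hW g hx iN'); apply: rE_le; first exact: rD.
    exact: sqint_rint (sqint_density hP hW g hx iN').
  by move=> w; rewrite ler_piMr//; case/andP: (below_itv i w).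
have Dq : rE P (fun w => D i w * below i w * quad_step i w) <= KI * dt i.
  have mDb : fmeas (t i) (fun w => D i w * below i w) by exact: measurable_funM.
  have hb w : 0 <= D i w * below i w <= 2 ^+ i.
    have /andP[b0 b1'] := below_itv i w; apply/andP; split; first exact: mulr_ge0.
    exact: le_trans (ler_piMr (D0 w) b1') (D2 w).
  have tn : 0 <= KI * dt i by rewrite mulr_ge0// ltW// dt_gt0.
  by apply: le_trans (mi_var hI iN mDb hb) _; rewrite ler_piMr.
have c0 : 0 <= 2 * M' ^+ 2 / eta + 2.
  by rewrite addr_ge0// divr_ge0 ?(ltW eta0)// mulr_ge0 ?sqr_ge0.
have h1 : C * dt i * rE P (fun w => D i w * below i w) <= C * dt i.
  by rewrite ler_piMr// mulr_ge0// ltW// dt_gt0.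
have h2 := ler_wpM2l c0 Dq.
have h3 : (1 - th i) * rE P (fun w => D i w * lyap_bound i w) <= (1 - th i) * (2 * lyap_const / eta).
  by apply: ler_wpM2l; [lra|exact: IH].
have h4 : (1 - th i) * (2 * lyap_const / eta) + dt i * lyap_const = 2 * lyap_const / eta.
  by field; rewrite gt_eqF.
rewrite -[leRHS]h4.
have -> : dt i * lyap_const = C * dt i + (2 * M' ^+ 2 / eta + 2) * (KI * dt i).
  by rewrite /lyap_const; ring.
lra.
Qed.

End lyapunov.

(** * The reflecting boundary *)

Section C1_expansion.
Context {R : realType} {d : nat}.
Implicit Types (x y v : 'cV[R]_d).

Lemma is_derive_line (phi : 'cV[R]_d -> R) (i : 'I_d) q s : has_partial i phi ->
  is_derive (s : R^o) 1 (fun s : R^o => phi (q + s *: delta_mx i 0) : R^o)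
    (partial i phi (q + s *: delta_mx i 0)).
Proof.
move=> hp; have := hp (q + s *: delta_mx i 0).
have E : (fun h : R => h^-1 *: (((fun s : R^o => phi (q + s *: delta_mx i 0) : R^o) \o shift s) (h *: 1) -
    phi (q + s *: delta_mx i 0))) =
  (fun h : R => h^-1 *: (((phi : 'cV[R]_d -> R^o) \o shift (q + s *: delta_mx i 0)) (h *: delta_mx i 0) -
    phi (q + s *: delta_mx i 0))).
  apply/funext => h /=; rewrite /shift /= scaler1 scalerDl.
  by congr (_ *: (phi _ - _)); rewrite addrCA.
move=> hq; apply: DeriveDef; first by rewrite /derivable E; exact: hq.
by rewrite /derive E.
Qed.

Lemma MVT_coord (phi : 'cV[R]_d -> R) (i : 'I_d) q c : has_partial i phi ->
  exists2 s, `|s| <= `|c| &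
    phi (q + c *: delta_mx i 0) - phi q = partial i phi (q + s *: delta_mx i 0) * c.
Proof.
move=> hp; pose F (s : R^o) : R^o := phi (q + s *: delta_mx i 0).
have dF s := is_derive_line q s hp.
have cF : continuous F.
  move=> s; apply: differentiable_continuous; apply/derivable1_diffP.
  by have [] := dF s.
have q0 : phi q = F 0 by rewrite /F scale0r addr0.
rewrite q0 -/(F c); case: (leP 0 c) => c0.
  have [s] := @MVT_segment _ F _ _ _ c0 (fun s _ => dF s) (continuous_subspaceT cF).
  rewrite in_itv/= subr0 => /andP[s0 sc] ->; exists s => //.
  by rewrite !ger0_norm.
have [s] := @MVT_segment _ F _ _ _ (ltW c0) (fun s _ => dF s) (continuous_subspaceT cF).
rewrite in_itv/= sub0r => /andP[s0 sc] E; exists s.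
  by rewrite (ler0_norm sc) (ltr0_norm c0) lerN2.
by rewrite -opprB E mulrN opprK.
Qed.

(** One coordinate is moved at a time, along the points [p j]. Each move is a one-dimensional mean
    value, taken at a point so close to [x] that the partial derivative there differs from its value
    at [x] by at most [e]. *)
Lemma C1_expand (phi : 'cV[R]_d -> R) x e : (forall i, has_partial i phi) ->
  (forall i, continuous (partial i phi)) -> 0 < e ->
  exists2 del, 0 < del & forall v, (forall i, `|v i 0| <= del) ->
    `|phi (x + v) - phi x - \sum_i partial i phi x * v i 0| <= e * \sum_i `|v i 0|.
Proof.
move=> hp hc e0.
have near_i i : exists2 r, 0 < r & forall y, (forall k, `|y k 0 - x k 0| < r) ->
    `|partial i phi y - partial i phi x| <= e.
  have /cvgr_dist_lt /(_ _ e0) := hc i x.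
  rewrite -filter_from_ballE => -[r r0 hr]; exists r => // y hy.
  apply: ltW; rewrite distrC; apply: hr => /=; split=> // a b.
  by rewrite ord1 /ball/= distrC; exact: hy.
pose r i := projT1 (cid2 (near_i i)).
have [r0 hr] : (forall i, 0 < r i) /\ forall i y, (forall k, `|y k 0 - x k 0| < r i) ->
    `|partial i phi y - partial i phi x| <= e.
  by split=> i; rewrite /r; case: cid2.
pose del := \big[Num.min/1]_i (r i / 2).
have del0 : 0 < del by apply/bigmin_gtP; split=> // i _; rewrite divr_gt0.
have delr i : del < r i.
  apply: (@le_lt_trans _ _ (r i / 2)); first exact: bigmin_le_cond.
  by have := r0 i; lra.
exists del => // v hv.
pose p (j : nat) : 'cV[R]_d := x + \col_k (if (k < j)%N then v k 0 else 0).
have p0 : p 0 = x by apply/colP => k; rewrite !mxE addr0.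
have pd : p d = x + v by apply/colP => k; rewrite !mxE ltn_ord.
have pS (i : 'I_d) : p i.+1 = p i + v i 0 *: delta_mx i 0.
  apply/colP => k; rewrite !mxE eqxx andbT ltnS leq_eqVlt -addrA; congr (_ + _).
  case: (altP (k =P i)) => [->|]; first by rewrite ltnn eqxx/= add0r mulr1.
  by move=> /negbTE h; rewrite mulr0 addr0 (_ : (k == i :> nat) = false).
have step (i : 'I_d) : `|phi (p i.+1) - phi (p i) - partial i phi x * v i 0| <= e * `|v i 0|.
  rewrite pS; have [s hs ->] := MVT_coord (p i) (v i 0) (hp i).
  rewrite -mulrBl normrM ler_wpM2r//; apply: hr => k.
  have -> : (p i + s *: delta_mx i 0) k 0 - x k 0 =
      (if (k < i)%N then v k 0 else 0) + s * (k == i)%:R.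
    by rewrite !mxE eqxx andbT addrAC [x k 0 + _]addrC addrK.
  apply: le_lt_trans (delr i).
  case: (altP (k =P i)) => [->|ki]; first by rewrite ltnn mulr1 add0r (le_trans hs).
  by rewrite mulr0 addr0; case: ifP => _; rewrite ?normr0// ltW.
have tele : \sum_(i < d) (phi (p i.+1) - phi (p i)) = phi (x + v) - phi x.
  rewrite -(big_mkord xpredT (fun i => phi (p i.+1) - phi (p i))) telescope_sumr//.
  by rewrite pd p0.
rewrite -tele -sumrB mulr_sumr; apply: le_trans (ler_norm_sum _ _ _) _.
by apply: ler_sum.
Qed.

End C1_expansion.

Section convex_domain.
Context {R : realType} {d : nat}.
Implicit Types (x y : 'cV[R]_d) (G : set 'cV[R]_d).

(** A map that does not increase coordinate distances and sends [G] into its closure sends the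
    closure into the closure. This is applied to the first endpoint and then to the second. *)
Lemma closure_convex G x y s : convex_set G -> closure G x -> closure G y ->
  0 <= s <= 1 -> closure G (x + s *: (y - x)).
Proof.
move=> cG; move: x y.
have main (f : 'cV[R]_d -> 'cV[R]_d) :
    (forall u v k, `|f u k 0 - f v k 0| <= `|u k 0 - v k 0|) ->
    (forall u, G u -> closure G (f u)) -> forall u, closure G u -> closure G (f u).
  move=> cf fG u hu; rewrite [closure G]((closure_id (closure G)).1 (@closed_closure _ G)).
  move=> B /nbhs_ballP[r r0 hB].
  have [v [Gv uv]] := hu _ (nbhsx_ballx u r r0).
  exists (f v); split; [exact: fG|apply: hB].
  have [_ uv'] := uv; split=> // i j; apply: le_lt_trans (uv' i j).
  by rewrite ord1; exact: cf.
move=> x y hx hy /andP[s0 s1]; move: x hx.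
have E (a b c : R) : a + s * (c - a) - (b + s * (c - b)) = (1 - s) * (a - b) by ring.
have E' (a b c : R) : a + s * (b - a) - (a + s * (c - a)) = s * (b - c) by ring.
apply: (main (fun x => x + s *: (y - x))) => [u v k|x Gx].
  rewrite !mxE E normrM ler_piMl// ger0_norm ?subr_ge0//; lra.
move: y hy; apply: (main (fun y => x + s *: (y - x))) => [u v k|y Gy].
  by rewrite !mxE E' normrM ler_piMl// ger0_norm.
have s2 : 0 <= 1 - s by lra.
have s3 : 1 - s <= 1 by lra.
apply: subset_closure; have := cG x y (Itv01 s2 s3).
rewrite !inE => /(_ Gx Gy); congr G.
apply/colP => k; transitivity ((1 - s) * x k 0 + (1 - (1 - s)) * y k 0); last by rewrite !mxE; ring.
by rewrite /conv/= !mxE.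
Qed.

Lemma domain_phi_ge0 G (phi : 'cV[R]_d -> R) x : hypG G phi -> closure G x -> 0 <= phi x.
Proof.
move=> hG hx; have [Gx|nGx] := pselect (G x).
  by move: Gx; rewrite (hypG_domain hG) /= => /ltW.
have : boundary G x by split=> //; have /interior_id -> := hypG_open hG.
by rewrite (hypG_boundary hG) /= => ->.
Qed.

(** [phi] vanishes at [x] and is nonnegative on the segment to [y], which stays in the closure of
    [G] by convexity; so the slope of [phi] towards [y] cannot be negative. *)
Lemma domain_normal G (phi : 'cV[R]_d -> R) x y : hypG G phi -> boundary G x ->
  closure G y -> 0 <= \sum_k partial k phi x * (y k 0 - x k 0).
Proof.
move=> hG bx hy; have [hp hc _ _] := hypG_C2 hG.
have cx : closure G x by case: bx.
have p0 : phi x = 0 by move: bx; rewrite (hypG_boundary hG).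
pose A := \sum_k partial k phi x * (y k 0 - x k 0).
pose B := \sum_k `|y k 0 - x k 0|.
have B0 : 0 <= B by exact: sumr_ge0.
suff H e : 0 < e -> - (e * B) <= A.
  rewrite -/A leNgt; apply/negP => A0.
  have := H (- A / (2 * (B + 1))).
  rewrite divr_gt0 ?oppr_gt0//; last by lra.
  move=> /(_ isT); rewrite lerNl -mulrA.
  have : (2 * (B + 1))^-1 * B <= 2^-1.
    by rewrite mulrC ler_pdivrMr; lra.
  by nra.
move=> e0; have [del del0 h] := C1_expand x hp hc e0.
(* Short enough for the expansion at [x] to apply to [s *: (y - x)], and at most 1 to stay on the
   segment. *)
pose s := Num.min 1 (del / (B + 1)).
have s0 : 0 < s by rewrite lt_min ltr01 divr_gt0//; lra.
have sB : s * (B + 1) <= del.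
  by rewrite -ler_pdivlMr; [rewrite ge_min lexx orbT|lra].
have s1 : s <= 1 by rewrite ge_min lexx.
have := h (s *: (y - x)); rewrite p0 subr0.
have E k : (s *: (y - x)) k 0 = s * (y k 0 - x k 0) by rewrite !mxE.
have E1 : \sum_i partial i phi x * (s *: (y - x)) i 0 = s * A.
  by rewrite mulr_sumr; apply: eq_bigr => i _; rewrite E; ring.
have E2 : \sum_i `|(s *: (y - x)) i 0| = s * B.
  by rewrite mulr_sumr; apply: eq_bigr => i _; rewrite E normrM gtr0_norm.
rewrite E1 E2 => /(_ _)/wrap[].
  move=> i; rewrite E normrM gtr0_norm//; apply: le_trans sB; rewrite ler_pM2l//.
  by rewrite /B (bigD1 i)//= -addrA lerDl addr_ge0// sumr_ge0.
rewrite ler_norml => /andP[_].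
have : 0 <= phi (x + s *: (y - x)).
  by apply: (domain_phi_ge0 hG); apply: closure_convex => //; [exact: hypG_convex hG|rewrite s1 ltW].
move=> h1 h2; rewrite -(ler_pM2l s0) mulrN mulrCA; lra.
Qed.

End convex_domain.

(** * Paths of the reflected equation *)

Section path_continuity.
Context {R : realType}.
Implicit Types (T : R) (u : R -> R).

Lemma itv_dist (a b r r' : R) : a <= r <= b -> a <= r' <= b -> `|r - r'| <= b - a.
Proof. by rewrite ler_norml; lra. Qed.

Lemma within_dist_lt T u x e : {within `[0, T], continuous u} -> 0 <= x <= T -> 0 < e ->
  exists2 r, 0 < r & forall y, 0 <= y <= T -> `|x - y| < r -> `|u x - u y| < e.
Proof.
move=> /subspace_continuousP cu x0 e0.
have /cvgr_dist_lt /(_ _ e0) := cu x (ltac:(by rewrite /= in_itv)).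
rewrite near_withinE => /nbhs_ballP[r r0 hr]; exists r => // y y0 xy.
by apply: hr => //=; rewrite in_itv.
Qed.

Lemma within_unif T u e : {within `[0, T], continuous u} -> 0 < e ->
  exists2 del, 0 < del & forall s r, 0 <= s <= T -> 0 <= r <= T -> `|s - r| <= del ->
    `|u s - u r| <= e.
Proof.
move=> cu e0; have e2 : 0 < e / 2 by rewrite divr_gt0.
pose Q (del s : R) := forall r, 0 <= r <= T -> `|s - r| <= del -> `|u s - u r| <= e.
have cov := (compact_near_coveringP _).1 (@segment_compact R 0 T).
have : \forall del \near (0 : R)^'+, `[0, T] `<=` (fun s => 0 <= s <= T -> Q del s).
  apply: cov => x /=; rewrite in_itv/= => x0.
  have [r r0 hr] := within_dist_lt cu x0 e2.
  near=> y del => y0 z z0 yz.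
  have xy : `|x - y| < r / 2 by near: y; apply: nbhsx_ballx; rewrite divr_gt0.
  have dr : del < r / 2 by near: del; apply: nbhs_right_lt; rewrite divr_gt0.
  have h1 : `|u x - u y| < e / 2 by apply: hr => //; apply: lt_le_trans xy _; lra.
  have h2 : `|u x - u z| < e / 2.
    apply: hr => //; have := ler_normD (x - y) (y - z); rewrite /= in yz; rewrite addrA subrK; lra.
  have := ler_normD (u y - u x) (u x - u z); rewrite addrA subrK distrC in h1 *; lra.
move=> h; near (0 : R)^'+ => del; exists del => // s r s0 r0.
have : `[0, T] `<=` (fun s => 0 <= s <= T -> Q del s) by near: del.
by move=> /(_ s); rewrite /= in_itv/= => /(_ s0 s0); exact.
Unshelve. all: by end_near. Qed.

Lemma within_bounded T u : 0 <= T -> {within `[0, T], continuous u} ->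
  exists M, forall r, 0 <= r <= T -> `|u r| <= M.
Proof.
move=> T0 cu; have cn : {within `[0, T], continuous (fun r => `|u r|)}.
  by move=> x; apply: (cvg_comp u (fun v : R => `|v|) (cu x)); exact: norm_continuous.
have [c _ hc] := EVT_max T0 cn.
by exists `|u c| => r r0; apply: hc; rewrite in_itv.
Qed.

Lemma within_measurable T u : {within `[0, T], continuous u} ->
  measurable_fun (`[0, T] : set (measurableTypeR R)) u.
Proof. by move=> cu; exact: subspace_continuous_measurable_fun. Qed.

End path_continuity.

Section path_defect.
Context {R : realType} {d : nat}.
Local Notation RT := (measurableTypeR R).
Local Notation leb := (@lebesgue_measure R).
Variables (T : R) (T0 : 0 < T) (z F g : 'I_d -> R -> R) (I : 'I_d -> R -> R).
Variables (mu : {measure set RT -> \bar R}) (beta : R -> R) (C eta : R).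
Hypotheses (cz : forall k, {within `[0, T], continuous (z k)})
  (cF : forall k, {within `[0, T], continuous (F k)})
  (cg : forall k, {within `[0, T], continuous (g k)})
  (muT : (mu `[0%R, T]%classic < +oo)%E)
  (mbeta : measurable_fun (`[0, T] : set RT) beta)
  (beta01 : forall r, beta r = 0 \/ beta r = 1)
  (betaE : forall t, 0 <= t <= T ->
     \int[mu]_(r in `[0, t]) beta r = fine (mu `[0, t]%classic))
  (zE : forall k t, 0 <= t <= T ->
     z k t = \int[leb]_(r in `[0, t]) F k r + I k t + \int[mu]_(r in `[0, t]) g k r)
  (eta0 : 0 <= eta)
  (zF : forall r, 0 <= r <= T ->
     \sum_k 2 * z k r * F k r <= C - eta * \sum_k z k r ^+ 2)
  (zg : forall r, 0 <= r <= T -> beta r = 1 -> \sum_k z k r * g k r <= 0).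

Let itv_sub s t : 0 <= s -> t <= T -> (`]s, t] : set RT) `<=` `[0, T].
Proof.
move=> s0 tT r /=; rewrite !in_itv/= => /andP[h1 h2].
by rewrite (le_trans s0 (ltW h1)) (le_trans h2).
Qed.

Let bdd_int (nu : {measure set RT -> \bar R}) (h : R -> R) M (A : set RT) :
  (nu `[0%R, T]%classic < +oo)%E -> measurable A -> A `<=` `[0, T] ->
  measurable_fun (`[0, T] : set RT) h -> (forall r, 0 <= r <= T -> `|h r| <= M) ->
  nu.-integrable A (EFin \o h).
Proof.
move=> nuT mA sA mh hM; apply: measurable_bounded_integrable => //.
- by apply: le_lt_trans nuT; apply: le_measure => //; rewrite inE.
- exact: measurable_funS mh.
- exists M; split; first exact: num_real.
  move=> y My r /= /sA; rewrite /= in_itv => /hM h1; exact: le_trans h1 (ltW My).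
Qed.

Let incr (nu : {measure set RT -> \bar R}) (h : R -> R) M s t :
  (nu `[0%R, T]%classic < +oo)%E ->
  measurable_fun (`[0, T] : set RT) h -> (forall r, 0 <= r <= T -> `|h r| <= M) ->
  0 <= s -> s <= t -> t <= T ->
  \int[nu]_(r in `[0, t]) h r = \int[nu]_(r in `[0, s]) h r + \int[nu]_(r in `]s, t]) h r.
Proof.
move=> nuT mh hM s0 st tT.
have E : `[0, t]%classic = `[0, s]%classic `|` `]s, t]%classic :> set RT.
  by rewrite -itv_bndbnd_setU// bnd_simp.
rewrite E Rintegral_setU//.
  apply: (bdd_int nuT _ _ mh hM); first exact: measurableU.
  rewrite -E => r /=; rewrite !in_itv/= => /andP[-> rt]; exact: le_trans rt tT.
apply/disj_setPS => r [] /=; rewrite !in_itv/= => /andP[_ h1] /andP[h2 _].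
by have := le_lt_trans h1 h2; rewrite ltxx.
Qed.

(* With [dX = B + dI], [|dX|^2 = |dI|^2 + 2 dX . B - |B|^2], so that only [2 z(t) . B] with the
   right endpoint [t] has to be estimated and no chain rule for [B] is needed. *)
Lemma path_defect_small eps : 0 < eps -> exists2 del, 0 < del &
  forall N t, is_grid T N t -> (forall i, (i < N)%N -> t i.+1 - t i <= del) ->
  \sum_(i < N) Num.max (lyap_defect t (fun i (_ : unit) k => z k (t i))
     (fun i _ k => I k (t i.+1) - I k (t i)) C eta i tt) 0 <= eps.
Proof.
move=> eps0; have T0' := ltW T0.
have cz' k : {within `[0, T], continuous (z k)} by exact: cz.
have cF' k : {within `[0, T], continuous (F k)} by exact: cF.
have cg' k : {within `[0, T], continuous (g k)} by exact: cg.
have bd (h : 'I_d -> R -> R) : (forall k, {within `[0, T], continuous (h k)}) ->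
    exists2 M, 0 <= M & forall k r, 0 <= r <= T -> `|h k r| <= M.
  move=> ch; pose Mk k := projT1 (cid (within_bounded T0' (ch k))).
  exists (\sum_k `|Mk k|) => [|k r rT]; first exact: sumr_ge0.
  rewrite (bigD1 k)//=; apply: (@le_trans _ _ `|Mk k|); last by rewrite lerDl sumr_ge0.
  by apply: le_trans (ler_norm _); rewrite /Mk; case: cid => M /= ->.
have [Mz Mz0 hz] := bd _ cz; have [MF MF0 hF] := bd _ cF; have [Mg Mg0 hg] := bd _ cg.
have lebT : (leb `[0%R, T]%classic < +oo)%E.
  by rewrite lebesgue_measure_itv/= lte_fin T0 -EFinD ltry.
pose m t := fine (mu `[0, t]%classic).
pose D : R := d%:R.
have D0 : 0 <= D by [].
(* The cost, per unit of oscillation of [z] on a cell, of evaluating [z] at the same time as the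
   drift, the square sum and the reflection term. *)
pose c1 := 2 * D * MF + eta * (2 * D * Mz); pose c2 := 2 * D * Mg.
have c10 : 0 <= c1 by rewrite addr_ge0 ?mulr_ge0.
have c20 : 0 <= c2 by rewrite !mulr_ge0.
have m0 t : 0 <= m t by exact: fine_ge0.
(* The oscillation allowed on a cell: [om] times the total cost [c1 * T + c2 * m T] is at most
   [eps], and the 1 keeps the denominator positive. *)
pose om := eps / (c1 * T + c2 * m T + 1).
have den0 : 0 < c1 * T + c2 * m T + 1.
  by rewrite ltr_wpDl// addr_ge0// mulr_ge0.
have om0 : 0 < om by rewrite divr_gt0.
pose dk k := projT1 (cid2 (within_unif (cz' k) om0)).
pose del := \big[Num.min/1]_k dk k.
have dk0 k : 0 < dk k by rewrite /dk; case: cid2.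
exists del; first by apply/bigmin_gtP; split=> // i _.
move=> N t gr mesh.
have near_z i k r r' : (i < N)%N -> t i <= r <= t i.+1 -> t i <= r' <= t i.+1 ->
    `|z k r - z k r'| <= om.
  move=> iN /andP[r1 r2] /andP[r3 r4].
  have a0 := grid_ge0 gr (ltnW iN); have b0 := grid_leT gr iN.
  have : dk k >= t i.+1 - t i.
    by apply: le_trans (mesh i iN) _; exact: bigmin_le_cond.
  rewrite /dk; case: cid2 => /= dd _ h hd; apply: h.
  - by rewrite (le_trans a0 r1) (le_trans r2 b0).
  - by rewrite (le_trans a0 r3) (le_trans r4 b0).
  - by apply: le_trans hd; apply: itv_dist; rewrite ?r1 ?r3.
have step i : (i < N)%N -> Num.max (lyap_defect t (fun i (_ : unit) k => z k (t i))
     (fun i _ k => I k (t i.+1) - I k (t i)) C eta i tt) 0 <=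
    om * (c1 * (t i.+1 - t i) + c2 * (m (t i.+1) - m (t i))).
  move=> iN.
  have a0 := grid_ge0 gr (ltnW iN); have bT := grid_leT gr iN.
  have ab : t i < t i.+1 := grid_lt gr iN.
  have nz k r r' := near_z i k r r' iN.
  rewrite /lyap_defect /mart_step /quad_step /lyap.
  move: nz a0 bT ab; move: (t i) (t i.+1) => a b nz a0 bT ab.
  have ab' := ltW ab.
  pose A : set RT := `]a, b]%classic.
  have mA : measurable A by exact: measurable_itv.
  have sA : A `<=` `[0, T] := itv_sub a0 bT.
  have inA r : A r -> (0 <= r <= T) /\ (a <= r <= b).
    by move=> Ar; split; [have := sA r Ar; rewrite /= in_itv|
      move: Ar; rewrite /A /= in_itv/= => /andP[/ltW -> ->]].
  have abb : a <= b <= b by rewrite ab' lexx.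
  have aab : a <= a <= b by rewrite ab' lexx.
  have leA : fine (leb A) = b - a by rewrite lebesgue_measure_itv/= lte_fin ab.
  have muA : fine (mu A) = m b - m a.
    have := @incr mu (cst 1) 1 a b muT (measurable_cst _) (fun _ _ => ltac:(by rewrite normr1)) a0 ab' bT.
    by rewrite !Rintegral_cst// !mul1r /m => ->; rewrite addrC addKr.
  have muB : \int[mu]_(r in A) beta r = fine (mu A).
    have hb r : 0 <= r <= T -> `|beta r| <= 1.
      by move=> _; case: (beta01 r) => ->; rewrite ?normr0 ?normr1.
    have := incr muT mbeta hb a0 ab' bT; rewrite !betaE ?a0 ?(le_trans a0) ?(le_trans ab')//.
    by rewrite muA /m => ->; rewrite addrC addKr.
  have dab : 0 <= b - a by lra.
  have dm : 0 <= m b - m a by rewrite -muA; exact: fine_ge0.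
  rewrite ge_max; apply/andP; split; last first.
    by rewrite mulr_ge0 ?(ltW om0)// addr_ge0// mulr_ge0.
  pose BF k := \int[leb]_(r in A) F k r; pose Bg k := \int[mu]_(r in A) g k r.
  have iF k := bdd_int lebT mA sA (within_measurable (cF' k)) (hF k).
  have ig k := bdd_int muT mA sA (within_measurable (cg' k)) (hg k).
  have zincr k : z k b - z k a = BF k + (I k b - I k a) + Bg k.
    rewrite !zE ?a0 ?(le_trans a0) ?(le_trans ab')//.
    rewrite (incr lebT (within_measurable (cF' k)) (hF k) a0 ab' bT).
    by rewrite (incr muT (within_measurable (cg' k)) (hg k) a0 ab' bT) /BF /Bg; ring.
  set V := \sum_r z r a ^+ 2.
  have V1 : \sum_k z k b ^+ 2 - V - (\sum_k 2 * z k a * (I k b - I k a)) -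
      \sum_k (I k b - I k a) ^+ 2 <= \sum_k 2 * z k b * BF k + \sum_k 2 * z k b * Bg k.
    rewrite -!sumrB -big_split/=; apply: ler_sum => k _.
    have -> : I k b - I k a = z k b - z k a - (BF k + Bg k) by rewrite zincr; ring.
    by rewrite -subr_ge0; apply: le_trans (sqr_ge0 (BF k + Bg k)) _; rewrite le_eqVlt; apply/orP; left; apply/eqP; ring.
  have sumI (nu : {measure set RT -> \bar R}) (h : 'I_d -> R -> R) :
      (forall k, nu.-integrable A (EFin \o h k)) ->
      \sum_k 2 * z k b * \int[nu]_(r in A) h k r = \int[nu]_(r in A) (\sum_k 2 * z k b * h k r)
      /\ nu.-integrable A (EFin \o (fun r => \sum_k 2 * z k b * h k r)).
    move=> ih; elim: (index_enum _) => [|k s [IH1 IH2]].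
      have E : (fun r => \sum_(k <- [::]) 2 * z k b * h k r) = cst 0.
        by apply/funext => r; rewrite big_nil.
      rewrite E big_nil Rintegral_cst// mul0r; split=> //.
      rewrite (_ : _ \o _ = cst 0%E); last exact/funext.
      exact: integrable0.
    have E : (fun r => \sum_(j <- k :: s) 2 * z j b * h j r) =
        (fun r => 2 * z k b * h k r + \sum_(j <- s) 2 * z j b * h j r).
      by apply/funext => r; rewrite big_cons.
    have ik : nu.-integrable A (EFin \o (fun r => 2 * z k b * h k r)).
      by apply: (eq_integrable mA _ _ _ (integrableZl mA (2 * z k b) (ih k))) => r _.
    rewrite big_cons E RintegralD// RintegralZl// IH1; split=> //.
    by apply: (eq_integrable mA _ _ _ (integrableD mA ik IH2)) => r _.
  have V2 : \sum_k 2 * z k b * BF k <= (C - eta * V + om * c1) * (b - a).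
    have [-> iS] := sumI leb F iF.
    rewrite -leA -Rintegral_cst//; apply: le_Rintegral => //.
      by apply: (@bdd_int leb _ `|C - eta * V + om * c1|).
    move=> r /inA[rT rab].
    have h1 : \sum_k 2 * z k b * F k r <= \sum_k 2 * z k r * F k r + D * (2 * om * MF).
      rewrite (_ : D * _ = \sum_(k < d) (2 * om * MF)); last first.
        by rewrite sumr_const card_ord -[RHS]mulr_natl.
      rewrite -big_split/=; apply: ler_sum => k _; rewrite -lerBlDl -mulrBl -mulrBr.
      apply: le_trans (ler_norm _) _; rewrite !normrM ger0_norm//.
      by rewrite ler_pM ?mulr_ge0 ?hF// ler_pM2l// nz.
    have h2 : V <= \sum_k z k r ^+ 2 + D * (2 * om * Mz).
      rewrite (_ : D * _ = \sum_(k < d) (2 * om * Mz)); last first.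
        by rewrite sumr_const card_ord -[RHS]mulr_natl.
      rewrite -big_split/=; apply: ler_sum => k _; rewrite -lerBlDl subr_sqr.
      apply: le_trans (ler_norm _) _; rewrite normrM (mulrC 2) -mulrA.
      rewrite ler_pM// ?nz//; apply: le_trans (ler_normD _ _) _.
      rewrite mulr_natl mulr2n lerD// hz//; last by rewrite a0 (le_trans ab').
    have h3 := ler_wpM2l eta0 h2; have := zF rT; rewrite /c1 /=.
    by move: h1 h3; rewrite mulrDr; lra.
  have V3 : \sum_k 2 * z k b * Bg k <= om * c2 * (m b - m a).
    have [-> iS] := sumI mu g ig.
    have ib : mu.-integrable A (EFin \o beta).
      apply: (bdd_int (M := 1) muT mA sA mbeta) => r _.
      by case: (beta01 r) => ->; rewrite ?normr0 ?normr1.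
    (* A crude bound where [beta = 0], the good one being [om * c2] where [beta = 1]. Since [beta]
       integrates to the full mass of the cell, the function [(om * c2 - c') * beta + c'] integrates
       to the good bound. *)
    pose c' := 2 * D * Mz * Mg.
    have i1 : mu.-integrable A (EFin \o (fun r => (om * c2 - c') * beta r)).
      by apply: (eq_integrable mA _ _ _ (integrableZl mA (om * c2 - c') ib)) => r _.
    have i2 : mu.-integrable A (EFin \o cst c').
      by apply: (bdd_int (M := `|c'|) muT mA sA).
    have -> : om * c2 * (m b - m a) = \int[mu]_(r in A) ((om * c2 - c') * beta r + cst c' r).
      by rewrite RintegralD// RintegralZl// Rintegral_cst// muB muA; ring.
    apply: le_Rintegral => //.
      by apply: (eq_integrable mA _ _ _ (integrableD mA i1 i2)) => r _.
    move=> r /inA[rT rab].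
    case: (beta01 r) => br; rewrite br ?mulr0 ?mulr1 ?add0r ?subrK.
      rewrite (_ : cst c' r = \sum_(k < d) (2 * Mz * Mg)); last first.
        by rewrite sumr_const card_ord -[RHS]mulr_natl /c' /=; ring.
      apply: ler_sum => k _; apply: le_trans (ler_norm _) _; rewrite !normrM ger0_norm//.
      by rewrite ler_pM ?mulr_ge0 ?hg// ler_pM2l// hz// (le_trans a0).
    have h1 : \sum_k 2 * z k b * g k r <= 2 * \sum_k z k r * g k r + D * (2 * om * Mg).
      rewrite (_ : D * _ = \sum_(k < d) (2 * om * Mg)); last first.
        by rewrite sumr_const card_ord -[RHS]mulr_natl.
      rewrite mulr_sumr -big_split/=; apply: ler_sum => k _.
      rewrite -lerBlDl (_ : 2 * z k b * g k r - _ = 2 * (z k b - z k r) * g k r); last by ring.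
      apply: le_trans (ler_norm _) _; rewrite !normrM ger0_norm//.
      by rewrite ler_pM ?mulr_ge0 ?hg// ler_pM2l// nz.
    by have := zg rT br; move: h1; rewrite /c2 /=; lra.
  lra.
have sumE : \sum_(i < N) om * (c1 * (t i.+1 - t i) + c2 * (m (t i.+1) - m (t i))) =
    om * (c1 * (t N - t 0) + c2 * (m (t N) - m (t 0))).
  rewrite -mulr_sumr big_split/= -!mulr_sumr.
  rewrite -(big_mkord xpredT (fun i => t i.+1 - t i)) -(big_mkord xpredT (fun i => m (t i.+1) - m (t i))).
  by rewrite !telescope_sumr.
apply: (@le_trans _ _ (\sum_(i < N) om * (c1 * (t i.+1 - t i) + c2 * (m (t i.+1) - m (t i))))).
  by apply: ler_sum => i _; exact: step.
rewrite sumE (grid0 gr) (gridN gr) subr0.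
apply: (@le_trans _ _ (om * (c1 * T + c2 * m T + 1))); last by rewrite divfK// gt_eqF.
rewrite ler_pM2l//; have := m0 0; have : 0 <= c2 * m 0 by rewrite mulr_ge0.
lra.
Qed.

End path_defect.

(** * Continuity and dissipativity of the coefficients *)

Section coefficients.
Context {R : realType} {d : nat}.
Implicit Types (x y : 'cV[R]_d).

Definition near_at (h : 'cV[R]_d -> R) x e := exists2 r, 0 < r &
  forall y, (forall k, `|y k 0 - x k 0| < r) -> `|h y - h x| < e.

Lemma near_at_continuous (h : 'cV[R]_d -> R) x : (forall e, 0 < e -> near_at h x e) ->
  {for x, continuous h}.
Proof.
move=> hh A /nbhs_ballP[e e0 hA]; have [r r0 hr] := hh e e0.
apply/nbhs_ballP; exists r => // y [_ xy]; apply: hA.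
rewrite /ball/= distrC; apply: hr => k; rewrite distrC; exact: xy.
Qed.

Lemma mx_dist_lt x y r : 0 < r -> (forall k, `|y k 0 - x k 0| < r) -> `|x - y| < r.
Proof.
move=> r0 h; have : ball x r y by split=> // i j; rewrite ord1 /ball/= distrC.
by rewrite mx_norm_ball.
Qed.

Lemma mx_norm_coord (v : 'cV[R]_d) k : `|v k 0| <= `|v|.
Proof.
rewrite [leRHS]/Num.Def.normr/= mx_normrE.
exact: (le_bigmax _ (fun ij => `|v ij.1 ij.2|) (k, 0)).
Qed.

Lemma lipschitz_near_at (h : 'cV[R]_d -> 'cV[R]_d) x (U : set 'cV[R]_d) k e :
  nbhs x U -> [lipschitz h y | y in U] -> 0 < e -> near_at (fun y => h y k 0) x e.
Proof.
move=> /nbhs_ballP[u u0 hU] [M [_ hM]] e0.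
pose L := `|M| + 1.
have L0 : 0 < L by rewrite ltr_pwDr.
have ML : M < L by rewrite (le_lt_trans (ler_norm M))// ltrDl.
exists (Num.min u (e / L)) => [|y hy]; first by rewrite lt_min u0 divr_gt0.
have xy : `|x - y| < Num.min u (e / L) by apply: mx_dist_lt => //; rewrite lt_min u0 divr_gt0.
move: xy; rewrite lt_min => /andP[xy1 xy2].
have xx : ball x u x by exact: ballxx.
have xy : ball x u y by rewrite mx_norm_ball.
have := hM _ ML (x, y); rewrite /globally/= => /(_ (conj (hU _ xx) (hU _ xy))) h1.
have := mx_norm_coord (h x - h y) k; rewrite !mxE distrC => /le_lt_trans; apply.
by apply: le_lt_trans h1 _; rewrite mulrC -ltr_pdivlMr.
Qed.

Lemma drift_continuous dd b sigma k : hypA dd b sigma ->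
  continuous (fun y : 'cV[R]_d => (dd \+ b) y k 0 : R).
Proof.
move=> hA x; apply: near_at_continuous => e e0.
have e2 : 0 < e / 2 by rewrite divr_gt0.
have [U xU lU] := hypA_local_lipschitz hA x.
have [r r0 hr] := lipschitz_near_at k xU lU e2.
have [u u0 hu] := lipschitz_near_at k (@filterT _ (nbhs x) _) (hypA_b_lipschitz hA) e2.
exists (Num.min r u) => [|y hy]; first by rewrite lt_min r0.
have h1 : `|dd y k 0 - dd x k 0| < e / 2.
  by apply: hr => j; have := hy j; rewrite lt_min => /andP[].
have h2 : `|b y k 0 - b x k 0| < e / 2.
  by apply: hu => j; have := hy j; rewrite lt_min => /andP[].
rewrite /= !mxE opprD addrACA; apply: le_lt_trans (ler_normD _ _) _.
by rewrite (splitr e) ltrD.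
Qed.

(** Dissipativity around [x] yields [- 2 eta |y - x|^2]. Half of it pays, by Young's inequality, for
    [dd x] and [b y], which are bounded independently of [y]. *)
Lemma drift_dissipative dd b sigma x : hypA dd b sigma ->
  exists C eta, [/\ 0 <= C, 0 < eta & forall y,
    \sum_k 2 * (y k 0 - x k 0) * (dd \+ b) y k 0 <= C - eta * \sum_k (y k 0 - x k 0) ^+ 2].
Proof.
move=> hA; have [eta eta0 hd] := hypA_dissipative hA; have [B hB] := hypA_b_bounded hA.
exists ((2 * enorm (dd x) ^+ 2 + 2 * B ^+ 2) / eta), eta; split=> //.
  by rewrite divr_ge0 ?(ltW eta0)// addr_ge0// mulr_ge0// sqr_ge0.
move=> y; have := hd y x.
rewrite enorm_sqr_col /dotp => h.
have hb : \sum_k b y k 0 ^+ 2 <= B ^+ 2.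
  by rewrite -enorm_sqr_col lerXn2r ?nnegrE ?enorm_ge0// (le_trans _ (hB y)) ?enorm_ge0.
have E k : (y - x) k 0 = y k 0 - x k 0 by rewrite !mxE.
have {}h : \sum_k (dd y - dd x) k 0 * (y k 0 - x k 0) <= - eta * \sum_k (y k 0 - x k 0) ^+ 2.
  by move: h; under eq_bigr do rewrite E; under [in X in _ <= X]eq_bigr do rewrite E.
apply: (@le_trans _ _ (\sum_k (2 * ((dd y - dd x) k 0 * (y k 0 - x k 0)) +
  (eta * (y k 0 - x k 0) ^+ 2 + (2 * dd x k 0 ^+ 2 + 2 * b y k 0 ^+ 2) / eta)))).
  apply: ler_sum => k _; rewrite !mxE.
  set z := y k 0 - x k 0; set p := dd x k 0; set q := b y k 0.
  have -> : 2 * z * (dd y k 0 + q) = 2 * ((dd y k 0 - p) * z) + 2 * z * (p + q) by ring.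
  rewrite lerD2l.
  have h1 : 2 * z * (p + q) <= eta * z ^+ 2 + (p + q) ^+ 2 / eta.
    rewrite -subr_ge0 (_ : _ - _ = (eta * z - (p + q)) ^+ 2 / eta); last by field; rewrite gt_eqF.
    by rewrite divr_ge0 ?sqr_ge0// ltW.
  apply: le_trans h1 _; rewrite lerD2l ler_pM2r ?invr_gt0//; exact: sqrD_le2.
rewrite !big_split/= -!mulr_sumr -mulr_suml big_split/= -!mulr_sumr -enorm_sqr_col.
have : (2 * enorm (dd x) ^+ 2 + 2 * \sum_k b y k 0 ^+ 2) / eta <=
  (2 * enorm (dd x) ^+ 2 + 2 * B ^+ 2) / eta by rewrite ler_pM2r ?invr_gt0// lerD2l ler_pM2l.
lra.
Qed.

Lemma phi_continuous (phi : 'cV[R]_d -> R) : (forall i, has_partial i phi) ->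
  (forall i, continuous (partial i phi)) -> continuous phi.
Proof.
move=> hp hc x; apply: near_at_continuous => e e0.
have [del del0 h] := C1_expand x hp hc ltr01.
pose M := \sum_i `|partial i phi x| + d%:R + 1.
have M0 : 0 < M by rewrite ltr_pwDr// addr_ge0// sumr_ge0.
have r0 : 0 < Num.min del (e / M) by rewrite lt_min del0 divr_gt0.
exists (Num.min del (e / M)) => // y hy.
have := mx_dist_lt r0 hy; rewrite distrC lt_min => /andP[y1 y2].
have hk := mx_norm_coord (y - x).
have := h (y - x) (fun i => le_trans (hk i) (ltW y1)).
rewrite subrKC mul1r => h1.
have h2 : \sum_i `|(y - x) i 0| <= d%:R * `|y - x|.
  by rewrite mulr_natl -[X in _ *+ X]card_ord -sumr_const; exact: ler_sum.
have h3 : `|\sum_i partial i phi x * (y - x) i 0| <= (\sum_i `|partial i phi x|) * `|y - x|.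
  rewrite mulr_suml; apply: le_trans (ler_norm_sum _ _ _) _; apply: ler_sum => i _.
  by rewrite normrM ler_wpM2l.
rewrite -[X in `|X|](subrK (\sum_i partial i phi x * (y - x) i 0)).
apply: le_lt_trans (ler_normD _ _) _.
apply: (@le_lt_trans _ _ (M * `|y - x|)); last by rewrite mulrC -ltr_pdivlMr.
by rewrite /M; have := normr_ge0 (y - x); lra.
Qed.

End coefficients.

Section stieltjes.
Context {R : realType}.
Variable K : cumulative R R.
Hypotheses (cK : continuous K) (K0 : forall t, t <= 0 -> K t = 0).

Lemma stieltjes_itv_oc (s t : R) : s <= t ->
  lebesgue_stieltjes_measure K `]s, t] = (K t - K s)%:E.
Proof.
move=> st; rewrite /lebesgue_stieltjes_measure /measure_extension/=.
rewrite measurable_mu_extE/= ?wlength_itv_bnd//; exact: is_ocitv.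
Qed.

(** There is no atom at 0: the interval is squeezed between []0, t]] and []-1, t]], which have the
    same mass because [K] vanishes up to time 0. *)
Lemma stieltjes_itv_cc t : 0 <= t -> lebesgue_stieltjes_measure K `[0%R, t] = (K t)%:E.
Proof.
move=> t0; have n1 : -1 <= t by lra.
have K1 : K (-1) = 0 by apply: K0; lra.
apply/eqP; rewrite eq_le; apply/andP; split.
  have <- : (K t - K (-1))%:E = (K t)%:E by rewrite K1 subr0.
  rewrite -stieltjes_itv_oc//; apply: le_measure; rewrite ?inE//=; try exact: measurable_itv.
  by apply: subset_itvr; rewrite bnd_simp; lra.
have <- : (K t - K 0)%:E = (K t)%:E by rewrite (K0 (lexx 0)) subr0.
rewrite -stieltjes_itv_oc//.
by apply: le_measure; rewrite ?inE//=; try exact: measurable_itv; apply: subset_itvr; rewrite bnd_simp.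
Qed.

End stieltjes.

(** * The discrete expansion along the reflected path *)

Section reflected_path.
Context {R : realType} {dO : measure_display} {Omega : measurableType dO}.
Variable P : probability Omega R.
Hypothesis hP : measure_is_complete P.
Context {d : nat}.
Variable W : R -> Omega -> 'cV[R]_d.
Hypothesis hW : brownian_motion P W.
Local Notation F := (bm_filtration P W).

(** All simple integrals vanish at time 0, so the approximation errors there are the constant second
    moment of [I 0], which must be their limit 0. *)
Lemma ito_start m (H : R -> Omega -> 'M[R]_(m, d)) I : ito_integral P F W H I ->
  {ae P, forall w, I 0 w = 0}.
Proof.
move=> hI; have mI r := ito_measurable hP hW hI r (lexx 0).
have mE : measurable_fun setT (fun w => (enorm (I 0 w) ^+ 2)%:E).
  apply/measurable_EFinP; under eq_fun do rewrite enorm_sqr_col.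
  by apply: measurable_sum => r; apply: measurable_funX; exact: mI.
have I0 : (\int[P]_w (enorm (I 0 w) ^+ 2)%:E = 0)%E.
  have [_ _ _ /(_ 0 (lexx 0))[S [_ hS]]] := hI.
  have E n : (\int[P]_w (enorm (simple_ito W (S n) 0 w - I 0 w) ^+ 2)%:E)%E =
      (\int[P]_w (enorm (I 0 w) ^+ 2)%:E)%E.
    apply: eq_integral => w _; rewrite (_ : simple_ito _ _ _ _ = 0) ?sub0r ?enorm_sqrN//.
    rewrite /simple_ito big1// => k _.
    by rewrite !(min_idPr _) ?sp_time_nneg// subrr mulmx0.
  move: hS; under eq_fun do rewrite E; move=> hS.
  by apply: (cvg_unique (@ereal_hausdorff R) _ hS); exact: cvg_cst.
have : ae_eq P setT (fun w => (enorm (I 0 w) ^+ 2)%:E) (cst 0%E).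
  apply/(ae_eq_integral_abs P measurableT mE); rewrite -[RHS]I0; apply: eq_integral => w _.
  by rewrite gee0_abs// lee_fin sqr_ge0.
apply: filterS => w /(_ Logic.I)[/eqP]; rewrite enorm_sqr_col psumr_eq0 => [/allP h|r _]; last exact: sqr_ge0.
by apply/colP => r; rewrite mxE; apply/eqP; rewrite -sqrf_eq0; apply: h; rewrite mem_index_enum.
Qed.

Variables (dd b : 'cV[R]_d -> 'cV[R]_d) (sigma : 'cV[R]_d -> 'M[R]_d).
Hypothesis hA : hypA dd b sigma.
Variables (G : set 'cV[R]_d) (phi : 'cV[R]_d -> R).
Hypothesis hG : hypG G phi.
Variables (x : 'cV[R]_d) (hx : closure G x).
Variables (X : R -> Omega -> 'cV[R]_d) (K : Omega -> cumulative R R).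
Hypothesis hX : reflected_sde P W (dd \+ b) sigma G phi x X K.

Lemma within_path w T (h : 'cV[R]_d -> R) : continuous h ->
  {within `[0, T], continuous (fun t => h (X t w))}.
Proof.
move=> ch; have cX : {within `[0, T], continuous (X ^~ w)}.
  have cX : continuous_process X := rsde_X_continuous hX.
  apply: continuous_subspaceW (cX w) => r /=.
  by rewrite !in_itv/= andbT => /andP[].
by move=> r; apply: (cvg_comp (X ^~ w) h (cX r)); exact: ch.
Qed.

Lemma col_sumE (y c : 'cV[R]_d) (f g : 'I_d -> R) k :
  (y + \col_i f i + c + \col_i g i) k 0 - y k 0 = f k + c k 0 + g k.
Proof. by rewrite !mxE; ring. Qed.

Lemma reflected_path_defect : exists C eta I, [/\ 0 <= C, 0 < eta,
  ito_integral P F W (fun t w => sigma (X t w)) I,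
  {ae P, forall w, X 0 w = x} &
  {ae P, forall w, forall T eps, 0 < T -> 0 < eps -> exists2 del, 0 < del &
  forall N t, is_grid T N t -> (forall i, (i < N)%N -> t i.+1 - t i <= del) ->
  \sum_(i < N) Num.max (lyap_defect t (fun i w k => X (t i) w k 0 - x k 0)
     (fun i w k => I (t i.+1) w k 0 - I (t i) w k 0) C eta i w) 0 <= eps}].
Proof.
have [C [eta [C0 eta0 hf]]] := drift_dissipative x hA.
have [I hI heq] := rsde_equation hX.
have [hp hc _ _] := hypG_C2 hG.
have K0 w t (h : t <= 0) : K w t = 0 := rsde_K_start hX w h.
exists C, eta, I; split=> //.
  have := ito_start hI; apply: filterS2 heq => w /(_ 0 (lexx 0)) -> I0.
  rewrite I0; apply/colP => k; apply/eqP; rewrite -subr_eq0 col_sumE mxE addr0 set_itv1.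
  rewrite (_ : \int[lebesgue_measure]_(s in _) _ = 0) ?add0r; last first.
    by rewrite /Rintegral integral_set1.
  rewrite (_ : \int[_]_(s in _) _ = 0) ?eqxx//.
  rewrite /Rintegral null_set_integral//.
  - exact: measurable_fun_set1.
  - have := stieltjes_itv_cc (K0 w) (lexx 0).
    by rewrite set_itv1 K0.
apply: filterS2 heq (rsde_K_boundary hX) => w hw hK T eps T0 eps0.
pose mu : {measure set (measurableTypeR R) -> \bar R} := lebesgue_stieltjes_measure (K w).
pose beta r : R := \1_(boundary G) (X r w).
have mass (t : R) : 0 <= t -> mu `[0%R, t]%classic = (K w t)%:E.
  by move=> t0; exact: (stieltjes_itv_cc (K0 w) t0).
have bdE : boundary G = [set y | phi y = 0] := hypG_boundary hG.
have mb : measurable_fun (`[0, T]%classic : set (measurableTypeR R)) beta.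
  (* The boundary is a level set of [phi], which makes [beta] a Borel function of a continuous
     path. *)
  have E : beta = (fun r => \1_([set 0 : R]) (phi (X r w))).
    by apply/funext => r; rewrite /beta !indicE bdE; congr (_ %:R); apply/idP/idP; rewrite !inE.
  have m1 : measurable_fun [set: measurableTypeR R] (\1_([set 0 : R]) : R -> R).
    by apply: measurable_indic; exact: measurable_set1.
  have m2 : measurable_fun (`[0, T]%classic : set (measurableTypeR R)) (fun r => phi (X r w)).
    by apply: within_measurable; apply: within_path; exact: phi_continuous.
  by rewrite E; exact: (measurableT_comp m1 m2).
have b01 r : beta r = 0 \/ beta r = 1.
  by rewrite /beta indicE; case: (_ \in _); [right|left].
have := @path_defect_small R d T T0 (fun k r => X r w k 0 - x k 0)
  (fun k r => (dd \+ b) (X r w) k 0) (fun k r => grad phi (X r w) k 0) (fun k r => I r w k 0)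
  mu beta C eta.
move=> H; have {H} := H _ _ _ _ mb b01 _ _ (ltW eta0) _ _ eps eps0.
apply.
- move=> k; apply: (within_path (h := fun y => y k 0 - x k 0)) => y.
  apply: near_at_continuous => e e0; exists e => // v hv.
  by rewrite opprB addrA subrK.
- move=> k; exact: (within_path (drift_continuous hA)).
- move=> k; apply: (within_path (h := fun y => grad phi y k 0)).
  have -> : (fun y => grad phi y k 0) = partial k phi by apply/funext => y; rewrite mxE.
  exact: hc.
- by rewrite mass ?ltry// ltW.
- by move=> t /andP[t0 _]; rewrite mass//=; rewrite [RHS](hK t t0).
- by move=> k t /andP[t0 _]; rewrite (hw t t0) col_sumE.
- by move=> r _; exact: hf.
(* The supporting half-space at the boundary point [X r w], tested on the starting point [x]. *)
- move=> r /andP[r0 _]; rewrite /beta indicE => bd.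
  have {bd} : boundary G (X r w).
    by move: bd; case: (boolP (X r w \in boundary G)) => [/[!inE]//|_ /esym/eqP]; rewrite oner_eq0.
  move=> /(domain_normal hG) /(_ hx); rewrite -oppr_le0 -sumrN.
  by under eq_bigr do rewrite -mulrN opprB mulrC; under [X in _ -> X <= 0]eq_bigr do rewrite mxE.
Qed.

End reflected_path.

(** * Removing the drift of the backward equation *)

Section drift_density.
Context {R : realType} {dO : measure_display} {Omega : measurableType dO}.
Variable P : probability Omega R.
Hypothesis hP : measure_is_complete P.
Context {d : nat}.
Variable W : R -> Omega -> 'cV[R]_d.
Hypothesis hW : brownian_motion P W.
Local Notation fmeas := (fmeas P W).
Local Notation dW := (dW W).

Variables (T : R) (N : nat) (t : nat -> R) (g : is_grid T N t).
Variables (s : nat -> 'I_d -> Omega -> R) (B M : R).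
Hypotheses (ms : forall i j, (i < N)%N -> fmeas (t i) (s i j))
  (sB : forall i j w, `|s i j w| <= B) (M0 : 0 <= M).

Local Notation dt i := (t i.+1 - t i).
Local Notation kappa i := (incr_kappa (t i) (t i.+1)).
Local Notation sgn i := (incr_sign W (t i) (t i.+1)).

Definition coef_norm i w := Num.sqrt (\sum_j s i j w ^+ 2).
(* Division by 0 gives 0, so there is no tilt where the coefficients vanish. *)
Definition tilt_coef i j w := M * dt i / kappa i * (s i j w / coef_norm i w).
Definition tilt i w := \sum_j tilt_coef i j w * sgn i j w.
(** The discrete counterpart of the integral of [s] against the process that Girsanov's theorem
    would turn into a Brownian motion; the tilt is designed to centre it. *)
Definition drift_sum n w := incr_sum W t s 0 n w - M * \sum_(i < n) coef_norm i w * dt i.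

Definition kappa0 : R := expR (- 2) * normal_peak 1.
Definition tilt_bound : R := d%:R * M / kappa0.

Hypothesis small : forall i, (i < N)%N -> tilt_bound ^+ 2 * dt i <= 1.

Let tt i (iN : (i < N)%N) := grid_step g iN.

Lemma kappa0_gt0 : 0 < kappa0.
Proof. by rewrite mulr_gt0 ?expR_gt0// normal_peak_gt0// oner_neq0. Qed.

Let dt0 i : (i < N)%N -> 0 < dt i.
Proof. by move=> /tt /andP[_]; rewrite subr_gt0. Qed.

Let kap_ge i : (i < N)%N -> kappa0 * Num.sqrt (dt i) <= kappa i.
Proof. by move=> /tt/incr_kappa_ge. Qed.

Let kap_gt0 i : (i < N)%N -> 0 < kappa i.
Proof.
by move=> iN; apply: lt_le_trans (kap_ge iN); rewrite mulr_gt0 ?kappa0_gt0// sqrtr_gt0 dt0.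
Qed.

Let sn_ge0 i w : 0 <= coef_norm i w.
Proof. exact: sqrtr_ge0. Qed.

Let sn_sqr i w : coef_norm i w ^+ 2 = \sum_j s i j w ^+ 2.
Proof. by rewrite sqr_sqrtr// sumr_ge0// => j _; rewrite sqr_ge0. Qed.

Let s_le i j w : `|s i j w| <= coef_norm i w.
Proof.
rewrite -(ler_pXn2r (n := 2)) ?nnegrE// sn_sqr real_normK ?num_real//.
by rewrite (bigD1 j)//= lerDl sumr_ge0// => k _; rewrite sqr_ge0.
Qed.

Let sdiv i w : \sum_j s i j w / coef_norm i w * s i j w = coef_norm i w.
Proof.
have [->|sn0] := eqVneq (coef_norm i w) 0.
  by rewrite big1// => j _; rewrite invr0 mulr0 mul0r.
rewrite -[RHS](mulfK sn0) -expr2 sn_sqr mulr_suml; apply: eq_bigr => j _.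
by rewrite mulrAC expr2.
Qed.

(** The entries of [s / |s|] are at most 1, and [kappa i >= kappa0 * sqrt dt] leaves one factor sqrt
    dt out of [dt]. Summing over the [d] coordinates gives [tilt_bound]. *)
Lemma tilt_coef_bounded i j w : (i < N)%N -> `|tilt_coef i j w| <= M / kappa0 * Num.sqrt (dt i).
Proof.
move=> iN; have k0 := kappa0_gt0; have q0 : 0 < Num.sqrt (dt i) by rewrite sqrtr_gt0 dt0.
have h1 : 0 <= M * dt i / kappa i.
  by rewrite divr_ge0 ?mulr_ge0// ltW ?dt0 ?kap_gt0.
rewrite normrM ger0_norm//.
apply: (@le_trans _ _ (M * dt i / kappa i)).
  rewrite ler_piMr// normrM normfV (ger0_norm (sn_ge0 _ _)).
  have [->|sn0] := eqVneq (coef_norm i w) 0; first by rewrite invr0 mulr0.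
  by rewrite ler_pdivrMr ?mul1r ?s_le// lt_neqAle eq_sym sn0 sn_ge0.
rewrite ler_pdivrMr ?kap_gt0//.
apply: (@le_trans _ _ (M / kappa0 * Num.sqrt (dt i) * (kappa0 * Num.sqrt (dt i)))).
  rewrite le_eqVlt; apply/orP; left; apply/eqP.
  rewrite -{1}(@sqr_sqrtr _ (dt i)) ?ltW ?dt0//; field; exact: lt0r_neq0.
by rewrite ler_wpM2l ?kap_ge// mulr_ge0 ?divr_ge0 // ltW.
Qed.

Let m_sn i : (i < N)%N -> fmeas (t i) (coef_norm i).
Proof.
move=> iN; have mq : measurable_fun [set: R] (@Num.sqrt R).
  by apply: continuous_measurable_fun; exact: sqrt_continuous.
apply: (measurableT_comp mq).
by apply: measurable_sum => j; apply: measurable_funX; exact: ms.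
Qed.

Let m_tc i j : (i < N)%N -> fmeas (t i) (tilt_coef i j).
Proof.
move=> iN; apply: measurable_funM; first exact: measurable_cst.
apply: measurable_funM; first exact: ms.
under eq_fun do rewrite -powR_inv1//.
by apply: (measurableT_comp (measurable_powR _)) => //; exact: m_sn.
Qed.

Let m_sgn i j : (i < N)%N -> fmeas (t i.+1) (sgn i j).
Proof.
move=> iN; have /andP[t0 t1] := tt iN; apply: measurable_funB; last exact: measurable_cst.
apply: (measurableT_comp (measurable_indic _)) => //.
by apply: fmeas_dW => //; exact: ltW.
Qed.

Let tc_rint i j xi : (i < N)%N -> rint P xi -> rint P (fun w => tilt_coef i j w * xi w).
Proof.
move=> iN; apply: (rintM_bdd (M := M / kappa0 * Num.sqrt (dt i))).
  exact: (fmeas_measurable hP hW (m_tc j iN)).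
by move=> w; exact: tilt_coef_bounded.
Qed.

Lemma tilt_density : density_incr P W N t tilt tilt_bound.
Proof.
split=> //.
- move=> i iN; apply: measurable_sum => j; apply: measurable_funM; last exact: m_sgn.
  by apply: fmeas_le (m_tc j iN); case/andP: (tt iN) => _ /ltW.
- move=> i w iN; have q := sqr_sqrtr (ltW (dt0 iN)).
  have h : `|tilt i w| <= tilt_bound * Num.sqrt (dt i).
    apply: le_trans (ler_norm_sum _ _ _) _.
    have -> : tilt_bound * Num.sqrt (dt i) = \sum_(j < d) M / kappa0 * Num.sqrt (dt i).
      by rewrite sumr_const card_ord -[RHS]mulr_natl /tilt_bound !mulrA.
    apply: ler_sum => j _; rewrite normrM -[leRHS]mulr1.
    by apply: ler_pM => //; [exact: tilt_coef_bounded|exact: incr_sign_le].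
  rewrite -real_normK ?num_real// -[leRHS](_ : (tilt_bound * Num.sqrt (dt i)) ^+ 2 = _).
    rewrite ler_pXn2r// nnegrE; exact: le_trans (normr_ge0 _) h.
  by rewrite exprMn q.
- move=> i xi iN mxi ixi.
  have H j := incr_sign_mean hP hW (tt iN) j
    (measurable_funM (m_tc j iN) mxi : fmeas (t i) _) (tc_rint j iN ixi).
  have E w : xi w * tilt i w = \sum_j sgn i j w * (tilt_coef i j w * xi w).
    by rewrite mulr_sumr; apply: eq_bigr => j _; ring.
  under eq_fun do rewrite E.
  rewrite rE_sum => [|j]; last by case: (H j).
  by rewrite big1// => j _; case: (H j).
Qed.

Local Notation D := (density tilt).

Let sqW i j : (i < N)%N -> sqint P (dW (t i) (t i.+1) j).
Proof.
move=> iN; have /andP[t0 t1] := tt iN; split.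
  by apply: (measurable_dW hP hW); rewrite t0 ltW.
have [+ _] := incr_var hP hW (tt iN) j (measurable_cst (1 : R)) (rint_cst P 1) (fun=> ler01).
by under eq_fun do rewrite mulr1.
Qed.

Let sn_bdd : exists2 B', 0 <= B' & forall i w, `|coef_norm i w| <= B'.
Proof.
exists (Num.sqrt (\sum_(j < d) B ^+ 2)) => // i w.
rewrite ger0_norm// ler_sqrt ?sumr_ge0// => [|j _]; last exact: sqr_ge0.
apply: ler_sum => j _; rewrite -(real_normK (num_real (s i j w))).
rewrite ler_pXn2r// nnegrE; exact: le_trans (sB i j w).
Qed.

Let rint_sn i xi : (i < N)%N -> rint P xi -> rint P (fun w => coef_norm i w * xi w).
Proof.
move=> iN; have [B' _ hB'] := sn_bdd.
apply: (rintM_bdd (M := B')) => //; exact: (fmeas_measurable hP hW (m_sn iN)).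
Qed.

Let cost i w := \sum_j s i j w * dW (t i) (t i.+1) j w.

Let sq_cost i : (i < N)%N -> sqint P (cost i).
Proof.
move=> iN; apply: sqint_sum => j; apply: (sqintM_bdd (M := B)) => //; last exact: sqW.
exact: (fmeas_measurable hP hW (ms j iN)).
Qed.

Let s_rint i j xi : (i < N)%N -> rint P xi -> rint P (fun w => s i j w * xi w).
Proof.
move=> iN; apply: (rintM_bdd (M := B)) => //; exact: (fmeas_measurable hP hW (ms j iN)).
Qed.

(* [sign j] is orthogonal to [dW k] for [j != k] and has covariance [kappa i] with [dW j]:
   the tilt produces exactly the drift [M |s i|]. *)
Lemma rE_density_cost i : (i < N)%N ->
  rE P (fun w => D i.+1 w * cost i w) = M * dt i * rE P (fun w => D i w * coef_norm i w).
Proof.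
move=> iN; have iN' := ltnW iN.
have mD := fmeas_density g tilt_density iN'.
have iD : rint P (D i) := sqint_rint (sqint_density hP hW g tilt_density iN').
have H1 j := incr_mean hP hW (tt iN) j (measurable_funM (ms j iN) mD : fmeas (t i) _)
  (s_rint j iN iD).
pose xi j k w := tilt_coef i j w * (s i k w * D i w).
have mxi j k : fmeas (t i) (xi j k).
  by apply: measurable_funM; [exact: m_tc|apply: measurable_funM => //; exact: ms].
have ixi j k : rint P (xi j k) by apply: tc_rint => //; exact: s_rint.
have H2 j k : rint P (fun w => sgn i j w * dW (t i) (t i.+1) k w * xi j k w) /\
    rE P (fun w => sgn i j w * dW (t i) (t i.+1) k w * xi j k w) =
      (j == k)%:R * (kappa i * rE P (xi j k)).
  have [->|jk] := eqVneq j k; first by rewrite mul1r; exact: (incr_sign_diag hP hW (tt iN) k (mxi _ _) (ixi _ _)).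
  by rewrite mul0r; exact: (incr_sign_offdiag hP hW (tt iN) jk (mxi _ _) (ixi _ _)).
have E w : D i.+1 w * cost i w = \sum_j dW (t i) (t i.+1) j w * (s i j w * D i w) +
    \sum_j \sum_k sgn i j w * dW (t i) (t i.+1) k w * xi j k w.
  rewrite densityS mulrDr mulr1 mulrDl; congr (_ + _).
    by rewrite mulr_sumr; apply: eq_bigr => j _; ring.
  rewrite [tilt _ _]/tilt mulr_sumr mulr_suml; apply: eq_bigr => j _.
  by rewrite mulr_sumr; apply: eq_bigr => k _; rewrite /xi; ring.
under eq_fun do rewrite E.
rewrite rED; last 2 first.
- by apply: rint_sum => j; case: (H1 j).
- by apply: rint_sum => j; apply: rint_sum => k; case: (H2 j k).
rewrite rE_sum => [|j]; last by case: (H1 j).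
rewrite big1 ?add0r => [|j _]; last by case: (H1 j).
rewrite rE_sum => [|j]; last by apply: rint_sum => k; case: (H2 j k).
rewrite (eq_bigr (fun j => rE P (fun w => kappa i * xi j j w))); last first.
  move=> j _; rewrite rE_sum => [|k]; last by case: (H2 j k).
  rewrite (bigD1 j)//= big1 ?addr0 => [|k kj].
    by rewrite (H2 j j).2 eqxx mul1r rEZ.
  by rewrite (H2 j k).2 eq_sym (negbTE kj) mul0r.
rewrite -rE_sum => [|j]; last exact: rintZ.
rewrite -rEZ; last by under eq_fun do rewrite mulrC; exact: rint_sn.
congr rE; apply/funext => w; rewrite -[in RHS]sdiv !mulr_sumr; apply: eq_bigr => j _.
rewrite /xi /tilt_coef; have := lt0r_neq0 (kap_gt0 iN).
by move: (s i j w / coef_norm i w) (kappa i) => q k k0; field.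
Qed.

Let drift_sumS n w : drift_sum n.+1 w =
  drift_sum n w + (cost n w - M * (coef_norm n w * dt n)).
Proof. by rewrite /drift_sum /incr_sum big_nat_recr//= big_ord_recr/= /cost; ring. Qed.

Let fm_drift n : (n <= N)%N -> fmeas (t n) (drift_sum n) /\ rint P (drift_sum n).
Proof.
move=> nN; split.
  apply: measurable_funB.
    by apply: (fmeas_incr_sum g) => //; rewrite leq0n.
  apply: measurable_funM; first exact: measurable_cst.
  apply: measurable_sum => i; apply: measurable_funM; last exact: measurable_cst.
  have iN : (i < N)%N := leq_trans (ltn_ord i) nN.
  by apply: fmeas_le (m_sn iN); apply: (grid_le g) => //; exact: ltnW.
apply: rintB.
  by apply: sqint_rint; apply: (sqint_incr_sum hP hW g (M := B)) => //; rewrite leq0n.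
apply: rintZ; apply: rint_sum => i.
have iN : (i < N)%N := leq_trans (ltn_ord i) nN.
by apply: rint_sn => //; exact: rint_cst.
Qed.

Lemma rint_density_drift n : (n <= N)%N -> rint P (fun w => D n w * drift_sum n w).
Proof.
by move=> nN; apply: (rint_density hP hW g tilt_density) => //; case: (fm_drift nN).
Qed.

(** The past sum does not see the new density factor, and on the new cell the drift created by the
    tilt cancels [M |s| dt] exactly. *)
Lemma rE_density_drift n : (n <= N)%N -> rE P (fun w => D n w * drift_sum n w) = 0.
Proof.
elim: n => [|n IH] nN.
  rewrite (_ : (fun w => _) = cst 0) ?rE_cst//; apply/funext => w.
  by rewrite /drift_sum /incr_sum big_geq// big_ord0 mulr0 subr0 mulr0.
have nN' := ltnW nN; have [m1 i1] := fm_drift nN'.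
have isn : rint P (coef_norm n) by move: (rint_sn nN (rint_cst P 1)); under eq_fun do rewrite mulr1.
have iDS f : rint P f -> rint P (fun w => D n.+1 w * f w).
  exact: (rint_density hP hW g tilt_density nN).
have E w : D n.+1 w * drift_sum n.+1 w = D n.+1 w * drift_sum n w +
    (D n.+1 w * cost n w - M * dt n * (D n.+1 w * coef_norm n w)).
  by rewrite drift_sumS; ring.
under eq_fun do rewrite E.
have ic := sqint_rint (sq_cost nN).
rewrite rED; [|exact: iDS|by apply: rintB; [exact: iDS|apply: rintZ; exact: iDS]].
rewrite rEB; [|exact: iDS|by apply: rintZ; exact: iDS].
rewrite rEZ; last exact: iDS.
rewrite rE_density_cost// (density_martingale1 hP hW g tilt_density nN m1 i1).
by rewrite (density_martingale1 hP hW g tilt_density nN (m_sn nN) isn) IH// subrr addr0.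
Qed.

End drift_density.

(** * Measurability of the driver along processes *)

Section borel_composition.
Context {R : realType} {d : nat} {dT : measure_display} {T : measurableType dT}.
Local Notation E := ('cV[R]_d * 'rV[R]_d)%type.

Let rat_near (a e : R) : 0 < e -> exists q : rat, `|a - ratr q| < e.
Proof.
move=> e0; have [|q] := @rat_in_itvoo R (a - e) (a + e); first by lra.
by rewrite in_itv/= => /andP[h1 h2]; exists q; rewrite ltr_norml; lra.
Qed.

(* The product Borel structure is only known on coordinates, so opens are exhausted by
   countably many boxes with rational centres. *)
Lemma measurable_fun_open_pair (D : set T) (u : T -> 'cV[R]_d) (v : T -> 'rV[R]_d) :
  measurable D ->
  (forall i, measurable_fun D (fun x => u x i 0)) ->
  (forall i, measurable_fun D (fun x => v x 0 i)) ->
  measurable_fun D ((fun x => (u x, v x)) : T -> g_sigma_algebraType (@open E)).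
Proof.
move=> mD mu mv; apply: (@measurability _ _ T (g_sigma_algebraType (@open E)) D
  (fun x => (u x, v x)) (@open E)) => //.
move=> _ [U oU <-].
pose I := ({ffun 'I_d -> rat} * {ffun 'I_d -> rat} * nat)%type.
pose r (k : I) : R := k.2.+1%:R^-1.
pose box (k : I) : set E := [set p : E | forall i : 'I_d,
  `|p.1 i 0 - ratr (k.1.1 i)| < r k /\ `|p.2 0 i - ratr (k.1.2 i)| < r k].
pose F k := if `[< box k `<=` U >] then D `&` (fun x => (u x, v x)) @^-1` box k else set0.
have -> : D `&` (fun x => (u x, v x)) @^-1` U = \bigcup_k F k.
  apply/seteqP; split=> x; last first.
    by move=> [k _]; rewrite /F; case: asboolP => // kU [Dx /kU].
  move=> [Dx Ux]; have : nbhs (u x, v x) U by exact: open_nbhs_nbhs.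
  move=> /nbhs_ballP[e e0 he].
  have e2 : 0 < e / 2 by rewrite divr_gt0.
  (* Two points of a box of radius [n.+1%:R^-1] differ by less than twice this radius in each
     coordinate, so the box lies in the ball of radius [e]. *)
  have [n hn] : exists n : nat, n.+1%:R^-1 < e / 2.
    near \oo => n; exists n; near: n.
    exact: (near_infty_natSinv_lt (PosNum e2)).
  have n0 : 0 < n.+1%:R^-1 :> R by rewrite invr_gt0.
  pose q1 := [ffun i => projT1 (cid (rat_near (u x i 0) n0))].
  pose q2 := [ffun i => projT1 (cid (rat_near (v x 0 i) n0))].
  have h1 i : `|u x i 0 - ratr (q1 i)| < n.+1%:R^-1 by rewrite ffunE; case: cid.
  have h2 i : `|v x 0 i - ratr (q2 i)| < n.+1%:R^-1 by rewrite ffunE; case: cid.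
  exists (q1, q2, n) => //; rewrite /F; case: asboolP => [_|[]]; first by split.
  have tri (a b c : R) : `|a - c| < n.+1%:R^-1 -> `|b - c| < n.+1%:R^-1 -> `|a - b| < e.
    by move: (n.+1%:R^-1) hn => z hz; rewrite !ltr_norml; lra.
  move=> p hp; apply: he; split; split=> // i j; rewrite ?(ord1 i) ?(ord1 j).
    exact: tri (h1 i) (hp i).1.
  exact: tri (h2 j) (hp j).2.
apply: countable_bigcupT_measurable => [|k]; first exact: countableP.
rewrite /F; case: asboolP => _; last exact: measurable0.
have -> : D `&` (fun x => (u x, v x)) @^-1` box k = D `&` \bigcap_(i in [set: 'I_d])
   ((D `&` (fun x => u x i 0) @^-1` (ball (ratr (k.1.1 i) : R) (r k))) `&`
    (D `&` (fun x => v x 0 i) @^-1` (ball (ratr (k.1.2 i) : R) (r k)))).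
  apply/seteqP; split=> x [Dx h]; split=> //.
    move=> i _; have [h1 h2] := h i.
    by split; split=> //; rewrite /= /ball/= distrC.
  move=> i; have [[_ +] [_ +]] := h i Logic.I.
  by rewrite /= /ball/= distrC => h1; rewrite distrC.
apply: measurableI => //; apply: fin_bigcap_measurable => // i _.
by apply: measurableI; [apply: mu|apply: mv] => //; exact: measurable_ball.
Unshelve. all: by end_near. Qed.

Lemma measurable_hypP_comp psi (D : set T) u v : measurable D ->
  hypP psi ->
  (forall i, measurable_fun D (fun x : T => (u x : 'cV[R]_d) i 0)) ->
  (forall i, measurable_fun D (fun x => (v x : 'rV[R]_d) 0 i)) ->
  measurable_fun D (fun x => psi (u x) (v x)).
Proof.
move=> mD [mpsi _] hu hv; have := measurable_fun_open_pair mD hu hv.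
exact: (measurableT_comp mpsi).
Qed.

End borel_composition.

Section euclidean_norm.
Context {R : realType} {m n : nat}.
Implicit Types A B : 'M[R]_(m, n).

(** The inequality [|A + B|^2 <= (1 + k) |A|^2 + (1 + 1/k) |B|^2] is optimal at [k = |B| / |A|]. If
    one norm vanishes, [k] is sent to infinity or to 0 instead. *)
Lemma enormD A B : enorm (A + B) <= enorm A + enorm B.
Proof.
have AB0 : 0 <= enorm A + enorm B by rewrite addr_ge0 ?enorm_ge0.
rewrite -(ler_pXn2r (n := 2)) ?nnegrE ?enorm_ge0//.
have key k : 0 < k -> enorm (A + B) ^+ 2 <= (1 + k) * enorm A ^+ 2 + (1 + k^-1) * enorm B ^+ 2.
  move=> k0; rewrite !enorm_sqr !mulr_sumr -big_split/=; apply: ler_sum => i _.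
  rewrite !mulr_sumr -big_split/=; apply: ler_sum => j _; rewrite !mxE.
  rewrite -subr_ge0 (_ : _ - _ = (k * A i j - B i j) ^+ 2 / k).
    by rewrite divr_ge0 ?sqr_ge0 ?ltW.
  by field; rewrite gt_eqF.
have [A0|A0] := eqVneq (enorm A) 0.
  rewrite A0 add0r; apply/ler_addgt0Pr => e e0.
  have B1 : 0 < enorm B ^+ 2 + 1 by rewrite ltr_wpDl ?sqr_ge0.
  have := key ((enorm B ^+ 2 + 1) / e); rewrite divr_gt0// A0 expr0n mulr0 add0r => /(_ isT).
  rewrite invf_div mulrDl mul1r => /le_trans; apply; rewrite lerD2l -mulrA ler_piMr ?(ltW e0)//.
  by rewrite mulrC ler_pdivrMr ?mul1r// lerDl.
have [B0|B0] := eqVneq (enorm B) 0.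
  rewrite B0 addr0; apply/ler_addgt0Pr => e e0.
  have B1 : 0 < enorm A ^+ 2 + 1 by rewrite ltr_wpDl ?sqr_ge0.
  have := key (e / (enorm A ^+ 2 + 1)); rewrite divr_gt0// B0 expr0n mulr0 addr0 => /(_ isT).
  rewrite mulrDl mul1r => /le_trans; apply; rewrite lerD2l -mulrA ler_piMr ?(ltW e0)//.
  by rewrite mulrC ler_pdivrMr ?mul1r// lerDl.
have A1 : 0 < enorm A by rewrite lt_neqAle eq_sym A0 enorm_ge0.
have B1 : 0 < enorm B by rewrite lt_neqAle eq_sym B0 enorm_ge0.
have := key (enorm B / enorm A) (divr_gt0 B1 A1); move/le_trans; apply.
by rewrite le_eqVlt; apply/orP; left; apply/eqP; field; rewrite A0 B0.
Qed.

End euclidean_norm.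

(** * Pathwise estimate of the difference of the drivers *)

Section drift_integral.
Context {R : realType}.
Local Notation RT := (measurableTypeR R).
Local Notation leb := (@lebesgue_measure R).
Variables (T : R) (p p' n q y : R -> R) (M : R).
Hypotheses (T0 : 0 < T) (M0 : 0 <= M).
Local Notation A := (`[0%R, T]%classic : set RT).
Hypotheses (ip : leb.-integrable A (EFin \o p)) (ip' : leb.-integrable A (EFin \o p'))
  (i_n : leb.-integrable A (EFin \o n)) (iq : leb.-integrable A (EFin \o q)).
Hypotheses (hpp : forall r, `|p r - p' r| <= M * (n r + y r)) (hy : forall r, y r ^+ 2 <= q r).

(** [n] is the distance of the two step processes, kept exactly because the tilt will cancel it; [y]
    is the approximation remainder, dominated by its square bound [q]. The density value [D] is
    inside the estimate so that Young's inequality can separate it from [y]. *)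
Lemma drift_integral_le D del : 0 <= D -> 0 < del ->
  D * (\int[leb]_(r in A) p r - \int[leb]_(r in A) p' r) <=
  M * (D * \int[leb]_(r in A) n r + (del * T * D ^+ 2 + del^-1 * \int[leb]_(r in A) q r)).
Proof.
move=> D0 del0.
have mA : measurable A by exact: measurable_itv.
have muA : (leb A < +oo)%E by rewrite lebesgue_measure_itv/= lte_fin T0 -EFinB ltry.
have TE : fine (leb A) = T by rewrite lebesgue_measure_itv/= lte_fin T0 -EFinB/= subr0.
have iZ k f : leb.-integrable A (EFin \o f) -> leb.-integrable A (EFin \o (fun r => k * f r)).
  by move=> i; apply: (eq_integrable mA _ _ _ (integrableZl mA k i)) => r _.
have iD f h : leb.-integrable A (EFin \o f) -> leb.-integrable A (EFin \o h) ->
    leb.-integrable A (EFin \o (fun r => f r + h r)).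
  by move=> i j; apply: (eq_integrable mA _ _ _ (integrableD mA i j)) => r _.
have ic k : leb.-integrable A (EFin \o cst k).
  apply: measurable_bounded_integrable => //.
  by exists `|k|; split=> [|z kz r _ /=]; [exact: num_real|exact: ltW].
have ipp : leb.-integrable A (EFin \o (fun r => p r + -1 * p' r)) by apply: (iD _ _) => //; exact: iZ.
have -> : \int[leb]_(r in A) p r - \int[leb]_(r in A) p' r = \int[leb]_(r in A) (p r + -1 * p' r).
  by rewrite RintegralD//; [rewrite RintegralZl// mulN1r|exact: iZ].
have -> : M * (D * \int[leb]_(r in A) n r + (del * T * D ^+ 2 + del^-1 * \int[leb]_(r in A) q r)) =
   \int[leb]_(r in A) (M * (D * n r + (cst (del * D ^+ 2) r + del^-1 * q r))).
  rewrite RintegralZl//; last by apply: (iD _ _); [exact: iZ|apply: (iD _ _) => //; exact: iZ].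
  rewrite RintegralD//; [|exact: iZ|by apply: (iD _ _) => //; exact: iZ].
  rewrite RintegralD//; last exact: iZ.
  rewrite [X in _ = _ * (_ + (X + _))](Rintegral_cst leb mA) TE.
  by rewrite !RintegralZl//; congr (_ * (_ + (_ + _))); ring.
rewrite -RintegralZl//; apply: le_Rintegral => //.
- exact: iZ.
- by apply: (iZ _ _); apply: (iD _ _); [exact: iZ|apply: (iD _ _) => //; exact: iZ].
move=> r _; rewrite mulN1r.
apply: (@le_trans _ _ (D * (M * (n r + y r)))).
  by apply: ler_wpM2l => //; apply: le_trans (hpp r); exact: ler_norm.
rewrite mulrCA; apply: ler_wpM2l => //; rewrite mulrDr lerD2l.
apply: (@le_trans _ _ (del * D ^+ 2 + del^-1 * y r ^+ 2)).
  rewrite -subr_ge0.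
  have -> : del * D ^+ 2 + del^-1 * y r ^+ 2 - D * y r =
     ((del * D - y r) ^+ 2 + (del * D) ^+ 2 + y r ^+ 2) / (2 * del).
    by field; rewrite gt_eqF.
  by rewrite divr_ge0 ?addr_ge0 ?sqr_ge0// mulr_ge0// ltW.
by rewrite lerD2l ler_pM2l ?invr_gt0.
Qed.

End drift_integral.

Section path_integrals.
Context {R : realType} {dO : measure_display} {Omega : measurableType dO}.
Variable P : probability Omega R.
Local Notation leb := (@lebesgue_measure R).

Definition tint (T : R) (h : R -> Omega -> R) (w : Omega) : R :=
  \int[leb]_(s in `[0%R, T]) h s w.

Definition tintegrable (T : R) (h : R -> Omega -> R) (w : Omega) : Prop :=
  leb.-integrable (`[0%R, T]%classic : set (measurableTypeR R)) (EFin \o h^~ w).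

Lemma jmeas_tintegrable T g : jmeas T g -> (forall s w, 0 <= g s w) ->
  (\int[P]_w \int[leb]_(s in `[0%R, T]) (g s w)%:E < +oo)%E ->
  [/\ {ae P, forall w, tintegrable T g w}, rint P (tint T g) &
    (rE P (tint T g))%:E = (\int[P]_w \int[leb]_(s in `[0%R, T]) (g s w)%:E)%E].
Proof.
move=> mg g0 fin.
have E0 w : (0 <= \int[leb]_(s in `[0%R, T]) (g s w)%:E)%E.
  by apply: integral_ge0 => s _; rewrite lee_fin.
have [i e ae] := fine_rint (jmeas_integral mg g0) E0 fin.
split=> //; apply: filterS ae => w hw.
apply/integrableP; split; first by apply/measurable_EFinP; exact: jmeas_path.
by under eq_integral do rewrite /= ger0_norm//; rewrite hw ltry.
Qed.

End path_integrals.

Lemma sqr_le_pow4 (R : realType) (z : R) : z ^+ 2 <= 1 + z ^+ 4.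
Proof.
have : 0 <= (z ^+ 2 - 2^-1) ^+ 2 by exact: sqr_ge0.
by have -> : (z ^+ 2 - 2^-1) ^+ 2 = z ^+ 4 - z ^+ 2 + 4^-1 by [field]; lra.
Qed.

(** * The difference of the two equations under the new density *)

Section girsanov.
Context {R : realType} {dO : measure_display} {Omega : measurableType dO}.
Variable P : probability Omega R.
Hypothesis hP : measure_is_complete P.
Context {d : nat}.
Variable W : R -> Omega -> 'cV[R]_d.
Hypothesis hW : brownian_motion P W.
Local Notation F := (bm_filtration P W).
Local Notation leb := (@lebesgue_measure R).
Variables (psi : 'cV[R]_d -> 'rV[R]_d -> R) (M : R).
Hypotheses (hpsi : hypP psi) (psi0 : forall x, `|psi x 0| <= M)
  (psiL : forall x z z', `|psi x z - psi x z'| <= M * enorm (z - z')).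
Variable X : R -> Omega -> 'cV[R]_d.
Hypothesis mX : forall w T i,
  measurable_fun (`[0, T]%classic : set (measurableTypeR R)) (fun s => X s w i 0).

Let M0 : 0 <= M.
Proof. exact: le_trans (normr_ge0 _) (psi0 0). Qed.

Section one_solution.
Variables (Z : R -> Omega -> 'rV[R]_d) (I : R -> Omega -> 'cV[R]_1).
Hypothesis hI : ito_integral P F W Z I.
Variables (T : R) (T0 : 0 < T).
Local Notation A := (`[0%R, T]%classic : set (measurableTypeR R)).

Let Z2 s w := enorm (Z s w) ^+ 2.

Lemma sq_tintegrable : [/\ {ae P, forall w, tintegrable T Z2 w} & rint P (tint T Z2)].
Proof.
have [[_ hM] _ _ _] := hI.
have mZ : jmeas T Z2.
  by apply: jmeas_enorm_sqr => i j; apply: (ito_jmeas hP hW hI); exact: ltW.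
by have [|a b _] := jmeas_tintegrable mZ _ (hM T T0) => //; move=> s w; exact: sqr_ge0.
Qed.

Lemma psi_tintegrable : {ae P, forall w, tintegrable T (fun s w => psi (X s w) (Z s w)) w}.
Proof.
have [ae _] := sq_tintegrable; apply: filterS ae => w iZ.
have mA : measurable A by exact: measurable_itv.
have muA : (leb A < +oo)%E by rewrite lebesgue_measure_itv/= lte_fin T0 -EFinB ltry.
(* From [|psi x z| <= M + M |z|] and [|z| <= 1 + |z|^2]. *)
have ic : leb.-integrable A (EFin \o cst (M + M)).
  apply: measurable_bounded_integrable => //.
  by exists `|M + M|; split=> [|z kz r _ /=]; [exact: num_real|exact: ltW].
have iMZ : leb.-integrable A (EFin \o (fun s => M * Z2 s w)).
  by apply: (eq_integrable mA _ _ _ (integrableZl mA M iZ)) => r _.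
apply: (le_integrable mA _ _ (integrableD mA ic iMZ)).
  apply/measurable_EFinP; apply: measurable_hypP_comp => // i.
  have mj : jmeas T (fun s w => Z s w 0 i) by apply: (ito_jmeas hP hW hI); exact: ltW.
  exact: (jmeas_path w mj).
move=> s _ /=; rewrite lee_fin.
have h : enorm (Z s w) <= 1 + Z2 s w.
  have : 0 <= (enorm (Z s w) - 2^-1) ^+ 2 by exact: sqr_ge0.
  have -> : (enorm (Z s w) - 2^-1) ^+ 2 = Z2 s w - enorm (Z s w) + 4^-1 by rewrite /Z2; field.
  lra.
have := psiL (X s w) (Z s w) 0; rewrite subr0 => h1.
have h2 := psi0 (X s w); have h3 := ler_wpM2l M0 h.
have h4 := ler_normD (psi (X s w) (Z s w) - psi (X s w) 0) (psi (X s w) 0).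
rewrite subrK in h4; apply: le_trans (ler_norm _).
by rewrite mulrDr mulr1 in h3; lra.
Qed.

Lemma sim_err_tintegrable (S : @simple_process R dO Omega F d 1) eps :
  (\int[P]_w sim_err Z S T w < eps%:E)%E ->
  let e := fun s w => enorm (simple_val S s w - Z s w) ^+ 2 in
  [/\ {ae P, forall w, tintegrable T e w}, rint P (tint T e) & rE P (tint T e) <= eps].
Proof.
move=> he e; have me := sim_err_jmeas hP hW hI S (ltW T0).
have [| |a b c] := jmeas_tintegrable (P := P) me.
- by move=> s w; exact: sqr_ge0.
- exact: lt_trans he (ltry _).
by split=> //; rewrite -lee_fin c ltW.
Qed.

End one_solution.

Variables (Y Y' : R -> Omega -> R) (Z Z' : R -> Omega -> 'rV[R]_d) (lam lam' : R).
Hypotheses (hY : ergodic_bsde P W psi X Y Z lam) (hY' : ergodic_bsde P W psi X Y' Z' lam').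
Hypotheses (mY : forall t, 0 <= t -> measurable_fun setT (Y t))
  (mY' : forall t, 0 <= t -> measurable_fun setT (Y' t)).
Variable C0 : R.
Hypothesis hC0 : {ae P, forall w, `|Y 0 w - Y' 0 w| <= C0}.
Variables (T : R) (T0 : 0 < T).
Local Notation A := (`[0%R, T]%classic : set (measurableTypeR R)).
Local Notation Yh := (fun w => Y T w - Y' T w).
Local Notation pp := (fun Z s w => psi (X s w) (Z s w)).

Let mYh : measurable_fun setT Yh.
Proof. by apply: measurable_funB; [apply: mY|apply: mY']; exact: ltW. Qed.

Lemma bsde_difference : exists I I', [/\ ito_integral P F W Z I, ito_integral P F W Z' I' &
  {ae P, forall w, [/\ tintegrable T (pp Z) w, tintegrable T (pp Z') w,
    I 0 w = 0, I' 0 w = 0 &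
    (lam - lam') * T = Yh w - (Y 0 w - Y' 0 w) + (tint T (pp Z) w - tint T (pp Z') w)
      - (I T w 0 0 - I' T w 0 0)]}].
Proof.
have [I hI eY] := hY; have [I' hI' eY'] := hY'.
exists I, I'; split=> //.
have i1 := psi_tintegrable hI T0; have i2 := psi_tintegrable hI' T0.
have z1 := ito_start hP hW hI; have z2 := ito_start hP hW hI'.
apply: filterS3 (filterI i1 i2) (filterI z1 z2) (filterI eY eY').
move=> w [j1 j2] [w1 w2] [e1 e2]; split=> //.
have T00 : (0 : R) <= 0 <= T by apply/andP; split; [exact: lexx|exact: ltW].
have mA : measurable A by exact: measurable_itv.
have muA : (leb A < +oo)%E by rewrite lebesgue_measure_itv/= lte_fin T0 -EFinB ltry.
have TE : fine (leb A) = T by rewrite lebesgue_measure_itv/= lte_fin T0 -EFinB/= subr0.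
have sub k h : tintegrable T h w -> \int[leb]_(s in A) (h s w - k) = tint T h w - k * T.
  move=> ih; have ic : leb.-integrable A (EFin \o cst (- k)).
    apply: measurable_bounded_integrable => //.
    by exists `|- k|; split=> [|z kz r _ /=]; [exact: num_real|exact: ltW].
  rewrite (RintegralD mA ih ic); congr (_ + _).
  by rewrite (Rintegral_cst leb mA) TE mulNr.
have := e1 0 T T00; have := e2 0 T T00; rewrite w1 w2 mxE !subr0.
rewrite (sub lam (pp Z) j1) (sub lam' (pp Z') j2).
by move=> -> ->; ring.
Qed.

(** Obtained from the equation, since the growth condition would call for moments of [X T]: the
    drivers are controlled by the time integrals of [|Z|^2] and [|Z'|^2], and the stochastic
    integrals are square integrable. *)
Lemma sqint_bsde_difference : sqint P Yh.
Proof.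
have [I [I' [hI hI' ae]]] := bsde_difference.
have [iZ rZ] := sq_tintegrable hI T0; have [iZ' rZ'] := sq_tintegrable hI' T0.
have sI := sqint_ito hP hW hI 0 (ltW T0); have sI' := sqint_ito hP hW hI' 0 (ltW T0).
have mA : measurable A by exact: measurable_itv.
pose Q w := 2 * tint T (fun s w => enorm (Z s w) ^+ 2) w +
  2 * tint T (fun s w => enorm (Z' s w) ^+ 2) w.
have Q0 w : 0 <= Q w.
  by rewrite addr_ge0// mulr_ge0// Rintegral_ge0// => s _; exact: sqr_ge0.
have rQ : rint P Q by apply: rintD; exact: rintZ.
(* [Yh] is a sum of four terms, whence the factor 4; the squared difference of the integrated
   drivers is at most [4 M^2 T (Q + 1)]. *)
pose B w := 4 * (C0 + `|lam - lam'| * T) ^+ 2 + 16 * M ^+ 2 * T * (Q w + 1) +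
  4 * I T w 0 0 ^+ 2 + 4 * I' T w 0 0 ^+ 2.
have rB : rint P B.
  apply: rintD; last by apply: rintZ; exact: sI'.2.
  apply: rintD; last by apply: rintZ; exact: sI.2.
  apply: rintD; first exact: rint_cst.
  by apply: rintZ; apply: rintD => //; exact: rint_cst.
split=> //; apply: rint_lty; [exact: measurable_funX|by move=> w; exact: sqr_ge0|].
apply: (@le_lt_trans _ _ (\int[P]_w (B w)%:E)%E); last by rewrite rEfin// ltry.
apply: ae_ge0_le_integral => //.
- by move=> w _; rewrite lee_fin sqr_ge0.
- by apply/measurable_EFinP; exact: measurable_funX.
- move=> w _; rewrite lee_fin /B; have h1 := sqr_ge0 (C0 + `|lam - lam'| * T).
  have h2 : 0 <= 16 * M ^+ 2 * T * (Q w + 1).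
    exact: (mulr_ge0 (mulr_ge0 (mulr_ge0 (ler0n R 16) (sqr_ge0 M)) (ltW T0)) (addr_ge0 (Q0 w) ler01)).
  have h3 := sqr_ge0 (I T w 0 0); have h4 := sqr_ge0 (I' T w 0 0); lra.
- by apply/measurable_EFinP; exact: rint_meas rB.
apply: filterS3 ae (filterI iZ iZ') hC0 => w [i1 i2 _ _ e] [j1 j2] c0 _.
rewrite lee_fin.
have key : `|tint T (pp Z) w - tint T (pp Z') w| <= 2 * M * Num.sqrt (T * (Q w + 1)).
  have Q1 : 0 < Q w + 1 by rewrite ltr_wpDl.
  (* The weight that balances [del * T] against [Q w / del]: both are at most the square root of
     [T * (Q w + 1)]. The added 1 keeps it positive. *)
  pose del := Num.sqrt ((Q w + 1) / T).
  have del0 : 0 < del by rewrite sqrtr_gt0 divr_gt0.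
  have d1 : del * T = Num.sqrt (T * (Q w + 1)).
    have ET : T = Num.sqrt (T ^+ 2) by rewrite sqrtr_sqr gtr0_norm.
    rewrite /del [X in _ * X = _]ET -sqrtrM ?divr_ge0 ?ltW//.
    by congr Num.sqrt; field; rewrite gt_eqF.
  have d2 : del^-1 * Q w <= Num.sqrt (T * (Q w + 1)).
    rewrite mulrC ler_pdivrMr// -d1 mulrAC -expr2 sqr_sqrtr ?divr_ge0 ?ltW// divfK ?gt_eqF//.
    by rewrite ltrDl.
  have iq : leb.-integrable A (EFin \o (fun s => 2 * enorm (Z s w) ^+ 2 + 2 * enorm (Z' s w) ^+ 2)).
    have k1 := integrableZl mA 2 j1; have k2 := integrableZl mA 2 j2.
    by apply: (eq_integrable mA _ _ _ (integrableD mA k1 k2)) => s _.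
  have tQ : \int[leb]_(s in A) (2 * enorm (Z s w) ^+ 2 + 2 * enorm (Z' s w) ^+ 2) = Q w.
    rewrite RintegralD// ?RintegralZl//.
      by apply: (eq_integrable mA _ _ _ (integrableZl mA 2 j1)) => s _.
    by apply: (eq_integrable mA _ _ _ (integrableZl mA 2 j2)) => s _.
  have i0 : leb.-integrable A (EFin \o cst (0 : R)).
    by apply: (eq_integrable mA _ _ _ (integrable0 _ _)) => s _.
  have t0 : \int[leb]_(s in A) cst (0 : R) s = 0 by rewrite (Rintegral_cst leb mA) mul0r.
  have sq s : enorm (Z s w - Z' s w) ^+ 2 <= 2 * enorm (Z s w) ^+ 2 + 2 * enorm (Z' s w) ^+ 2.
    by rewrite -(enorm_sqrN (Z' s w)) enorm_sqrD.
  have sq' s : enorm (Z' s w - Z s w) ^+ 2 <= 2 * enorm (Z s w) ^+ 2 + 2 * enorm (Z' s w) ^+ 2.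
    by rewrite -enorm_sqrN opprB.
  have := drift_integral_le T0 M0 i1 i2 i0 iq (y := fun s => enorm (Z s w - Z' s w))
    (fun s => ltac:(by rewrite add0r; exact: psiL)) sq ler01 del0.
  have := drift_integral_le T0 M0 i2 i1 i0 iq (y := fun s => enorm (Z' s w - Z s w))
    (fun s => ltac:(by rewrite add0r; exact: psiL)) sq' ler01 del0.
  rewrite t0 mulr0 add0r !mul1r expr1n mulr1 tQ -/(tint T (pp Z) w) -/(tint T (pp Z') w).
  have h := ler_wpM2l M0 (lerD (lexx (del * T)) d2); rewrite {2}d1 in h.
  move=> h1 h2; rewrite ler_norml; apply/andP; split; lra.
have key2 : (tint T (pp Z) w - tint T (pp Z') w) ^+ 2 <= 4 * M ^+ 2 * T * (Q w + 1).
  rewrite -real_normK ?num_real//.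
  apply: (@le_trans _ _ ((2 * M * Num.sqrt (T * (Q w + 1))) ^+ 2)).
    by rewrite ler_pXn2r// nnegrE ?mulr_ge0 ?sqrtr_ge0.
  rewrite exprMn sqr_sqrtr; last exact: (mulr_ge0 (ltW T0) (addr_ge0 (Q0 w) ler01)).
  by rewrite le_eqVlt; apply/orP; left; apply/eqP; ring.
set a := tint T (pp Z) w - tint T (pp Z') w in key2 e.
pose b := (lam - lam') * T + (Y 0 w - Y' 0 w).
have hb : b ^+ 2 <= (C0 + `|lam - lam'| * T) ^+ 2.
  rewrite -real_normK ?num_real// ler_pXn2r ?nnegrE//; last first.
    by rewrite addr_ge0 ?mulr_ge0 ?(ltW T0)// (le_trans _ c0).
  rewrite /b; apply: le_trans (ler_normD _ _) _.
  by rewrite normrM (gtr0_norm T0) addrC lerD2r.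
have -> : Yh w = b - a + I T w 0 0 - I' T w 0 0 by rewrite /b e; ring.
have := sqrD_le2 (b - a) (I T w 0 0 - I' T w 0 0); rewrite addrA.
have := sqrD_le2 b (- a); have := sqrD_le2 (I T w 0 0) (- I' T w 0 0).
rewrite !sqrrN /B; lra.
Qed.

Local Notation tb := (@tilt_bound R d M).

(** The approximations are fixed before the grid, and the error is controlled for every compatible
    grid that is fine enough. The grid thus remains free for the Lyapunov estimate. *)
Lemma girsanov_bound eps : 0 < eps -> exists S S' : @simple_process R dO Omega F d 1,
  forall N t, is_grid T N t -> grid_fits S T N t -> grid_fits S' T N t ->
  (forall i, (i < N)%N -> tb ^+ 2 * (t i.+1 - t i) <= 1) ->
  exists2 x, density_incr P W N t x (tb) &
    (lam - lam') * T <= rE P (fun w => density x N w * Yh w) + C0 + eps.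
Proof.
move=> eps0; have T00 := ltW T0.
have [I [I' [hI hI' ae]]] := bsde_difference.
(* Bounds the second moment of the density for every grid, through [z^2 <= 1 + z^4]. *)
pose kap := 1 + expR (11 * tb ^+ 2 * T).
have kap0 : 0 < kap by rewrite addr_gt0// expR_gt0.
have MT0 : 0 < M * T + 2 by rewrite ltr_wpDl// mulr_ge0.
have M42 : 0 < 4 * M + 2 by rewrite ltr_wpDl// mulr_ge0.
(* [M * T] comes from the driver remainder, the 2 from the errors of the two stochastic integrals,
   each paired with the density by Young's inequality. *)
have [del del0 hdel] : exists2 del, 0 < del & (M * T + 2) * del * kap = eps / 2.
  exists (eps / (2 * ((M * T + 2) * kap))); first by rewrite divr_gt0// !mulr_gt0.
  by field; rewrite !gt_eqF.
(* The mean of [err] is at most [2 M (e1 + e1) + (e1 + e1)]. *)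
have [e1 e10 he1] : exists2 e1, 0 < e1 & del^-1 * ((4 * M + 2) * e1) = eps / 2.
  exists (del * eps / (2 * (4 * M + 2))); first by apply: divr_gt0; exact: mulr_gt0.
  by field; rewrite !gt_eqF.
have [S [hS1 hS2 hS3]] := ito_approx hP hW hI T00 e10.
have [S' [hS1' hS2' hS3']] := ito_approx hP hW hI' T00 e10.
exists S, S' => N t g fS fS' small.
pose s i j w := grid_coef S t 0 i j w - grid_coef S' t 0 i j w.
have ms i j : (i < N)%N -> fmeas P W (t i) (s i j).
  by move=> iN; apply: measurable_funB; [exact: (fmeas_grid_coef g fS)|exact: (fmeas_grid_coef g fS')].
have [B hB] := grid_coef_bounded S t; have [B' hB'] := grid_coef_bounded S' t.
have sB i j w : `|s i j w| <= B + B' by apply: le_trans (ler_normB _ _) _; exact: lerD.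
exists (tilt W t s M); first exact: (tilt_density hP hW g ms M0 small).
have dx := tilt_density hP hW g ms M0 small.
set D := density (tilt W t s M) N.
have iD : sqint P D := sqint_density hP hW g dx (leqnn N).
have rD f : rint P f -> rint P (fun w => D w * f w) := rint_density hP hW g dx (leqnn N).
have [iS rS leS] := sim_err_tintegrable hI T0 hS1.
have [iS' rS' leS'] := sim_err_tintegrable hI' T0 hS1'.
set e := tint T _ in rS leS; set e' := tint T _ in rS' leS'.
pose rho w := simple_ito W S T w 0 0 - I T w 0 0.
pose rho' w := simple_ito W S' T w 0 0 - I' T w 0 0.
have rE_rho : rE P (fun w => rho w ^+ 2) <= e1.
  by have := ltW hS3; under eq_fun do rewrite big_ord1.
have rE_rho' : rE P (fun w => rho' w ^+ 2) <= e1.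
  by have := ltW hS3'; under eq_fun do rewrite big_ord1.
have mA : measurable A by exact: measurable_itv.
have sqY := sqint_bsde_difference.
have iDd := rint_density_drift hP hW g ms sB M0 small (leqnn N).
have eDd := rE_density_drift hP hW g ms sB M0 small (leqnn N).
pose err w := 2 * M * (e w + e' w) + (rho w ^+ 2 + rho' w ^+ 2).
have r1 : rint P (fun w => D w * Yh w) by apply: rD; exact: sqint_rint.
have r2 : rint P (fun w => C0 * D w) by apply: rintZ; exact: sqint_rint.
have r3 : rint P (fun w => (M * T + 2) * del * D w ^+ 2) by apply: rintZ; exact: iD.2.
have rrho : rint P (fun w => rho w ^+ 2 + rho' w ^+ 2).
  by apply: rintD; [exact: (hS2 0).2|exact: (hS2' 0).2].
have ree : rint P (fun w => e w + e' w) by exact: rintD.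
have r4' : rint P err by apply: rintD => //; exact: rintZ.
have r4 : rint P (fun w => del^-1 * err w) by exact: rintZ.
(* The equation multiplied by the density. The bound [M |S - S'|] on the drivers and the simple
   integrals combine into [drift_sum], which disappears on taking expectations. *)
have main : {ae P, forall w, (lam - lam') * T * D w <= D w * Yh w + C0 * D w -
    D w * drift_sum W t s M N w + (M * T + 2) * del * D w ^+ 2 + del^-1 * err w}.
  apply: filterS3 (filterI ae hC0) iS iS' => w [[i1 i2 z1 z2 eq] c0] j1 j2.
  have D0 : 0 <= D w by exact: (density_ge0 dx).
  have [||mG IG] := @step_integral R T N t (fun r => enorm (simple_val S r w - simple_val S' r w))
     (fun i => coef_norm s i w) N g (leqnn N).
  - by move=> r; exact: enorm_ge0.
  - move=> i r iN tr; rewrite /enorm /coef_norm big_ord1; congr Num.sqrt.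
    by apply: eq_bigr => j _; rewrite !mxE (simple_val_grid_coef g fS _ _ _ iN tr) (simple_val_grid_coef g fS' _ _ _ iN tr).
  rewrite (gridN g) in mG IG.
  have i_n : leb.-integrable A (EFin \o (fun r => enorm (simple_val S r w - simple_val S' r w))).
    apply/integrableP; split; first exact/measurable_EFinP.
    by under eq_integral do rewrite /= ger0_norm ?enorm_ge0//; rewrite IG ltry.
  have k1 := integrableZl mA 2 j1; have k2 := integrableZl mA 2 j2.
  have iq : leb.-integrable A (EFin \o (fun r => 2 * enorm (simple_val S r w - Z r w) ^+ 2 +
      2 * enorm (simple_val S' r w - Z' r w) ^+ 2)).
    by apply: (eq_integrable mA _ _ _ (integrableD mA k1 k2)) => r _.
  have tQ : \int[leb]_(r in A) (2 * enorm (simple_val S r w - Z r w) ^+ 2 +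
      2 * enorm (simple_val S' r w - Z' r w) ^+ 2) = 2 * e w + 2 * e' w.
    by rewrite RintegralD// !RintegralZl.
  pose y r := enorm ((Z r w - simple_val S r w) - (Z' r w - simple_val S' r w)).
  have hy r : y r ^+ 2 <= 2 * enorm (simple_val S r w - Z r w) ^+ 2 +
      2 * enorm (simple_val S' r w - Z' r w) ^+ 2.
    rewrite -(enorm_sqrN (simple_val S r w - _)) opprB.
    by apply: le_trans (enorm_sqrD _ _) _; rewrite opprB.
  have hpp r : `|psi (X r w) (Z r w) - psi (X r w) (Z' r w)| <=
      M * (enorm (simple_val S r w - simple_val S' r w) + y r).
    apply: le_trans (psiL _ _ _) _; apply: ler_wpM2l => //.
    apply: le_trans (enormD _ _); rewrite le_eqVlt; apply/orP; left; apply/eqP.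
    by congr enorm; apply/matrixP => k l; rewrite !mxE; ring.
  have := drift_integral_le T0 M0 i1 i2 i_n iq hpp hy D0 del0.
  rewrite tQ -/(tint T (pp Z) w) -/(tint T (pp Z') w) [\int[_]_(r in _) enorm _]/Rintegral IG /=.
  set a := tint T (pp Z) w in eq *; set a' := tint T (pp Z') w in eq *.
  set H := \sum_(i < N) _ => h1.
  have hsum : simple_ito W S T w 0 0 - simple_ito W S' T w 0 0 = incr_sum W t s 0 N w.
    rewrite -(gridN g) (simple_ito_grid g fS)// (simple_ito_grid g fS')// /incr_sum -sumrB.
    apply: eq_bigr => i _; rewrite -sumrB; apply: eq_bigr => j _; by rewrite -mulrBl.
  have hI1 : I T w 0 0 - I' T w 0 0 = incr_sum W t s 0 N w - rho w + rho' w.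
    by rewrite -hsum /rho /rho'; ring.
  have young u : D w * u <= del * D w ^+ 2 + del^-1 * u ^+ 2.
    rewrite -subr_ge0.
    have -> : del * D w ^+ 2 + del^-1 * u ^+ 2 - D w * u =
       ((del * D w - u) ^+ 2 + (del * D w) ^+ 2 + u ^+ 2) / (2 * del).
      by field; rewrite gt_eqF.
    by rewrite divr_ge0 ?addr_ge0 ?sqr_ge0// mulr_ge0// ltW.
  have y1 := young (rho w); have y2 := young (- rho' w); rewrite sqrrN in y2.
  have c1 : D w * - (Y 0 w - Y' 0 w) <= D w * C0.
    by apply: ler_wpM2l => //; rewrite lerNl; move: c0; rewrite ler_norml => /andP[].
  rewrite mulrC eq hI1 /drift_sum -/H /err.
  rewrite -subr_ge0 in h1; rewrite -subr_ge0 in y1; rewrite -subr_ge0 in y2; rewrite -subr_ge0 in c1.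
  rewrite -subr_ge0; have := addr_ge0 (addr_ge0 (addr_ge0 h1 y1) y2) c1.
  by congr (0 <= _); ring.
have := rE_le_ae _ _ main.
rewrite rEZ; last exact: sqint_rint.
rewrite (rE_density hP hW g dx (leqnn N)) mulr1.
have i_12 : rint P (fun w => D w * Yh w + C0 * D w) by exact: rintD.
have i_123 : rint P (fun w => D w * Yh w + C0 * D w - D w * drift_sum W t s M N w) by exact: rintB.
have i_1234 : rint P (fun w => D w * Yh w + C0 * D w - D w * drift_sum W t s M N w +
  (M * T + 2) * del * D w ^+ 2) by exact: rintD.
move=> /(_ _ _)/wrap[]; [by apply: rintZ; exact: sqint_rint|exact: rintD|].
rewrite rED// rED// rEB// rED// eDd subr0 (rEZ _ (sqint_rint iD)) (rE_density hP hW g dx (leqnn N)) mulr1.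
rewrite (rEZ _ iD.2) (rEZ _ r4').
have hD2 : rE P (fun w => D w ^+ 2) <= kap.
  apply: (@le_trans _ _ (rE P (fun w => 1 + D w ^+ 4))).
    apply: rE_le; [exact: iD.2|apply: rintD; [exact: rint_cst|exact: (rint_density4 hP hW g dx)]|].
    by move=> w; exact: sqr_le_pow4.
  rewrite rED ?rE_cst; [|exact: rint_cst|exact: (rint_density4 hP hW g dx)].
  by rewrite lerD2l; have := rE_density4 hP hW g dx (leqnn N); rewrite (gridN g).
have herr : rE P err <= (4 * M + 2) * e1.
  rewrite /err rED ?(rEZ _ ree)//; last exact: rintZ.
  rewrite !rED//; [|exact: (hS2 0).2|exact: (hS2' 0).2].
  have -> : (4 * M + 2) * e1 = 2 * M * (e1 + e1) + (e1 + e1) by ring.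
  exact: (lerD (ler_wpM2l (mulr_ge0 (ler0n R 2) M0) (lerD leS leS')) (lerD rE_rho rE_rho')).
have h1 : (M * T + 2) * del * rE P (fun w => D w ^+ 2) <= eps / 2.
  by rewrite -hdel; apply: ler_wpM2l => //; rewrite mulr_ge0 ?ltW.
have h2 : del^-1 * rE P err <= eps / 2.
  by rewrite -he1; apply: ler_wpM2l => //; rewrite invr_ge0 ltW.
by move/le_trans; apply; rewrite -addrA lerD2l [leRHS](splitr eps); exact: lerD.
Qed.

End girsanov.

(** * Comparison of the two solutions *)

Section growth.
Context {R : realType} {dO : measure_display} {Omega : measurableType dO}.
Variable P : probability Omega R.
Hypothesis hP : measure_is_complete P.
Context {d : nat}.
Variable W : R -> Omega -> 'cV[R]_d.
Hypothesis hW : brownian_motion P W.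

(** [e] marks paths with uncontrolled defects, where [lb] is only bounded below by [lm - R2]; [b]
    marks paths that exceed the level, where [lb >= -1] holds and [y] is charged to its absolute
    value. Elsewhere [V <= lb + 1] is available. *)
Let split_le (D y a1 a2 V lb lm R2 : R) (e b : bool) :
  0 <= D -> 0 <= a1 -> 0 <= a2 -> y <= a1 + a2 * V -> lm - R2 <= lb ->
  (~~ e -> -1 <= lb) -> (~~ e -> ~~ b -> V <= lb + 1) ->
  D * y <= D * (a1 + a2) + a2 * (D * lb) + D * `|y| * b%:R + D * `|y| * e%:R +
    a2 * (D * (R2 + `|lm|) * e%:R).
Proof.
move=> D0 a10 a20 hy hl he heb.
have -> : D * (a1 + a2) + a2 * (D * lb) + D * `|y| * b%:R + D * `|y| * e%:R +
    a2 * (D * (R2 + `|lm|) * e%:R) =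
  D * (a1 + a2 * (lb + 1) + `|y| * b%:R + `|y| * e%:R + a2 * ((R2 + `|lm|) * e%:R)) by ring.
apply: ler_wpM2l => //.
have yn := ler_norm y; have n0 := normr_ge0 y.
have lmn : - `|lm| <= lm by rewrite lerNl -normrN ler_norm.
case: e he heb => [_ _|/(_ isT) he /(_ isT) heb].
  rewrite !mulr1; have : 0 <= a2 * (lb + (R2 + `|lm|)) by rewrite mulr_ge0//; lra.
  by have : 0 <= `|y| * b%:R by [rewrite mulr_ge0]; lra.
case: b heb => [_|/(_ isT) heb]; rewrite !(mulr1, mulr0) !addr0.
  by have : 0 <= a2 * (lb + 1) by [rewrite mulr_ge0//; lra]; lra.
by apply: le_trans hy _; rewrite lerD2l ler_wpM2l.
Qed.

Variables (T : R) (N : nat) (t : nat -> R) (g : is_grid T N t).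
Variables (m : nat) (zeta dI : nat -> Omega -> 'I_m -> R) (C eta R2 KI : R).
Hypotheses (C0 : 0 <= C) (eta0 : 0 < eta) (R20 : 0 <= R2) (KI0 : 0 <= KI).
Hypothesis hI : mart_incr P W N t zeta dI eta KI.
Variables (x : nat -> Omega -> R) (M' : R).
Hypothesis hx : density_incr P W N t x M'.
Variables (y : Omega -> R) (a1 a2 : R) (E B : set Omega).
Hypotheses (sy : sqint P y) (a10 : 0 <= a1) (a20 : 0 <= a2)
  (hy : {ae P, forall w, y w <= a1 + a2 * lyap zeta N w})
  (mE : measurable E) (mB : measurable B)
  (hE : forall w, ~ E w -> \sum_(j < N) Num.max (lyap_defect t zeta dI C eta j w) 0 <= 1 /\
     lyap zeta 0 w = 0)
  (hB : forall w, ~ B w -> forall j, (j < N)%N -> lyap zeta j w <= R2).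

Local Notation kap := (expR (11 * M' ^+ 2 * T)).

(** The first three summands depend neither on the grid nor on [T]. The others come from the
    exceptional events, and each has a part small with [del] or [del'] and a part small with a
    probability. *)
Lemma rE_density_growth del del' : 0 < del -> 0 < del' ->
  rE P (fun w => density x N w * y w) <=
    a1 + a2 + a2 * (2 * lyap_const C eta KI M' / eta) +
    (del * (kap + rE P (fun w => y w ^+ 2)) + del^-1 ^+ 3 * fine (P B)) +
    (del * (kap + rE P (fun w => y w ^+ 2)) + del^-1 ^+ 3 * fine (P E)) +
    a2 * (del' * (kap + (2 * R2 ^+ 2 + 2 * (4 * m%:R * R2 * KI * T))) + del'^-1 ^+ 3 * fine (P E)).
Proof.
move=> del0 del0'.
set lb := lyap_bound t zeta dI C eta R2 N; set lm := lyap_mart t zeta dI eta R2 N.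
set D := density x N.
have D0 w : 0 <= D w by exact: (density_ge0 hx).
have iD : rint P D := sqint_rint (sqint_density hP hW g hx (leqnn N)).
have rD f : rint P f -> rint P (fun w => D w * f w) := rint_density hP hW g hx (leqnn N).
have sny : sqint P (fun w => `|y w|) by exact: sqint_norm.
have slm : sqint P lm := sqint_lyap_mart hP hW g R20 hI (leqnn N).
have snlm : sqint P (fun w => R2 + `|lm w|) by apply: sqintD; [exact: sqint_cst|exact: sqint_norm].
have ilb : rint P lb := rint_lyap_bound hP hW g C R20 hI (leqnn N).
have ind f A : sqint P f -> measurable A -> rint P (fun w => D w * f w * \1_A w).
  move=> sf mA; have : rint P (fun w => \1_A w * (D w * f w)).
    apply: (rintM_bdd (M := 1)); [exact: measurable_indic|exact: indic_le1|].
    exact/rD/sqint_rint.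
  by under eq_fun do rewrite mulrC.
have r1 : rint P (fun w => (a1 + a2) * D w) by exact: rintZ.
have r2 : rint P (fun w => a2 * (D w * lb w)) by apply: rintZ; exact: rD.
have r3 := ind _ _ sny mB; have r4 := ind _ _ sny mE.
have r5' := ind _ _ snlm mE.
have r5 : rint P (fun w => a2 * (D w * (R2 + `|lm w|) * \1_E w)) by exact: rintZ.
have main : {ae P, forall w, D w * y w <= (a1 + a2) * D w + a2 * (D w * lb w) +
    D w * `|y w| * \1_B w + D w * `|y w| * \1_E w + a2 * (D w * (R2 + `|lm w|) * \1_E w)}.
  apply: filterS hy => w yw; rewrite [(a1 + a2) * _]mulrC !indicE.
  apply: (split_le (V := lyap zeta N w)) => //.
  - exact: (lyap_bound_mart g C0 eta0 R20 hI).
  - rewrite notin_setE => nE; have [h1 h2] := hE nE.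
    by have [] := lyap_bound_ge g R2 eta0 hI (leqnn N) h1 h2.
  - rewrite !notin_setE => nE nB; have [h1 h2] := hE nE.
    by have [_] := lyap_bound_ge g R2 eta0 hI (leqnn N) h1 h2; apply; exact: hB.
have i12 : rint P (fun w => (a1 + a2) * D w + a2 * (D w * lb w)) by exact: rintD.
have i123 : rint P (fun w => (a1 + a2) * D w + a2 * (D w * lb w) + D w * `|y w| * \1_B w).
  exact: rintD.
have i1234 : rint P (fun w => (a1 + a2) * D w + a2 * (D w * lb w) + D w * `|y w| * \1_B w +
    D w * `|y w| * \1_E w) by exact: rintD.
apply: le_trans (rE_le_ae (rD _ (sqint_rint sy)) (rintD i1234 r5) main) _.
rewrite rED// rED// rED// rED// (rEZ _ iD) (rE_density hP hW g hx (leqnn N)) mulr1.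
rewrite (rEZ _ (rD _ ilb)) (rEZ _ r5').
have t1 := density_triple hP hW g hx del0 sny mB.
have t2 := density_triple hP hW g hx del0 sny mE.
have t3 := density_triple hP hW g hx del0' snlm mE.
have Ey : (fun w => `|y w| ^+ 2) = (fun w => y w ^+ 2).
  by apply/funext => w; rewrite real_normK ?num_real.
rewrite Ey in t1 t2.
have hlm : rE P (fun w => (R2 + `|lm w|) ^+ 2) <= 2 * R2 ^+ 2 + 2 * (4 * m%:R * R2 * KI * T).
  apply: (@le_trans _ _ (rE P (fun w => 2 * R2 ^+ 2 + 2 * lm w ^+ 2))).
    apply: rE_le; [exact: snlm.2|apply: rintD; [exact: rint_cst|apply: rintZ; exact: slm.2]|].
    by move=> w; apply: le_trans (sqrD_le2 _ _) _; rewrite real_normK ?num_real.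
  rewrite rED ?rE_cst; [|exact: rint_cst|by apply: rintZ; exact: slm.2].
  rewrite rEZ; last exact: slm.2.
  rewrite lerD2l ler_pM2l//.
  by have := rE_lyap_mart_sqr hP hW g eta0 R20 KI0 hI (leqnn N); rewrite (gridN g).
have t4 := rE_density_lyap_bound hP hW g C0 eta0 R20 KI0 hI hx (leqnn N).
apply: lerD; last first.
  apply: ler_wpM2l => //; apply: le_trans t3 _; rewrite lerD2r ler_pM2l// lerD2l; exact: hlm.
by apply: lerD => //; apply: lerD => //; rewrite lerD2l; apply: ler_wpM2l.
Qed.

End growth.

Section comparison.
Context {R : realType} {dO : measure_display} {Omega : measurableType dO}.
Variable P : probability Omega R.
Hypothesis hP : measure_is_complete P.
Context {d : nat}.
Variable W : R -> Omega -> 'cV[R]_d.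
Hypothesis hW : brownian_motion P W.
Local Notation F := (bm_filtration P W).
Variables (dd b : 'cV[R]_d -> 'cV[R]_d) (sigma : 'cV[R]_d -> 'M[R]_d).
Hypothesis hA : hypA dd b sigma.
Variables (psi : 'cV[R]_d -> 'rV[R]_d -> R).
Hypothesis hpsi : hypP psi.
Variables (G : set 'cV[R]_d) (phi : 'cV[R]_d -> R).
Hypothesis hG : hypG G phi.
Variables (x : 'cV[R]_d) (hx : closure G x).
Variables (X : R -> Omega -> 'cV[R]_d) (K : Omega -> cumulative R R).
Hypothesis hX : reflected_sde P W (dd \+ b) sigma G phi x X K.

Let cX w T k : {within `[0, T], continuous (fun s => X s w k 0)}.
Proof.
apply: (within_path hX (h := fun y => y k 0)) => y.
by apply: near_at_continuous => e e0; exists e.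
Qed.

Let mX w T k : measurable_fun (`[0, T]%classic : set (measurableTypeR R)) (fun s => X s w k 0).
Proof. by apply: within_measurable; exact: cX. Qed.

Variables (Y Y' : R -> Omega -> R) (Z Z' : R -> Omega -> 'rV[R]_d) (lam lam' : R).
Hypotheses (mY : forall t, 0 <= t -> measurable_fun setT (Y t))
  (mY' : forall t, 0 <= t -> measurable_fun setT (Y' t)).
Variable CY : R.
Hypotheses (CY0 : 0 <= CY)
  (hYh : {ae P, forall w, forall t, 0 <= t -> `|Y t w - Y' t w| <= CY * (1 + enorm (X t w) ^+ 2)}).
Hypotheses (hY : ergodic_bsde P W psi X Y Z lam) (hY' : ergodic_bsde P W psi X Y' Z' lam').

Let vanish (p : nat -> R) c : p @ \oo --> 0 -> 0 < c -> (forall n, 0 <= p n) ->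
  exists n, p n <= c.
Proof.
move=> /cvgr0Pnorm_lt/(_ c) hp c0 p0; have [n _ hn] := hp c0.
by exists n; have := hn n (leqnn n); rewrite /= ger0_norm// => /ltW.
Qed.

Let budget (a : R) : 0 <= a -> exists2 del, 0 < del & del * a <= 1.
Proof.
move=> a0; exists (a + 1)^-1; first by rewrite invr_gt0 ltr_wpDl.
by rewrite mulrC ler_pdivrMr ?mul1r ?ltr_wpDl// lerDl.
Qed.

(** For given [T] the order of the choices matters: the approximations, then [del] from the second
    moment of [Yh], then the level [q] making exits rare for this [del], then [del'], which depends
    on the level, and at last the mesh, making large defects rare for both weights. *)
Lemma lambda_growth : exists Kc, forall T, 0 < T -> (lam - lam') * T <= Kc.
Proof.
have [_ [M hM]] := hpsi.
have psi0 y : `|psi y 0| <= M by have [] := hM y 0 0.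
have psiL y z z' : `|psi y z - psi y z'| <= M * enorm (z - z') by have [] := hM y z z'.
have [C [eta [I [C0 eta0 hI X0 hdef]]]] := reflected_path_defect hP hW hA hG hx hX.
have [sinf hsig] := hypA_sigma_bounded hA.
pose KI := 32 * d%:R * sinf ^+ 2.
have KI0 : 0 <= KI by rewrite mulr_ge0 ?sqr_ge0// mulr_ge0.
have hC2 s w : 0 <= s -> enorm (sigma (X s w)) ^+ 2 <= sinf ^+ 2.
  move=> _; have [h _] := hsig (X s w); rewrite ler_pXn2r ?nnegrE ?enorm_ge0//.
  exact: le_trans (enorm_ge0 _) h.
pose tb := @tilt_bound R d M.
(* From [|X|^2 <= 2 |x|^2 + 2 |X - x|^2]. *)
pose a1 := CY * (1 + 2 * enorm x ^+ 2); pose a2 := 2 * CY.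
have a10 : 0 <= a1 by rewrite mulr_ge0// addr_ge0// mulr_ge0 ?sqr_ge0.
have a20 : 0 <= a2 by rewrite mulr_ge0.
pose c0 := CY * (1 + enorm x ^+ 2).
(* Each [1 + 1] pays for one exceptional term of [rE_density_growth], [c0] for the difference at
   time 0 and the last 1 for the error in [girsanov_bound]. *)
exists (a1 + a2 + a2 * (2 * lyap_const C eta KI tb / eta) + (1 + 1) + (1 + 1) + a2 * (1 + 1) + c0 + 1).
move=> T T0; have T00 := ltW T0.
have hc0 : {ae P, forall w, `|Y 0 w - Y' 0 w| <= c0}.
  by apply: filterS2 hYh X0 => w /(_ 0 (lexx 0)) + xw; rewrite xw.
have [S [S' HS]] := girsanov_bound hP hW hpsi psi0 psiL mX hY hY' mY mY' hc0 T0 (ltr01 : 0 < 1 :> R).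
have sqY := sqint_bsde_difference hP hW hpsi psi0 psiL mX hY hY' mY mY' hc0 T0.
set Yh := (fun w => Y T w - Y' T w) in sqY.
(* The first bound on the mesh keeps the tilts at most 1, the second keeps the contraction factors
   nonnegative. *)
pose m0 := Num.min ((tb ^+ 2 + 1)^-1) (2 / eta).
have m00 : 0 < m0 by rewrite lt_min invr_gt0 divr_gt0// ltr_wpDl ?sqr_ge0.
have grid_n n : exists Nt : nat * (nat -> R), [/\ is_grid T Nt.1 Nt.2, grid_fits S T Nt.1 Nt.2,
    grid_fits S' T Nt.1 Nt.2 & forall i, (i < Nt.1)%N -> Nt.2 i.+1 - Nt.2 i <= Num.min m0 n.+1%:R^-1].
  have [||N [t [h1 h2 h3 _ h4]]] := @grid_fits_ex _ _ _ _ _ _ _ _ S S' T (Num.min m0 n.+1%:R^-1) [::] T0.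
  - by rewrite lt_min m00 invr_gt0 ltr0Sn.
  - by [].
  - by exists (N, t).
have [Nt hNt] := choice grid_n.
pose N n := (Nt n).1; pose t n := (Nt n).2.
have gN n : [/\ is_grid T (N n) (t n), grid_fits S T (N n) (t n), grid_fits S' T (N n) (t n) &
    forall i, (i < N n)%N -> t n i.+1 - t n i <= Num.min m0 n.+1%:R^-1] by exact: hNt.
clearbody N t.
have gr n : is_grid T (N n) (t n) by case: (gN n).
have mesh n i : (i < N n)%N -> t n i.+1 - t n i <= m0.
  by move=> iN; have [_ _ _ /(_ i iN)] := gN n; rewrite le_min => /andP[].
have mesh_n n i : (i < N n)%N -> t n i.+1 - t n i <= n.+1%:R^-1.
  by move=> iN; have [_ _ _ /(_ i iN)] := gN n; rewrite le_min => /andP[].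
pose zeta n i w k := X (t n i) w k 0 - x k 0.
pose dI n i w k := I (t n i.+1) w k 0 - I (t n i) w k 0.
have mt n i k : (i <= N n)%N -> fmeas P W (t n i) (fun w => X (t n i) w k 0).
  by move=> iN; apply: (rsde_X_adapted hX); exact: grid_ge0 (gr n) iN.
have mart n : mart_incr P W (N n) (t n) (zeta n) (dI n) eta KI.
  have tt i : (i < N n)%N -> 0 <= t n i <= t n i.+1.
    by move=> iN; have /andP[-> /ltW ->] := grid_step (gr n) iN.
  split.
  - move=> i k iN; apply: measurable_funB; [exact: mt|exact: measurable_cst].
  - move=> i k iN; have /andP[s0 s1] := tt i iN; have [_ aI _ _] := hI.
    apply: measurable_funB; first exact: (aI k _ (le_trans s0 s1)).
    by apply: (fmeas_le s1); exact: (aI k _ s0).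
  - move=> i k iN; have /andP[s0 s1] := tt i iN.
    by apply: sqintB; apply: (sqint_ito hP hW hI) => //; exact: le_trans s1.
  - by move=> i k xi iN; exact: (ito_incr_mean hP hW hI k (tt i iN)).
  - move=> i xi B iN mxi hxi; exact: (ito_incr_var hP hW hI hC2 (tt i iN) mxi hxi).
  - move=> i iN; apply: (@le_trans _ _ (eta / 2 * m0)).
      by rewrite ler_pM2l ?divr_gt0// mesh.
    apply: (@le_trans _ _ (eta / 2 * (2 / eta))).
      by rewrite ler_pM2l ?divr_gt0// ge_min lexx orbT.
    by rewrite le_eqVlt; apply/orP; left; apply/eqP; field; rewrite gt_eqF.
have small n i : (i < N n)%N -> tb ^+ 2 * (t n i.+1 - t n i) <= 1.
  move=> iN; apply: (@le_trans _ _ (tb ^+ 2 * (tb ^+ 2 + 1)^-1)).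
    apply: ler_wpM2l; first exact: sqr_ge0.
    by apply: le_trans (mesh n i iN) _; rewrite ge_min lexx.
  by rewrite ler_pdivrMr ?mul1r ?lerDl// ltr_wpDl ?sqr_ge0.
pose dsum n w := \sum_(j < N n) Num.max (lyap_defect (t n) (zeta n) (dI n) C eta j w) 0.
pose E n := [set w | 1 < dsum n w] `|` [set w | 0 < lyap (zeta n) 0 w].
(* The union runs over all grids of the sequence, so that the level can be fixed before the grid; it
   is still avoided for large [q], as paths are bounded on [[0, T]]. *)
pose B (q : nat) := \bigcup_n \bigcup_(j in [set j | (j <= N n)%N]) [set w | q%:R < lyap (zeta n) j w].
have mzeta n i k : (i <= N n)%N -> measurable_fun setT (fun w => zeta n i w k).
  by move=> iN; exact: (fmeas_measurable hP hW (mi_zeta (mart n) k iN)).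
have mlyap n i : (i <= N n)%N -> measurable_fun setT (lyap (zeta n) i).
  by move=> iN; apply: measurable_sum => k; apply: measurable_funX; exact: mzeta.
have mdI n i k : (i < N n)%N -> measurable_fun setT (fun w => dI n i w k).
  by move=> iN; exact: (fmeas_measurable hP hW (mi_meas (mart n) k iN)).
have mgt (f : Omega -> R) c : measurable_fun setT f -> measurable [set w | c < f w].
  move=> mf; rewrite -[X in measurable X]setTI.
  have -> : [set w | c < f w] = f @^-1` `]c, +oo[ by apply/seteqP; split=> w /=; rewrite in_itv/= andbT.
  exact: mf.
have mE n : measurable (E n).
  apply: measurableU; apply: mgt; last exact: mlyap.
  apply: measurable_sum => j; have jN := ltn_ord j.
  apply: measurable_maxr; last exact: measurable_cst.
  have ml1 := mlyap n _ jN; have ml := mlyap n _ (ltnW jN).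
  apply: measurable_funB; last by apply: measurable_sum => k; apply: measurable_funX; exact: mdI.
  apply: measurable_funB; last first.
    apply: measurable_sum => k; apply: measurable_funM; last exact: mdI.
    by apply: measurable_funM; [exact: measurable_cst|apply: mzeta; exact: ltnW].
  apply: measurable_funB; first exact: measurable_funB.
  apply: measurable_funM; last exact: measurable_cst.
  apply: measurable_funB; first exact: measurable_cst.
  by apply: measurable_funM => //; exact: measurable_cst.
have mB q : measurable (B q).
  apply: bigcup_measurable => n _; apply: bigcup_measurable => j jN.
  by apply: mgt; exact: mlyap.
have aeE : {ae P, forall w, \forall n \near \oo, ~ E n w}.
  apply: filterS2 hdef X0 => w /(_ T 1 T0 ltr01)[del del0 hdel] xw.
  near=> n; move=> [|]; rewrite /= ltNge; apply/negP; apply/negPn.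
    apply: hdel => // i iN; apply: le_trans (mesh_n n i iN) _; apply: ltW.
    near: n; exact: (near_infty_natSinv_lt (PosNum del0)).
  rewrite /lyap big1// => k _; rewrite /zeta (grid0 (gr n)) xw subrr expr0n//.
have aeB : {ae P, forall w, \forall q \near \oo, ~ B q w}.
  apply: aeW => w; pose Mk k := projT1 (cid (within_bounded T00 (@cX w T k))).
  have hMk k r : 0 <= r <= T -> `|X r w k 0| <= Mk k by move=> rT; rewrite /Mk; case: cid => /= u; exact.
  pose V := \sum_k (Mk k + `|x k 0|) ^+ 2.
  have hV n j : (j <= N n)%N -> lyap (zeta n) j w <= V.
    move=> jN; apply: ler_sum => k _.
    have rT : 0 <= t n j <= T by rewrite (grid_ge0 (gr n) jN) (grid_leT (gr n) jN).
    rewrite -real_normK ?num_real// ler_pXn2r ?nnegrE//; last first.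
      by rewrite addr_ge0// (le_trans _ (hMk k _ rT)).
    by apply: le_trans (ler_normB _ _) _; rewrite lerD2r; exact: hMk.
  near=> q; move=> [n _ [j jN]] /=; rewrite ltNge => /negP; apply.
  apply: le_trans (hV n j jN) _; near: q; exact: nbhs_infty_ger.
have pE := rE_cvg0 mE aeE; have pB := rE_cvg0 mB aeB.
pose kap := expR (11 * tb ^+ 2 * T).
have kap0 : 0 <= kap by exact: expR_ge0.
have [del del0 hdel] := @budget (kap + rE P (fun w => Yh w ^+ 2))
  (addr_ge0 kap0 (rE_ge0 P (fun w => sqr_ge0 (Yh w)))).
have i0 : 0 < del^-1 ^+ 3 by rewrite exprn_gt0// invr_gt0.
have [q hq] : exists q, fine (P (B q)) <= (del^-1 ^+ 3)^-1.
  by apply: (vanish pB) => [|n]; [rewrite invr_gt0|exact: fine_ge0].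
pose R2 : R := q%:R.
have R20 : 0 <= R2 by [].
(* The second summand bounds the second moment of [R2 + |lyap_mart|], which depends on the level but
   not on the grid. *)
have [del' del0' hdel'] := @budget (kap + (2 * R2 ^+ 2 + 2 * (4 * d%:R * R2 * KI * T)))
  (addr_ge0 kap0 (addr_ge0 (mulr_ge0 (ler0n _ 2) (sqr_ge0 _)) (mulr_ge0 (ler0n _ 2)
    (mulr_ge0 (mulr_ge0 (mulr_ge0 (mulr_ge0 (ler0n _ 4) (ler0n _ d)) R20) KI0) T00)))).
have i0' : 0 < del'^-1 ^+ 3 by rewrite exprn_gt0// invr_gt0.
have [n hn] : exists n, fine (P (E n)) <= Num.min (del^-1 ^+ 3)^-1 (del'^-1 ^+ 3)^-1.
  by apply: (vanish pE) => [|n]; [rewrite lt_min !invr_gt0 i0|exact: fine_ge0].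
move: hn; rewrite le_min => /andP[hn hn'].
have [xi hxi bound] := HS (N n) (t n) (gr n) (ltac:(by case: (gN n))) (ltac:(by case: (gN n))) (small n).
have hy : {ae P, forall w, Yh w <= a1 + a2 * lyap (zeta n) (N n) w}.
  apply: filterS hYh => w /(_ T T00) h; apply: le_trans (ler_norm _) _; apply: le_trans h _.
  have -> : a1 + a2 * lyap (zeta n) (N n) w =
    CY * (1 + (2 * enorm x ^+ 2 + 2 * lyap (zeta n) (N n) w)) by rewrite /a1 /a2; ring.
  apply: ler_wpM2l => //; rewrite lerD2l.
  have -> : lyap (zeta n) (N n) w = enorm (X T w - x) ^+ 2.
    by rewrite enorm_sqr_col /lyap /zeta (gridN (gr n)); apply: eq_bigr => k _; rewrite !mxE.
  by rewrite -[X in enorm X ^+ 2 <= _](subrKC x) enorm_sqrD.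
have := @rE_density_growth _ _ _ P hP d W hW T (N n) (t n) (gr n) d (zeta n) (dI n) C eta R2 KI
  C0 eta0 R20 KI0 (mart n) xi tb hxi Yh a1 a2 (E n) (B q) sqY a10 a20 hy (mE n) (mB q).
move=> /(_ _ _ _ _ del0 del0')/wrap[].
- move=> w nE; split.
    by rewrite leNgt; apply/negP => h; apply: nE; left.
  apply/eqP; rewrite eq_le lyap_ge0 andbT leNgt; apply/negP => h; apply: nE; right.
  exact: h.
- move=> w nB j jN; rewrite leNgt; apply/negP => h; apply: nB.
  by exists n => //; exists j => //=; exact: ltnW.
move=> hgrow.
have b1 : del^-1 ^+ 3 * fine (P (B q)) <= 1 by rewrite mulrC -ler_pdivlMr// mul1r.
have b2 : del^-1 ^+ 3 * fine (P (E n)) <= 1 by rewrite mulrC -ler_pdivlMr// mul1r.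
have b3 : del'^-1 ^+ 3 * fine (P (E n)) <= 1 by rewrite mulrC -ler_pdivlMr// mul1r.
apply: le_trans bound _; rewrite lerD2r lerD2r; apply: le_trans hgrow _.
apply: lerD; last by apply: ler_wpM2l => //; exact: lerD.
by apply: lerD; [rewrite lerD2l; exact: lerD|exact: lerD].
Unshelve. all: by end_near. Qed.

(** A linear function of [T] that is bounded above for all positive [T] cannot have a positive
    slope. *)
Lemma lambda_le : lam <= lam'.
Proof.
have [Kc hK] := lambda_growth; rewrite leNgt; apply/negP => h.
have l0 : 0 < lam - lam' by rewrite subr_gt0.
have T0 : 0 < (`|Kc| + 1) / (lam - lam') by rewrite divr_gt0// ltr_wpDl.
have := hK _ T0; rewrite mulrC divfK ?gt_eqF//.
by rewrite leNgt (le_lt_trans (ler_norm Kc))// ltrDl.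
Qed.

End comparison.

Lemma jmeas_section (R : realType) (dO : measure_display) (Omega : measurableType dO)
  (T : R) (g : R -> Omega -> R) : 0 <= T -> jmeas T g -> measurable_fun setT (g T).
Proof.
move=> T0 mg; have mp : measurable_fun setT (fun w : Omega => (T : measurableTypeR R, w)).
  exact: measurable_fun_pair.
apply: (measurable_comp _ _ mg mp); first exact: measurableX.
by move=> _ [w _ <-]; split=> //=; rewrite in_itv/= T0 lexx.
Qed.

Theorem theorem4p5 (R : realType) (d : nat) (hd : (0 < d)%N)
  (dO : measure_display) (Omega : measurableType dO) (P : probability Omega R)
  (hP : measure_is_complete P)
  (W : R -> Omega -> 'cV[R]_d) (hW : brownian_motion P W)
  (dd b : 'cV[R]_d -> 'cV[R]_d) (sigma : 'cV[R]_d -> 'M[R]_d)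
  (hA : hypA dd b sigma)
  (psi : 'cV[R]_d -> 'rV[R]_d -> R) (hpsi : hypP psi)
  (G : set 'cV[R]_d) (phi : 'cV[R]_d -> R) (hG : hypG G phi)
  (x : 'cV[R]_d) (hx : closure G x)
  (X : R -> Omega -> 'cV[R]_d) (K : Omega -> cumulative R R)
  (hX : reflected_sde P W (dd \+ b) sigma G phi x X K) :
  (forall (Y Y' : R -> Omega -> R) (Z Z' : R -> Omega -> 'rV[R]_d)
     (lambda lambda' : R),
     (forall t, 0 <= t -> measurable_fun setT (Y t)) ->
     (forall t, 0 <= t -> measurable_fun setT (Y' t)) ->
     continuous_process Y -> continuous_process Y' ->
     (exists C, {ae P, forall w, forall t, 0 <= t -> `|Y t w| <= C}) ->
     (exists C, {ae P, forall w, forall t, 0 <= t -> `|Y' t w| <= C}) ->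
     M2 P (bm_filtration P W) Z -> M2 P (bm_filtration P W) Z' ->
     ergodic_bsde P W psi X Y Z lambda ->
     ergodic_bsde P W psi X Y' Z' lambda' ->
     lambda = lambda')
  /\
  (forall (Y Y' : R -> Omega -> R) (Z Z' : R -> Omega -> 'rV[R]_d)
     (lambda lambda' : R),
     progressive (bm_filtration P W) Y -> progressive (bm_filtration P W) Y' ->
     continuous_process Y -> continuous_process Y' ->
     (exists C, {ae P, forall w, forall t, 0 <= t ->
        `|Y t w| <= C * (1 + enorm (X t w) ^+ 2)}) ->
     (exists C', {ae P, forall w, forall t, 0 <= t ->
        `|Y' t w| <= C' * (1 + enorm (X t w) ^+ 2)}) ->
     M2 P (bm_filtration P W) Z -> M2 P (bm_filtration P W) Z' ->
     ergodic_bsde P W psi X Y Z lambda ->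
     ergodic_bsde P W psi X Y' Z' lambda' ->
     lambda = lambda').
Proof.
(* Common core of both claims; equality comes from the one-sided comparison with the two solutions
   in either order. *)
have main (Y Y' : R -> Omega -> R) (Z Z' : R -> Omega -> 'rV[R]_d) (lam lam' : R) :
    (forall t, 0 <= t -> measurable_fun setT (Y t)) ->
    (forall t, 0 <= t -> measurable_fun setT (Y' t)) ->
    (exists C, {ae P, forall w t, 0 <= t -> `|Y t w| <= C * (1 + enorm (X t w) ^+ 2)}) ->
    (exists C, {ae P, forall w t, 0 <= t -> `|Y' t w| <= C * (1 + enorm (X t w) ^+ 2)}) ->
    ergodic_bsde P W psi X Y Z lam -> ergodic_bsde P W psi X Y' Z' lam' -> lam = lam'.
  move=> mY mY' [C hC] [C' hC'] hY hY'.
  have bd : {ae P, forall w t, 0 <= t ->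
      `|Y t w - Y' t w| <= (`|C| + `|C'|) * (1 + enorm (X t w) ^+ 2)}.
    apply: filterS2 hC hC' => w h h' t t0; apply: le_trans (ler_normB _ _) _.
    have V0 : 0 <= 1 + enorm (X t w) ^+ 2 by rewrite addr_ge0// sqr_ge0.
    rewrite mulrDl; apply: lerD; [apply: le_trans (h t t0) _|apply: le_trans (h' t t0) _];
      by apply: ler_wpM2r => //; exact: ler_norm.
  have bd' : {ae P, forall w t, 0 <= t ->
      `|Y' t w - Y t w| <= (`|C| + `|C'|) * (1 + enorm (X t w) ^+ 2)}.
    by apply: filterS bd => w h t t0; rewrite distrC; exact: h.
  have c0 : 0 <= `|C| + `|C'| by rewrite addr_ge0.
  apply/eqP; rewrite eq_le.
  rewrite (lambda_le hP hW hA hpsi hG hx hX mY mY' c0 bd hY hY').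
  exact: (lambda_le hP hW hA hpsi hG hx hX mY' mY c0 bd' hY' hY).
split=> Y Y' Z Z' lam lam'.
  move=> mY mY' _ _ hC hC' _ _; apply: main => //.
    (* A bounded solution has quadratic growth because [1 + |X|^2 >= 1]; the absolute value is taken
       since the sign of [C] is not prescribed. *)
    case: hC => C hC; exists `|C|; apply: filterS hC => w h t t0.
    apply: le_trans (h t t0) _; apply: le_trans (ler_norm C) _.
    by rewrite ler_peMr// lerDl sqr_ge0.
  case: hC' => C' hC'; exists `|C'|; apply: filterS hC' => w h t t0.
  apply: le_trans (h t t0) _; apply: le_trans (ler_norm C') _.
  by rewrite ler_peMr// lerDl sqr_ge0.
move=> pY pY' _ _ hC hC' _ _; apply: main => // t t0.
  by apply: (jmeas_section t0); exact: (progressive_jmeas hP hW).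
by apply: (jmeas_section t0); exact: (progressive_jmeas hP hW).
Qed.
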